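(* Let $(\sigma_q,V)$ be a $U_q(\mathfrak{p})$-module. Then the map $\pi_{q,V}$ defined below is a homomorphism of $\mathbb{C}$-algebras $U_q(\mathfrak{sl}_{n+m}(\mathbb{C}))\to\mathcal{A}^q\otimes_{\mathbb{C}}\mathrm{End}\,V$, given on generators by: for $i=1,\dots,n-1$: $\pi_{q,V}(f_i)=\rho_q(f_i)\otimes\mathrm{id}_V+\rho_q(k_i)\otimes\sigma_q(f_i)$, $\pi_{q,V}(e_i)=\rho_q(e_i)\otimes\sigma_q(k_i^{-1})+1\otimes\sigma_q(e_i)$, $\pi_{q,V}(k_i)=\rho_q(k_i)\otimes\sigma_q(k_i)$; for $i=1,\dots,m-1$: $\pi_{q,V}(f_{n+i})=\rho_q(f_{n+i})\otimes\mathrm{id}_V+\rho_q(k_{n+i}^{-1})\otimes\sigma_q(f_{n+i})$, $\pi_{q,V}(e_{n+i})=\rho_q(e_{n+i})\otimes\sigma_q(k_{n+i})+1\otimes\sigma_q(e_{n+i})$, $\pi_{q,V}(k_{n+i})=\rho_q(k_{n+i})\otimes\sigma_q(k_{n+i})$; and $\pi_{q,V}(f_n)=x_{1,n}\prod_{t=1}^{n-1}\gamma_{1,t}\otimes\mathrm{id}_V$, $\pi_{q,V}(k_n)=\rho_q(k_n)\otimes\sigma_q(k_n)$, $$\begin{aligned}\pi_{q,V}(e_n)&=\sum_{k=1}^{n-1}\pi_{q,V}(E_{n,k}k_n)\Big(\prod_{t=1}^k\gamma_{1,t}\,\partial_{1,k}\otimes\mathrm{id}_V\Big)-\sum_{k=2}^m\prod_{t=k}^m\gamma_{t,n}\,\partial_{k,n}\otimes\sigma_q(k_n^{-1}E_{n+k,n+1})\\&\quad-\sum_{k=1}^m\prod_{t=1}^{k-1}\gamma_{t,n}\prod_{t=k+1}^m\gamma_{t,n}^{-1}\,x_{k,n}\partial_{k,n}\partial_{1,n}\otimes\sigma_q(k_n)+1\otimes\sigma_q(e_n)+\prod_{t=1}^m\gamma_{t,n}\,\partial_{1,n}\otimes\frac{\sigma_q(k_n)-\sigma_q(k_n^{-1})}{q-q^{-1}},\end{aligned}$$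 where, for $k=1,\dots,n-1$, $$\pi_{q,V}(E_{n,k})=\rho_q(E_{n,k})\otimes\mathrm{id}_V+\rho_q(K_{k,n})\otimes\sigma_q(E_{n,k})+(q-q^{-1})\sum_{k<\ell<n}\rho_q(E_{\ell,k}K_{\ell,n})\otimes\sigma_q(E_{n,\ell}).$$ (Products of operators denote composition.)
   Context: Let $n,m\ge1$, $N=n+m$, $q\in\mathbb{C}^\times$, $q\neq\pm1$. $U_q(\mathfrak{sl}_N(\mathbb{C}))$ is the unital associative $\mathbb{C}$-algebra generated by $e_i,f_i,k_i^{\pm1}$ ($1\le i\le N-1$) with relations $k_ik_i^{-1}=k_i^{-1}k_i=1$, $k_ik_j=k_jk_i$, $k_ie_jk_i^{-1}=q^{a_{ij}}e_j$, $k_if_jk_i^{-1}=q^{-a_{ij}}f_j$, $e_if_j-f_je_i=\delta_{ij}\frac{k_i-k_i^{-1}}{q-q^{-1}}$ and the quantum Serre relations ($e_i^2e_j-(q+q^{-1})e_ie_je_i+e_je_i^2=0$ and the same for $f$'s if $|i-j|=1$; $e_ie_j=e_je_i$, $f_if_j=f_jf_i$ if $|i-j|>1$), with $a_{ii}=2$, $a_{ij}=-1$ if $|i-j|=1$, $0$ otherwise. Root vectors: $E_{i,i+1}=e_i$, $E_{i+1,i}=f_i$, and for $j-i\ge2$, $E_{i,j}=E_{i,j-1}E_{j-1,j}-qE_{j-1,j}E_{i,j-1}$, $E_{j,i}=E_{j,i+1}E_{i+1,i}-q^{-1}E_{i+1,i}E_{j,i+1}$; $K_{i,j}=k_ik_{i+1}\cdots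 k_{j-1}$ for $i<j$. $U_q(\mathfrak{p})$ is the subalgebra generated by $e_i,k_i^{\pm1}$ ($1\le i\le N-1$) and $f_i$ for $i\ne n$; $\sigma_q$ denotes the action of $U_q(\mathfrak{p})$ on $V$. $U_q(\mathfrak{l})$ is the subalgebra generated by $k_i^{\pm1}$ ($1\le i\le N-1$) and $e_i,f_i$ for $i\neq n$, a Hopf algebra with $\Delta(k_i)=k_i\otimes k_i$, $S(k_i)=k_i^{-1}$, and for $1\le i\le n-1$: $\Delta(e_i)=e_i\otimes k_i^{-1}+1\otimes e_i$, $\Delta(f_i)=f_i\otimes1+k_i\otimes f_i$, $S(e_i)=-e_ik_i$, $S(f_i)=-k_i^{-1}f_i$; for $n+1\le i\le N-1$: $\Delta(e_i)=e_i\otimes k_i+1\otimes e_i$, $\Delta(f_i)=f_i\otimes1+k_i^{-1}\otimes f_i$, $S(e_i)=-e_ik_i^{-1}$, $S(f_i)=-k_if_i$. Adjoint action $\mathrm{ad}(a)b=\sum a_{(1)}bS(a_{(2)})$. $U_q(\bar{\mathfrak{u}})$ is the subalgebra generated by $E_{n+j,k}$ ($1\le j\le m$, $1\le k\le n$); it is $\mathrm{ad}(U_q(\mathfrak{l}))$-stable with basis the ordered monomials $E^r=E_{n+1,1}^{r_{1,1}}\cdots E_{n+1,n}^{r_{1,n}}\cdots E_{n+m,1}^{r_{m,1}}\cdots E_{n+m,n}^{r_{m,n}}$, $r\in M_{m,n}(\mathbb{N}_0)$, and $u\otimes v\mapsto u\otimes_{U_q(\mathfrak{p})}v$ is a linear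 isomorphism $U_q(\bar{\mathfrak{u}})\otimes_{\mathbb{C}}V\to M:=U_q(\mathfrak{sl}_N(\mathbb{C}))\otimes_{U_q(\mathfrak{p})}V$. $\mathbb{C}[x]$ is the commutative polynomial ring in $x_{j,k}$ ($1\le j\le m$, $1\le k\le n$), $x^r=\prod x_{j,k}^{r_{j,k}}$; $\Phi\colon\mathbb{C}[x]\to U_q(\bar{\mathfrak{u}})$ is the linear isomorphism $x^r\mapsto E^r$; $\rho_q(a)=\Phi^{-1}\circ\mathrm{ad}(a)\circ\Phi$ for $a\in U_q(\mathfrak{l})$. $\gamma_{j,k}$ is the algebra automorphism of $\mathbb{C}[x]$ with $x_{s,t}\mapsto q^{\delta_{js}\delta_{kt}}x_{s,t}$; $\partial_{j,k}(x^r)=[r_{j,k}]_q\,x^{r-1_{j,k}}$ with $[v]_q=\frac{q^v-q^{-v}}{q-q^{-1}}$ and $1_{j,k}$ the matrix unit; $x_{j,k}$ acts by multiplication. The quantum Weyl algebra $\mathcal{A}^q$ is the subalgebra of $\mathrm{End}\,\mathbb{C}[x]$ generated by all $x_{j,k}$, $\partial_{j,k}$, $\gamma_{j,k}^{\pm1}$. For $a\in U_q(\mathfrak{sl}_N(\mathbb{C}))$, $\pi_{q,V}(a)$ is the linear operator on $\mathbb{C}[x]\otimes_{\mathbb{C}}V$ defined by $\Theta(\pi_{q,V}(a)(x^r\otimes v))=a\cdot\Theta(x^r\otimes v)$, where $\Theta\colon\mathbb{C}[x]\otimes V\to M$, $x^r\otimes v\mapsto E^r\otimes_{U_q(\mathfrak{p})}v$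 (a linear isomorphism). *)

(* Defs.v *)
From HB Require Import structures.
From mathcomp Require Import all_boot all_order all_algebra.
From mathcomp Require Import reals Rstruct.
From mathcomp.real_closed Require Import complex.
From mathcomp Require Import mpoly.
Set Implicit Arguments. Unset Strict Implicit. Unset Printing Implicit Defensive.
Import GRing.Theory.
Local Open Scope ring_scope.

Definition CC : numClosedFieldType := complex Rdefinitions.R.

(* Generators e_i, f_i, k_i, k_i^{-1} of U_q(sl_N) in a C-algebra A    *)
(* (indices are natural numbers, meaningful for 1 <= i <= N-1).        *)
Record gens (A : Type) := Gens { ge : nat -> A; gf : nat -> A; gk : nat -> A; gki : nat -> A }.

Definition cartan (i j : nat) : int :=
  if i == j then 2%:Z else if (i == j.+1) || (j == i.+1) then (-1)%R else 0%R.

Definition Uq_rels (N : nat) (q : CC) (A : algType CC) (g : gens A) : Prop :=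
  forall i j, (0 < i < N)%N -> (0 < j < N)%N ->
    gk g i * gki g i = 1 /\ gki g i * gk g i = 1 /\
    gk g i * gk g j = gk g j * gk g i /\
    gk g i * ge g j * gki g i = q ^ cartan i j *: ge g j /\
    gk g i * gf g j * gki g i = q ^ (- cartan i j) *: gf g j /\
    ge g i * gf g j - gf g j * ge g i =
      (if i == j then (q - q^-1)^-1 *: (gk g i - gki g i) else 0) /\
    (((i == j.+1) || (j == i.+1)) ->
       ge g i ^+ 2 * ge g j - (q + q^-1) *: (ge g i * ge g j * ge g i) + ge g j * ge g i ^+ 2 = 0 /\
       gf g i ^+ 2 * gf g j - (q + q^-1) *: (gf g i * gf g j * gf g i) + gf g j * gf g i ^+ 2 = 0) /\
    (((j.+1 < i) || (i.+1 < j))%N ->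
       ge g i * ge g j = ge g j * ge g i /\ gf g i * gf g j = gf g j * gf g i).

Definition is_alg_hom (A B : algType CC) (phi : A -> B) : Prop :=
  (forall (c : CC) x y, phi (c *: x + y) = c *: phi x + phi y) /\
  phi 1 = 1 /\ (forall x y, phi (x * y) = phi x * phi y).

Definition maps_gens (N : nat) (A B : algType CC) (phi : A -> B) (g : gens A) (g' : gens B) :=
  forall i, (0 < i < N)%N ->
    phi (ge g i) = ge g' i /\ phi (gf g i) = gf g' i /\
    phi (gk g i) = gk g' i /\ phi (gki g i) = gki g' i.

(* (U, g) is U_q(sl_N): the C-algebra generated by the g's subject to   *)
(* the relations Uq_rels, i.e. the initial such algebra.               *)
Definition is_Uq (N : nat) (q : CC) (U : algType CC) (g : gens U) : Prop :=
  Uq_rels N q g /\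
  forall (A : algType CC) (g' : gens A), Uq_rels N q g' ->
    (exists phi : U -> A, is_alg_hom phi /\ maps_gens N phi g g') /\
    (forall phi1 phi2 : U -> A,
        is_alg_hom phi1 -> maps_gens N phi1 g g' ->
        is_alg_hom phi2 -> maps_gens N phi2 g g' -> phi1 =1 phi2).

Inductive subalg (A : algType CC) (G : A -> Prop) : A -> Prop :=
| subalg_gen x : G x -> subalg G x
| subalg_one : subalg G 1
| subalg_lin (c : CC) x y : subalg G x -> subalg G y -> subalg G (c *: x + y)
| subalg_mul x y : subalg G x -> subalg G y -> subalg G (x * y).

Definition Uqp (n N : nat) (A : algType CC) (g : gens A) : A -> Prop :=
  subalg (fun x => exists i, (0 < i < N)%N /\
     (x = ge g i \/ x = gk g i \/ x = gki g i \/ (i != n /\ x = gf g i))).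

Definition Uql (n N : nat) (A : algType CC) (g : gens A) : A -> Prop :=
  subalg (fun x => exists i, (0 < i < N)%N /\
     (x = gk g i \/ x = gki g i \/ (i != n /\ (x = ge g i \/ x = gf g i)))).

(* Root vectors.  Eup i d = E_{i,i+d+1},  Elow j d = E_{j,j-d-1}. *)
Fixpoint Eup (q : CC) (A : algType CC) (g : gens A) (i d : nat) : A :=
  match d with
  | 0 => ge g i
  | d'.+1 => Eup q g i d' * ge g (i + d) - q *: (ge g (i + d) * Eup q g i d')
  end.

Fixpoint Elow (q : CC) (A : algType CC) (g : gens A) (j d : nat) : A :=
  match d with
  | 0 => gf g j.-1
  | d'.+1 => Elow q g j d' * gf g (j - d'.+2) - q^-1 *: (gf g (j - d'.+2) * Elow q g j d')
  end.

Definition Root (q : CC) (A : algType CC) (g : gens A) (i j : nat) : A :=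
  if (i < j)%N then Eup q g i (j - i - 1)
  else if (j < i)%N then Elow q g i (i - j - 1) else 0.

Definition Kprod (A : algType CC) (g : gens A) (i j : nat) : A :=
  \prod_(i <= t < j) gk g t.

(* Modules.  act : A -> W -> W is a module structure of the subalgebra *)
(* P of A on W (only its values on P matter).                          *)
Definition is_lin (W1 W2 : lmodType CC) (h : W1 -> W2) : Prop :=
  forall (c : CC) x y, h (c *: x + y) = c *: h x + h y.

Definition is_mod (A : algType CC) (P : A -> Prop) (W : lmodType CC) (act : A -> W -> W) : Prop :=
  (forall w, act 1 w = w) /\
  (forall a, P a -> is_lin (act a)) /\
  (forall (c : CC) a b, P a -> P b -> forall w, act (c *: a + b) w = c *: act a w + act b w) /\
  (forall a b, P a -> P b -> forall w, act (a * b) w = act a (act b w)).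

(* (M, act, incl) is the induced module A \otimes_P V, characterised by *)
(* its universal property (incl v = 1 \otimes_P v).                     *)
Definition is_induced (A : algType CC) (P : A -> Prop) (V : lmodType CC) (sigma : A -> V -> V)
    (M : lmodType CC) (act : A -> M -> M) (incl : V -> M) : Prop :=
  is_mod (fun _ => True) act /\ is_lin incl /\
  (forall p, P p -> forall v, incl (sigma p v) = act p (incl v)) /\
  forall (W : lmodType CC) (actW : A -> W -> W) (j : V -> W),
    is_mod (fun _ => True) actW -> is_lin j ->
    (forall p, P p -> forall v, j (sigma p v) = actW p (j v)) ->
    (exists h : M -> W, is_lin h /\ (forall a w, h (act a w) = actW a (h w)) /\
                        (forall v, h (incl v) = j v)) /\
    (forall h1 h2 : M -> W,
        is_lin h1 -> (forall a w, h1 (act a w) = actW a (h1 w)) -> (forall v, h1 (incl v) = j v) ->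
        is_lin h2 -> (forall a w, h2 (act a w) = actW a (h2 w)) -> (forall v, h2 (incl v) = j v) ->
        h1 =1 h2).

(* The adjoint action of U_q(l) on U: ad : U_q(l) -> End U is the      *)
(* algebra map with ad(a) b = sum a_(1) b S(a_(2)) on generators, i.e. *)
(* (unfolding Delta and S of the context):                             *)
Definition is_ad (n N : nat) (U : algType CC) (g : gens U) (ad : U -> U -> U) : Prop :=
  is_mod (Uql n N g) ad /\
  forall i, (0 < i < N)%N -> forall b : U,
    ad (gk g i) b = gk g i * b * gki g i /\
    ad (gki g i) b = gki g i * b * gk g i /\
    ((i < n)%N -> ad (ge g i) b = ge g i * b * gk g i - b * ge g i * gk g i /\
                  ad (gf g i) b = gf g i * b - gk g i * b * gki g i * gf g i) /\
    ((n < i)%N -> ad (ge g i) b = ge g i * b * gki g i - b * ge g i * gki g i /\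
                  ad (gf g i) b = gf g i * b - gki g i * b * gk g i * gf g i).

(* The polynomial ring C[x_{j,k} : 1<=j<=m, 1<=k<=n].  Under the       *)
(* standing hypotheses n, m >= 1 the number of variables                *)
(* (m*n).-1.+1 equals m*n; x_{j,k} is variable number (j-1)*n+(k-1).    *)
Definition nv (n m : nat) : nat := (m * n).-1.+1.
Definition Cx (n m : nat) := {mpoly CC[nv n m]}.
Definition vidx (n m : nat) (j k : nat) : 'I_(nv n m) := inord (j.-1 * n + k.-1).

Definition Emon (n m : nat) (q : CC) (U : algType CC) (g : gens U) (r : 'X_{1..nv n m}) : U :=
  \prod_(j < m) \prod_(k < n) Root q g (n + j.+1) k.+1 ^+ r (vidx n m j.+1 k.+1).

Definition Phi (n m : nat) (q : CC) (U : algType CC) (g : gens U) (p : Cx n m) : U :=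
  \sum_(r <- msupp p) p@_r *: Emon q g r.

(* rho_q(a) = Phi^{-1} o ad(a) o Phi, for a in U_q(l) *)
Definition is_rho (n m : nat) (q : CC) (U : algType CC) (g : gens U) (ad : U -> U -> U)
    (rho : U -> Cx n m -> Cx n m) : Prop :=
  forall a, Uql n (n + m) g a -> forall p, Phi q g (rho a p) = ad a (Phi q g p).

(* Theta(p \otimes w) = sum_r p_r E^r \otimes_{U_q(p)} w *)
Definition Theta (n m : nat) (q : CC) (U : algType CC) (g : gens U) (V M : lmodType CC)
    (act : U -> M -> M) (incl : V -> M) (p : Cx n m) (w : V) : M :=
  \sum_(r <- msupp p) p@_r *: act (Emon q g r) (incl w).

Definition qint (q : CC) (v : nat) : CC := (q ^+ v - q ^- v) / (q - q^-1).

Definition xop (n m : nat) (j k : nat) (p : Cx n m) : Cx n m := 'X_(vidx n m j k) * p.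

Definition gam (n m : nat) (q : CC) (j k : nat) (p : Cx n m) : Cx n m :=
  \sum_(r <- msupp p) (q ^+ r (vidx n m j k) * p@_r) *: 'X_[r].

Definition gami (n m : nat) (q : CC) (j k : nat) (p : Cx n m) : Cx n m :=
  \sum_(r <- msupp p) (q ^- r (vidx n m j k) * p@_r) *: 'X_[r].

Definition dop (n m : nat) (q : CC) (j k : nat) (p : Cx n m) : Cx n m :=
  \sum_(r <- msupp p) (qint q (r (vidx n m j k)) * p@_r) *: 'X_[(r - U_(vidx n m j k))%MM].

Definition oprod (T : Type) (l : seq (T -> T)) : T -> T := foldr (fun F G => F \o G) id l.

Inductive inAq (n m : nat) (q : CC) : (Cx n m -> Cx n m) -> Prop :=
| inAq_x j k : (0 < j <= m)%N -> (0 < k <= n)%N -> inAq q (xop j k)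
| inAq_d j k : (0 < j <= m)%N -> (0 < k <= n)%N -> inAq q (dop q j k)
| inAq_g j k : (0 < j <= m)%N -> (0 < k <= n)%N -> inAq q (gam q j k)
| inAq_gi j k : (0 < j <= m)%N -> (0 < k <= n)%N -> inAq q (gami q j k)
| inAq_id : inAq q id
| inAq_lin (c : CC) F G : inAq q F -> inAq q G -> inAq q (fun p => c *: F p + G p)
| inAq_comp F G : inAq q F -> inAq q G -> inAq q (F \o G)
| inAq_ext F G : inAq q F -> F =1 G -> inAq q G.

(* Main.v *)
Require Import Defs.
From HB Require Import structures.
From mathcomp Require Import all_boot all_order all_algebra.
From mathcomp Require Import reals Rstruct.
From mathcomp.real_closed Require Import complex.
From mathcomp Require Import mpoly.
From mathcomp Require Import boolp ring zify.
Set Implicit Arguments. Unset Strict Implicit. Unset Printing Implicit Defensive.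
Import GRing.Theory.
Local Open Scope ring_scope.

(**
  The value of [a * E^r ⊗ v] is computed by moving the generator [a] past [E^r]:
  the Levi part acts through the coproduct and so through [ad], [f_n] is itself
  one of the root vectors, and the commutator with [e_n] is a derivation.  What
  this needs is the value of [ad e_i], [ad f_i] on the root vectors E_{n+j,k} and
  their q-commutation relations; the q-Leibniz rule then turns [ad a] into an
  element of the quantum Weyl algebra.

  Deriving these relations from the Serre relations meets a division by [q + q^-1];
  since [q^2 = -1] is allowed, they are derived instead from the existence of
  [rho_q], that is, from the stability of the span of the ordered monomials under
  [ad].  An element of this span is determined by its
  value on a vacuum vector; together with the grading by simple roots this leaves
  one possible monomial, whose coefficient is found by applying some [ad e_i].
  The representation with the vacuum vector is a tensor product of q-oscillator
  representations, with copy [a] Fourier transformed at site [a], so that [E^r]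
  sends the vacuum to a nonzero multiple of a single basis vector.
*)

(** * Identities in noncommutative algebras *)

(** The hypothesis on [U] supplies only relations and initiality, so the independence of the ordered
    monomials has to be proved; it is what allows operators to be read off through [Phi]. Since [q]
    may be a root of unity, two usual tools degenerate: the weights of the k_i do not separate
    degrees, and q-integers may vanish. Degrees are therefore detected by automorphisms multiplying
    f_c by 2, a number with distinct integer powers, and the basis vectors are created only by the
    operators [sy], whose coefficient is 1. In an untransformed oscillator representation every
    E_{l,k} contains a lowering operator at site k and kills the vacuum; after the exchange at site
    a, E_{n+j,a} creates one quantum at a and one at n+j, and one copy per column keeps the
    exponents apart. In the formula for e_n, the last two sums of operators with k_n come from the
    corner E_{n+1,n}: its commutator with e_n leaves G^-1 k_n - G k_n^-1, rewritten as -(G - G^-1)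
    k_n + G (k_n - k_n^-1), and the q-integer behind G - G^-1 is split along the column. *)

Inductive nexp : Type :=
| NAtom of nat | NZero | NOne
| NAdd of nexp & nexp | NOpp of nexp | NMul of nexp & nexp | NScale of CC & nexp.

Fixpoint ndenote (A : algType CC) (env : nat -> A) (t : nexp) : A :=
  match t with
  | NAtom i => env i
  | NZero => 0
  | NOne => 1
  | NAdd a b => ndenote env a + ndenote env b
  | NOpp a => - ndenote env a
  | NMul a b => ndenote env a * ndenote env b
  | NScale c a => c *: ndenote env a
  end.

Fixpoint nmapc (f : CC -> CC) (l : list (CC * list nat)) : list (CC * list nat) :=
  match l with
  | nil => nil
  | cons (c, w) l' => cons (f c, w) (nmapc f l')
  end.

(** The list functions are private copies, and words are compared by structural recursion, so that
    [cbv] with an explicit list of constants evaluates the checker and leaves the scalar operations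
    folded. *)
Fixpoint napp (T : Type) (l l' : list T) : list T :=
  match l with nil => l' | cons x l1 => cons x (napp l1 l') end.

Fixpoint nmul1 (c : CC) (w : list nat) (l : list (CC * list nat)) :=
  match l with
  | nil => nil
  | cons (c', w') l' => cons (c * c', napp w w') (nmul1 c w l')
  end.

Fixpoint nmull (l1 l2 : list (CC * list nat)) : list (CC * list nat) :=
  match l1 with
  | nil => nil
  | cons (c, w) l' => napp (nmul1 c w l2) (nmull l' l2)
  end.

Fixpoint nnorm (t : nexp) : list (CC * list nat) :=
  match t with
  | NAtom i => cons (1, cons i nil) nil
  | NZero => nil
  | NOne => cons (1, nil) nil
  | NAdd a b => napp (nnorm a) (nnorm b)
  | NOpp a => nmapc -%R (nnorm a)
  | NMul a b => nmull (nnorm a) (nnorm b)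
  | NScale c a => nmapc ( *%R c) (nnorm a)
  end.

Fixpoint neqn (i j : nat) : bool :=
  match i, j with
  | O, O => true | S i', S j' => neqn i' j' | _, _ => false
  end.

Fixpoint neqw (u v : list nat) : bool :=
  match u, v with
  | nil, nil => true
  | cons i u', cons j v' => if neqn i j then neqw u' v' else false
  | _, _ => false
  end.

Fixpoint ncoef (w : list nat) (l : list (CC * list nat)) : CC :=
  match l with
  | nil => 0
  | cons (c, w') l' => if neqw w w' then c + ncoef w l' else ncoef w l'
  end.

Fixpoint nrest (w : list nat) (l : list (CC * list nat)) : list (CC * list nat) :=
  match l with
  | nil => nil
  | cons (c, w') l' => if neqw w w' then nrest w l' else cons (c, w') (nrest w l')
  end.

(** Scalars of [CC] cannot be compared by computation, so the check is a conjunction of scalar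
    equations, one for each word. Every round removes at least the head, hence the length of the
    list is enough fuel. *)
Fixpoint ncheck (fuel : nat) (l : list (CC * list nat)) : Prop :=
  match fuel, l with
  | _, nil => True
  | O, _ => False
  | S k, cons (c, w) l' => (c + ncoef w l' = 0) /\ ncheck k (nrest w l')
  end.

Fixpoint nlen (T : Type) (l : list T) : nat :=
  match l with nil => O | cons _ l' => S (nlen l') end.

Section NcringSound.
Variables (A : algType CC) (env : nat -> A).

Fixpoint wden (w : list nat) : A :=
  match w with nil => 1 | cons i w' => env i * wden w' end.

Fixpoint lden (l : list (CC * list nat)) : A :=
  match l with nil => 0 | cons (c, w) l' => c *: wden w + lden l' end.

Lemma wden_app u v : wden (napp u v) = wden u * wden v.
Proof. by elim: u => [|i u IH] /=; rewrite ?mul1r // IH mulrA. Qed.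

Lemma lden_app u v : lden (napp u v) = lden u + lden v.
Proof. by elim: u => [|[c w] u IH] /=; rewrite ?add0r // IH addrA. Qed.

Lemma lden_opp l : lden (nmapc -%R l) = - lden l.
Proof. by elim: l => [|[c w] u IH] /=; rewrite ?oppr0 // IH opprD scaleNr. Qed.

Lemma lden_scale a l : lden (nmapc ( *%R a) l) = a *: lden l.
Proof. by elim: l => [|[c w] u IH] /=; rewrite ?scaler0 // IH scalerDr scalerA. Qed.

Lemma lden_mul1 c w l : lden (nmul1 c w l) = (c *: wden w) * lden l.
Proof.
elim: l => [|[c' w'] u IH] /=; rewrite ?mulr0 // IH mulrDr wden_app.
by rewrite -!scalerAl -scalerAr scalerA.
Qed.

Lemma lden_mul l1 l2 : lden (nmull l1 l2) = lden l1 * lden l2.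
Proof.
by elim: l1 => [|[c w] u IH] /=; rewrite ?mul0r // lden_app IH lden_mul1 mulrDl.
Qed.

Lemma nnormP t : lden (nnorm t) = ndenote env t.
Proof.
elim: t => /= [i| | |a <- b <-|a <-|a <- b <-|c a <-];
  rewrite ?scale1r ?mulr1 ?addr0 //.
- by rewrite lden_app.
- by rewrite lden_opp.
- by rewrite lden_mul.
- by rewrite lden_scale.
Qed.

Lemma neqnP i j : neqn i j -> i = j.
Proof. by elim: i j => [|i IH] [|j] //= /IH ->. Qed.

Lemma neqwP u v : neqw u v -> u = v.
Proof.
elim: u v => [|i u IH] [|j v] //=.
by case E: (neqn i j) => // /IH ->; rewrite (neqnP E).
Qed.

Lemma lden_split w l : lden l = ncoef w l *: wden w + lden (nrest w l).
Proof.
elim: l => [|[c w'] l IH] /=; first by rewrite scale0r add0r.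
case E: (neqw w w') => /=; rewrite IH; first by rewrite (neqwP E) scalerDl addrA.
by rewrite addrCA.
Qed.

Lemma ncheckP fuel l : ncheck fuel l -> lden l = 0.
Proof.
elim: fuel l => [|k IH] [|[c w] l] //= [h /IH].
by rewrite (lden_split w l) => ->; rewrite addr0 -scalerDl h scale0r.
Qed.

Lemma ncring_sound a b :
  (let l := nnorm (NAdd a (NOpp b)) in ncheck (nlen l) l) ->
  ndenote env a = ndenote env b.
Proof.
move=> /= /ncheckP; rewrite lden_app lden_opp !nnormP => /eqP.
by rewrite subr_eq0 => /eqP.
Qed.
End NcringSound.

Ltac nc_idx x env :=
  lazymatch env with
  | @cons _ ?y ?e =>
    match constr:(Set) with
    | _ => let _ := match constr:(Set) with _ => constr_eq_strict x y end in constr:(O)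
    | _ => let k := nc_idx x e in constr:(S k)
    end
  end.

Ltac nc_in x env :=
  lazymatch env with
  | @nil _ => constr:(false)
  | @cons _ ?y ?e =>
    match constr:(Set) with
    | _ => let _ := match constr:(Set) with _ => constr_eq_strict x y end in constr:(true)
    | _ => nc_in x e
    end
  end.

Ltac nc_atoms t env :=
  lazymatch t with
  | ?a + ?b => let e := nc_atoms a env in nc_atoms b e
  | - ?a => nc_atoms a env
  | ?a * ?b => let e := nc_atoms a env in nc_atoms b e
  | ?c *: ?a => nc_atoms a env
  | 0 => env
  | 1 => env
  | _ => let b := nc_in t env in
         lazymatch b with true => env | false => constr:(cons t env) end
  end.

Ltac nc_reify t env :=
  lazymatch t with
  | ?a + ?b => let x := nc_reify a env in let y := nc_reify b env in constr:(NAdd x y)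
  | - ?a => let x := nc_reify a env in constr:(NOpp x)
  | ?a * ?b => let x := nc_reify a env in let y := nc_reify b env in constr:(NMul x y)
  | ?c *: ?a => let x := nc_reify a env in constr:(NScale c x)
  | 0 => constr:(NZero)
  | 1 => constr:(NOne)
  | _ => let k := nc_idx t env in constr:(NAtom k)
  end.

(* [ncring tac] compares the coefficients of both sides in the free algebra on
   the atoms; [tac] has to prove the resulting identities between scalars. *)
Ltac ncring tac :=
  rewrite ?expr2 ?exprS ?expr0;
  lazymatch goal with
  | |- @eq ?T ?l ?r =>
    let env := nc_atoms l (@nil T) in
    let env := nc_atoms r env in
    let a := nc_reify l env in
    let b := nc_reify r env in
    let h := fresh in
    have h := @ncring_sound _ (fun i => nth 0 env i) a b;
    cbv beta iota zeta delta [nnorm ncheck nlen ncoef nrest neqw neqn nmull nmul1 napp nmapc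
       ndenote nth] in h;
    move: h; apply; repeat split; tac
  end.

(** The form of a rewrite rule that also fires inside a left-associated product. *)
Lemma mulr_rule (A : algType CC) (x y w : A) : y * x = w -> forall z, z * y * x = z * w.
Proof. by move=> h z; rewrite -mulrA h. Qed.

(** * Linear operators on functions of occupation numbers *)

(* An occupation number is attached to every pair (a, i): oscillator copy a, site i. *)
Definition occ := nat * nat -> nat.

(** Operators act on all functions of occupation numbers, not only on finitely supported ones: no
    support condition has to be carried along, and equality of operators is pointwise. *)
Record lop := Lop {
  lfun :> (occ -> CC) -> occ -> CC;
  lfunP : forall (c : CC) F G mu,
    lfun (fun nu => c * F nu + G nu) mu = c * lfun F mu + lfun G mu }.

Lemma lopP (S T : lop) : (forall F mu, S F mu = T F mu) -> S = T.
Proof.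
case: S T => [s hs] [t ht] /= h; have E : s = t.
  by apply/funext => F; apply/funext => mu; apply: h.
by rewrite E in hs *; congr Lop; apply: Prop_irrelevance.
Qed.

HB.instance Definition _ := gen_eqMixin lop.
HB.instance Definition _ := gen_choiceMixin lop.

Fact lop_id_lin (c : CC) (F G : occ -> CC) (mu : occ) : c * F mu + G mu = c * F mu + G mu.
Proof. by []. Qed.

Definition lop_one := Lop lop_id_lin.
Fact lop_zero_lin (c : CC) (F G : occ -> CC) (mu : occ) : (0 : CC) = c * 0 + 0.
Proof. by rewrite mulr0 addr0. Qed.

Definition lop_zero := @Lop (fun _ _ => 0) lop_zero_lin.
Fact lop_add_lin (S T : lop) (c : CC) F G mu :
  (S (fun nu => c * F nu + G nu) mu + T (fun nu => c * F nu + G nu) mu) =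
  c * (S F mu + T F mu) + (S G mu + T G mu).
Proof. by rewrite !lfunP; ring. Qed.

Definition lop_add (S T : lop) := @Lop (fun F mu => S F mu + T F mu) (lop_add_lin S T).
Fact lop_opp_lin (S : lop) (c : CC) F G mu :
  - S (fun nu => c * F nu + G nu) mu = c * (- S F mu) + (- S G mu).
Proof. by rewrite !lfunP; ring. Qed.

Definition lop_opp (S : lop) := @Lop (fun F mu => - S F mu) (lop_opp_lin S).
Fact lop_scale_lin a (S : lop) (c : CC) F G mu :
  a * S (fun nu => c * F nu + G nu) mu = c * (a * S F mu) + (a * S G mu).
Proof. by rewrite !lfunP; ring. Qed.

Definition lop_scale a (S : lop) := @Lop (fun F mu => a * S F mu) (lop_scale_lin a S).
Fact lop_mul_lin (S T : lop) (c : CC) F G mu :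
  S (T (fun nu => c * F nu + G nu)) mu = c * S (T F) mu + S (T G) mu.
Proof.
have -> : T (fun nu => c * F nu + G nu) = (fun nu => c * T F nu + T G nu).
  by apply/funext => nu; rewrite lfunP.
by rewrite lfunP.
Qed.

Definition lop_mul (S T : lop) := @Lop (fun F => S (T F)) (lop_mul_lin S T).

Fact lop_addA : associative lop_add.
Proof. by move=> S T R; apply: lopP => F mu /=; rewrite addrA. Qed.
Fact lop_addC : commutative lop_add.
Proof. by move=> S T; apply: lopP => F mu /=; rewrite addrC. Qed.
Fact lop_add0 : left_id lop_zero lop_add.
Proof. by move=> S; apply: lopP => F mu /=; rewrite add0r. Qed.
Fact lop_addN : left_inverse lop_zero lop_opp lop_add.
Proof. by move=> S; apply: lopP => F mu /=; rewrite addNr. Qed.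
HB.instance Definition _ := GRing.isZmodule.Build lop lop_addA lop_addC lop_add0 lop_addN.

Fact lop_mulA : associative lop_mul.
Proof. by move=> S T R; apply: lopP. Qed.
Fact lop_mul1 : left_id lop_one lop_mul.
Proof. by move=> S; apply: lopP. Qed.
Fact lop_1mul : right_id lop_one lop_mul.
Proof. by move=> S; apply: lopP. Qed.
Fact lop_mulDl : left_distributive lop_mul lop_add.
Proof. by move=> S T R; apply: lopP. Qed.

Lemma lopD (S : lop) F G mu : S (fun nu => F nu + G nu) mu = S F mu + S G mu.
Proof.
rewrite -[S F mu]mul1r -lfunP; congr (S _ mu); apply/funext => nu; by rewrite mul1r.
Qed.
Fact lop_mulDr : right_distributive lop_mul lop_add.
Proof. by move=> S T R; apply: lopP => F mu /=; rewrite lopD. Qed.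
Fact lop_1neq0 : lop_one != lop_zero.
Proof.
apply/eqP => /(congr1 (fun S : lop => S (fun _ => 1) (fun _ => 0%N))) /= /eqP.
by rewrite oner_eq0.
Qed.
HB.instance Definition _ := GRing.Zmodule_isNzRing.Build lop
  lop_mulA lop_mul1 lop_1mul lop_mulDl lop_mulDr lop_1neq0.

Fact lop_scaleA a b S : lop_scale a (lop_scale b S) = lop_scale (a * b) S.
Proof. by apply: lopP => F mu /=; rewrite mulrA. Qed.
Fact lop_scale1 : left_id 1 lop_scale.
Proof. by move=> S; apply: lopP => F mu /=; rewrite mul1r. Qed.
Fact lop_scaleDr : right_distributive lop_scale +%R.
Proof. by move=> a S T; apply: lopP => F mu /=; rewrite mulrDr. Qed.
Fact lop_scaleDl S : {morph lop_scale^~ S : a b / a + b}.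
Proof. by move=> a b; apply: lopP => F mu /=; rewrite mulrDl. Qed.
HB.instance Definition _ := GRing.Zmodule_isLmodule.Build CC lop
  lop_scaleA lop_scale1 lop_scaleDr lop_scaleDl.

Fact lop_scaleAl (a : CC) (S T : lop) : a *: (S * T) = a *: S * T.
Proof. by apply: lopP. Qed.
HB.instance Definition _ := GRing.Lmodule_isLalgebra.Build CC lop lop_scaleAl.

Lemma lopZ (S : lop) c F mu : S (fun nu => c * F nu) mu = c * S F mu.
Proof.
have h : S (fun _ => 0) mu = -1 * S (fun _ => 0) mu + S (fun _ => 0) mu.
  by rewrite -lfunP; congr (S _ mu); apply/funext => nu; rewrite mulr0 addr0.
have -> : (fun nu : occ => c * F nu) = (fun nu => c * F nu + (fun _ => 0) nu).
  by apply/funext => nu; rewrite addr0.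
by rewrite lfunP h; ring.
Qed.

Fact lop_scaleAr (a : CC) (S T : lop) : a *: (S * T) = S * (a *: T).
Proof. by apply: lopP => F mu /=; rewrite lopZ. Qed.
HB.instance Definition _ := GRing.Lalgebra_isAlgebra.Build CC lop lop_scaleAr.

Lemma lop_mulE (S T : lop) F : (S * T) F = S (T F). Proof. by []. Qed.

Lemma lop_addE (S T : lop) F mu : (S + T) F mu = S F mu + T F mu. Proof. by []. Qed.

Lemma lop_scaleE c (S : lop) F mu : (c *: S) F mu = c * S F mu. Proof. by []. Qed.

(** * q-commutation *)

Definition qc (q : CC) (A : algType CC) (z : int) (x y : A) : Prop :=
  x * y = q ^ z *: (y * x).

Section Qcomm.
Variables (q : CC) (hq : q != 0) (A : algType CC).
Implicit Types (x y : A) (a b : int).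

Lemma qc0 x y : qc q 0 x y <-> x * y = y * x.
Proof. by rewrite /qc expr0z scale1r. Qed.

Lemma qc01 x : qc q 0 x 1.
Proof. by apply/qc0; rewrite mul1r mulr1. Qed.

Lemma qcMr a b x y z : qc q a x y -> qc q b x z -> qc q (a + b) x (y * z).
Proof.
move=> h1 h2; rewrite /qc mulrA h1 -scalerAl -[y * x * z]mulrA h2 -scalerAr scalerA.
by rewrite expfzDr // mulrA.
Qed.

Lemma qcMl a b x y z : qc q a x z -> qc q b y z -> qc q (a + b) (x * y) z.
Proof.
move=> h1 h2; rewrite /qc -mulrA h2 -scalerAr [x * (z * y)]mulrA h1 -scalerAl scalerA.
by rewrite addrC expfzDr // -mulrA.
Qed.

Lemma qcS a x y : qc q a x y -> qc q (- a) y x.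
Proof.
by rewrite /qc => ->; rewrite scalerA -expfzDr // addNr expr0z scale1r.
Qed.

Lemma qcDr a x y z : qc q a x y -> qc q a x z -> qc q a x (y + z).
Proof. by rewrite /qc mulrDl mulrDr scalerDr => -> ->. Qed.

Lemma qcZr a c x y : qc q a x y -> qc q a x (c *: y).
Proof. by rewrite /qc -scalerAl -scalerAr => ->; rewrite !scalerA mulrC. Qed.

Lemma qcNr a x y : qc q a x y -> qc q a x (- y).
Proof. by rewrite -scaleN1r; apply: qcZr. Qed.

Lemma qcBr a x y z : qc q a x y -> qc q a x z -> qc q a x (y - z).
Proof. by move=> h1 h2; apply: qcDr => //; apply: qcNr. Qed.

Lemma qcXr a x y n : qc q a x y -> qc q (a * n%:Z) x (y ^+ n).
Proof.
move=> h; elim: n => [|n IH]; first by rewrite mulr0 expr0; apply: qc01.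
by rewrite exprS intS mulrDr mulr1; apply: qcMr.
Qed.

Lemma qcV a k ki x : k * ki = 1 -> ki * k = 1 -> qc q a k x -> qc q (- a) ki x.
Proof.
move=> h1 h2 h; rewrite /qc.
have E : k * x * ki = q ^ a *: x by rewrite h -scalerAl -mulrA h1 mulr1.
have -> : x * ki = ki * (k * x * ki) by rewrite !mulrA h2 mul1r.
by rewrite E -scalerAr scalerA -expfzDr // addNr expr0z scale1r.
Qed.

Lemma qcJ a k ki x : k * ki = 1 -> ki * k = 1 -> k * x * ki = q ^ a *: x <-> qc q a k x.
Proof.
move=> h1 h2; rewrite /qc; split => h; last by rewrite h -scalerAl -mulrA h1 mulr1.
by rewrite scalerAl -h -[RHS]mulrA h2 mulr1.
Qed.

Lemma qc_ext a b x y : qc q a x y -> a = b -> qc q b x y.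
Proof. by move=> h <-. Qed.

End Qcomm.

(** * The defining relations *)

Definition serre (q : CC) (A : algType CC) (x y : A) : A :=
  x ^+ 2 * y - (q + q^-1) *: (x * y * x) + y * x ^+ 2.

Lemma cartanC i j : cartan i j = cartan j i.
Proof. by rewrite /cartan eq_sym orbC. Qed.

Section Rels.
Variables (N : nat) (q : CC) (hq : q != 0) (A : algType CC) (g : gens A).
Hypothesis HR : Uq_rels N q g.
Variables (i j : nat) (hi : (0 < i < N)%N) (hj : (0 < j < N)%N).

Lemma gk_gki : gk g i * gki g i = 1.
Proof. by case: (HR hi hi). Qed.

Lemma gki_gk : gki g i * gk g i = 1.
Proof. by case: (HR hi hi) => _ []. Qed.

Lemma gkC : gk g i * gk g j = gk g j * gk g i.
Proof. by case: (HR hi hj) => _ [_ []]. Qed.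

Lemma qc_ke : qc q (cartan i j) (gk g i) (ge g j).
Proof. by apply/(@qcJ q A _ _ _ _ gk_gki gki_gk); case: (HR hi hj) => _ [_ [_ []]]. Qed.

Lemma qc_kf : qc q (- cartan i j) (gk g i) (gf g j).
Proof. by apply/(@qcJ q A _ _ _ _ gk_gki gki_gk); case: (HR hi hj) => _ [_ [_ [_ []]]]. Qed.

Lemma qc_kie : qc q (- cartan i j) (gki g i) (ge g j).
Proof. exact: qcV gk_gki gki_gk qc_ke. Qed.

Lemma qc_kif : qc q (cartan i j) (gki g i) (gf g j).
Proof. by rewrite -[cartan i j]opprK; exact: qcV gk_gki gki_gk qc_kf. Qed.

Lemma gef : ge g i * gf g j - gf g j * ge g i =
  (if i == j then (q - q^-1)^-1 *: (gk g i - gki g i) else 0).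
Proof. by case: (HR hi hj) => _ [_ [_ [_ [_ []]]]]. Qed.

Lemma gserre_e : (i == j.+1) || (j == i.+1) -> serre q (ge g i) (ge g j) = 0.
Proof. by case: (HR hi hj) => _ [_ [_ [_ [_ [_ [h _]]]]]] /h []. Qed.

Lemma gserre_f : (i == j.+1) || (j == i.+1) -> serre q (gf g i) (gf g j) = 0.
Proof. by case: (HR hi hj) => _ [_ [_ [_ [_ [_ [h _]]]]]] /h []. Qed.

Lemma geC_far : ((j.+1 < i) || (i.+1 < j))%N -> ge g i * ge g j = ge g j * ge g i.
Proof. by case: (HR hi hj) => _ [_ [_ [_ [_ [_ [_ h]]]]]] /h []. Qed.

Lemma gfC_far : ((j.+1 < i) || (i.+1 < j))%N -> gf g i * gf g j = gf g j * gf g i.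
Proof. by case: (HR hi hj) => _ [_ [_ [_ [_ [_ [_ h]]]]]] /h []. Qed.

End Rels.

Lemma gkkiC N q (A : algType CC) (g : gens A) (HR : Uq_rels N q g) i j :
  (0 < i < N)%N -> (0 < j < N)%N -> gk g i * gki g j = gki g j * gk g i.
Proof.
move=> hi hj; rewrite -[LHS]mul1r -(gki_gk HR hj) -mulrA (mulrA (gk g j)).
by rewrite (gkC HR hj hi) -!mulrA (gk_gki HR hj) mulr1.
Qed.

Lemma gkikiC N q (A : algType CC) (g : gens A) (HR : Uq_rels N q g) i j :
  (0 < i < N)%N -> (0 < j < N)%N -> gki g i * gki g j = gki g j * gki g i.
Proof.
move=> hi hj; rewrite -[LHS]mulr1 -(gk_gki HR hi) -!mulrA (mulrA _ (gk g i)).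
by rewrite -(gkkiC HR hi hj) !mulrA (gki_gk HR hi) mul1r.
Qed.

(** * Root vectors *)

Section Lowering.
Variables (q : CC) (A : algType CC) (g : gens A).

Lemma Root_low1 k : Root q g k.+1 k = gf g k.
Proof. by rewrite /Root ltnNge leqnSn /= ltnSn subSnn subnn. Qed.

Lemma Root_lowS l k : (k.+1 < l)%N ->
  Root q g l k = Root q g l k.+1 * gf g k - q^-1 *: (gf g k * Root q g l k.+1).
Proof.
move=> h; rewrite /Root.
have -> : (l < k)%N = false by lia.
have -> : (l < k.+1)%N = false by lia.
have -> : (k < l)%N by lia.
rewrite h; have -> : (l - k - 1 = (l - k.+1 - 1).+1)%N by lia.
by rewrite /=; have -> : (l - (l - k.+1 - 1).+2)%N = k by lia.
Qed.

(** Descending induction on the lower index, matching the recursion of [Root_lowS]. *)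
Lemma low_ind (P : nat -> Prop) l :
  (forall k, k.+1 = l -> P k) -> (forall k, (k.+1 < l)%N -> P k.+1 -> P k) ->
  forall k, (k < l)%N -> P k.
Proof.
move=> h1 h2 k hk; have [d hd] : exists d, (k + d).+1 = l by exists (l - k.+1)%N; lia.
elim: d k hk hd => [|d IH] k hk hd; first by apply: h1; rewrite -hd addn0.
by apply: h2; [lia | apply: IH; lia].
Qed.

Hypothesis hq : q != 0.

(** Every word of E_{l,k} contains each f_t with k <= t < l exactly once, so the exponents add
    up. *)
Lemma qc_Root_r (w : nat -> int) x l k : (k < l)%N ->
  (forall t, (k <= t < l)%N -> qc q (w t) x (gf g t)) ->
  qc q (\sum_(k <= t < l) w t) x (Root q g l k).
Proof.
move: k; apply: low_ind => [k <-|k hk IH] h.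
  by rewrite Root_low1 big_nat1; apply: h; lia.
have h1 := IH (fun t ht => h t ltac:(lia)).
have h2 := h k ltac:(lia).
rewrite Root_lowS // big_ltn ?(ltn_trans (ltnSn k)) //.
apply: qcBr; first by rewrite addrC; apply: qcMr.
by apply: qcZr; apply: qcMr.
Qed.

Lemma Root_comm x l k : (k < l)%N ->
  (forall t, (k <= t < l)%N -> x * gf g t = gf g t * x) ->
  x * Root q g l k = Root q g l k * x.
Proof.
move=> hk h; apply/(qc0 q).
apply: (qc_ext (qc_Root_r (w := fun _ => 0) hk _)); last by rewrite big1.
by move=> t ht; apply/qc0; apply: h.
Qed.

End Lowering.

(** * Tensor products of two commuting families of generators *)

Definition gmem (A : Type) (g : gens A) i (x : A) :=
  x = ge g i \/ x = gf g i \/ x = gk g i \/ x = gki g i.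

Definition gcomm N (A : algType CC) (g1 g2 : gens A) :=
  forall i j, (0 < i < N)%N -> (0 < j < N)%N ->
  forall x y, gmem g1 i x -> gmem g2 j y -> x * y = y * x.

(** The coproduct e -> e (x) k^-1 + 1 (x) e, f -> f (x) 1 + k (x) f, written inside one algebra that
    contains both factors as commuting families. *)
Definition gtens (A : algType CC) (g1 g2 : gens A) : gens A :=
  {| ge := fun i => ge g1 i * gki g2 i + ge g2 i;
     gf := fun i => gf g1 i + gk g1 i * gf g2 i;
     gk := fun i => gk g1 i * gk g2 i;
     gki := fun i => gki g1 i * gki g2 i |}.

(** The factors [u] and [w] can be collected in front of all three terms, as the common factor u u
    w. *)
Lemma serre_comm (q : CC) (A : algType CC) (a b u w : A) :
  u * a = a * u -> u * b = b * u -> w * a = a * w -> u * w = w * u ->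
  serre q a b = 0 -> serre q (u * a) (w * b) = 0.
Proof.
move=> ua ub wa uw h.
have -> : serre q (u * a) (w * b) = u * u * w * serre q a b; last by rewrite h mulr0.
rewrite /serre !expr2 !(mulrDr, mulrDl, mulrBr, mulrN, mulrA) -!scalerAr !mulrA.
have E (x y : A) : x * y = y * x -> forall z, z * x * y = z * y * x.
  by move=> xy z; rewrite -!mulrA xy.
rewrite !(E _ _ (esym ua), E _ _ (esym ub), E _ _ (esym wa), E _ _ (esym uw),
          esym ua, esym ub, esym wa, esym uw).
by [].
Qed.

(** Once all words are ordered, the mixed terms cancel for these exponents, which are those of e_i
    (x) k_i^-1 against 1 (x) e_j in a tensor product. *)
Lemma serre_sum (q : CC) (A : algType CC) (x y x' y' : A) : q != 0 ->
  qc q (- 2%:Z) x y -> qc q 1 x y' -> qc q 1 x' y ->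
  serre q x x' = 0 -> serre q y y' = 0 -> serre q (x + y) (x' + y') = 0.
Proof.
move=> hq; rewrite /qc expr1z => h1 h2 h3 s1 s2.
have h1' : x * y = (q^-1 * q^-1) *: (y * x) by rewrite h1 -exprnN expr2 invfM.
have -> : serre q (x + y) (x' + y') = serre q (x + y) (x' + y') - serre q x x' - serre q y y'.
  by rewrite s1 s2 !subr0.
rewrite /serre !expr2 !(mulrDr, mulrDl, mulrBr, mulrN, mulrA).
do 4! rewrite ?(h1', h2, h3, mulr_rule h1', mulr_rule h2, mulr_rule h3) -?(@scalerAl _ A)
  -?(@scalerAr _ A) ?(@scalerA _ A) ?(@mulrA A).

ncring ltac:(by field).
Qed.

Section Tensor.
Variables (N : nat) (q : CC) (hq : q != 0) (A : algType CC) (g1 g2 : gens A).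
Hypotheses (R1 : Uq_rels N q g1) (R2 : Uq_rels N q g2) (C12 : gcomm N g1 g2).

Lemma gtens_ef i j : (0 < i < N)%N -> (0 < j < N)%N ->
  ge (gtens g1 g2) i * gf (gtens g1 g2) j - gf (gtens g1 g2) j * ge (gtens g1 g2) i =
  (ge g1 i * gf g1 j - gf g1 j * ge g1 i) * gki g2 i +
  gk g1 j * (ge g2 i * gf g2 j - gf g2 j * ge g2 i).
Proof.
move=> hi hj /=.
have c x y : gmem g1 i x \/ gmem g1 j x -> gmem g2 i y \/ gmem g2 j y -> y * x = x * y.
  by move=> [h1|h1] [h2|h2]; symmetry; apply: (C12 _ _ h1 h2).
have h1 := c (gf g1 j) (gki g2 i) ltac:(rewrite /gmem; tauto) ltac:(rewrite /gmem; tauto).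
have h2 := c (gk g1 j) (gki g2 i) ltac:(rewrite /gmem; tauto) ltac:(rewrite /gmem; tauto).
have h3 := c (ge g1 i) (gf g2 j) ltac:(rewrite /gmem; tauto) ltac:(rewrite /gmem; tauto).
have h4 := c (gf g1 j) (ge g2 i) ltac:(rewrite /gmem; tauto) ltac:(rewrite /gmem; tauto).
have h5 := c (gk g1 j) (ge g2 i) ltac:(rewrite /gmem; tauto) ltac:(rewrite /gmem; tauto).
have h6 := qc_kif hq R2 hi hj; have h7 := qc_ke R1 hj hi.
rewrite cartanC in h7; rewrite /qc in h6 h7.
rewrite !(mulrDr, mulrDl, mulrBr, mulrBl, mulNr, mulrN, mulrA).
do 5! rewrite ?(h1, h2, h3, h4, h5, h6, h7, mulr_rule h1, mulr_rule h2, mulr_rule h3,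
  mulr_rule h4, mulr_rule h5, mulr_rule h6, mulr_rule h7) -?(@scalerAl _ A)
  -?(@scalerAr _ A) ?(@scalerA _ A) ?(@mulrA A).
by ncring ltac:(by ring).
Qed.

Lemma gtens_rels : Uq_rels N q (gtens g1 g2).
Proof.
move=> i j hi hj.
have c x y : gmem g1 i x \/ gmem g1 j x -> gmem g2 i y \/ gmem g2 j y -> qc q 0 x y.
  by move=> [h1|h1] [h2|h2]; apply/qc0; apply: (C12 _ _ h1 h2).
have c' x y : gmem g1 i x \/ gmem g1 j x -> gmem g2 i y \/ gmem g2 j y -> qc q 0 y x.
  by move=> h1 h2; apply/qc0; symmetry; apply/(qc0 q); apply: c.
have HK : gk (gtens g1 g2) i * gki (gtens g1 g2) i = 1.
  have /qc0 E := c' (gki g1 i) (gk g2 i) ltac:(rewrite /gmem; tauto) ltac:(rewrite /gmem; tauto).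
  by rewrite /= -mulrA (mulrA (gk g2 i)) E -mulrA (gk_gki R2 hi) mulr1 (gk_gki R1 hi).
have HK' : gki (gtens g1 g2) i * gk (gtens g1 g2) i = 1.
  have /qc0 E := c' (gk g1 i) (gki g2 i) ltac:(rewrite /gmem; tauto) ltac:(rewrite /gmem; tauto).
  by rewrite /= -mulrA (mulrA (gki g2 i)) E -mulrA (gki_gk R2 hi) mulr1 (gki_gk R1 hi).
split => //; split => //; split.
  have := gkC R1 hi hj; have := gkC R2 hi hj => /(qc0 q) h1 /(qc0 q) h2.
  apply/(qc0 q) => /=; rewrite -[0]addr0; apply: qcMr => //; rewrite -[0]addr0; apply: qcMl => //;
    first [(apply: c'; rewrite /gmem; tauto; fail) | (apply: c; rewrite /gmem; tauto; fail)].
split.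
  apply/(@qcJ q A _ _ _ _ HK HK') => /=; apply: qcDr.
    apply: (qc_ext (a := (cartan i j + 0) + (0 + 0))); last by rewrite !addr0.
    apply: qcMr => //; apply: qcMl => //;
      first [exact (qc_ke R1 hi hj) | (apply: c'; rewrite /gmem; tauto; fail) | (apply: c; rewrite /gmem; tauto; fail) | apply/qc0; exact (gkkiC R2 hi hj)].
  rewrite -[cartan i j]add0r; apply: qcMl => //; last exact (qc_ke R2 hi hj).
  by apply: c; rewrite /gmem; tauto.
split.
  apply/(@qcJ q A _ _ _ _ HK HK') => /=; apply: qcDr.
    rewrite -[- cartan i j]addr0; apply: qcMl => //; first exact (qc_kf R1 hi hj).
    by apply: c'; rewrite /gmem; tauto.
  apply: (qc_ext (a := (0 + 0) + (0 - cartan i j))); last by rewrite !add0r.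
  apply: qcMr => //; apply: qcMl => //;
      first [exact (qc_kf R2 hi hj) | (apply: c'; rewrite /gmem; tauto; fail) | (apply: c; rewrite /gmem; tauto; fail) | apply/qc0; exact (gkC R1 hi hj)].
split.
  rewrite gtens_ef // (gef R1 hi hj) (gef R2 hi hj).
  case: eqP => [<-|_] /=; last by rewrite mul0r mulr0 addr0.
  by rewrite -scalerAl -scalerAr -scalerDr; congr (_ *: _); rewrite mulrBl mulrBr addrC addrA subrK.
split => h.
  have ha : cartan i j = -1 by rewrite /cartan; case: eqP => [E|_]; [exfalso; lia | rewrite h].
  have hb : cartan j i = -1 by rewrite cartanC.
  have hc x : cartan x x = 2%:Z by rewrite /cartan eqxx.
  have c1 x y hx hy : x * y = y * x := proj1 (qc0 q x y) (c x y hx hy).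
  split.
    apply: serre_sum => //.
    + apply: (qc_ext (a := 0 + - 2%:Z)); last by rewrite add0r.
      apply: qcMl => //; first by apply: c; rewrite /gmem; tauto.
      by rewrite -(hc i); exact (qc_kie hq R2 hi hi).
    + apply: (qc_ext (a := 0 + 1)); last by [].
      apply: qcMl => //; first by apply: c; rewrite /gmem; tauto.
      by rewrite -[1]opprK -ha; exact (qc_kie hq R2 hi hj).
    + apply: (qc_ext (a := 0 + 1)); last by [].
      apply: qcMl => //; first by apply: c; rewrite /gmem; tauto.
      by rewrite -[1]opprK -hb; exact (qc_kie hq R2 hj hi).
    + rewrite (c1 (ge g1 i)) ?(c1 (ge g1 j)); [|rewrite /gmem; tauto..].
      apply: serre_comm; last exact ((gserre_e R1 hi hj h)).
      all: try by (symmetry; apply: c1; rewrite /gmem; tauto).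
      exact (gkikiC R2 hi hj).
    + exact ((gserre_e R2 hi hj h)).
  (* For the f's the exponents have the opposite signs. The Serre expression is symmetric in [q] and
     [q^-1], so [serre_sum] is applied at [q^-1]. *)
  have serreV x y : serre q^-1 x y = serre q x y :> A by rewrite /serre invrK [q^-1 + q]addrC.
  have qcV1 z (x y : A) : qc q (- z) x y -> qc q^-1 z x y by rewrite /qc exprz_inv.
  rewrite -/(serre q _ _) -serreV; apply: serre_sum; rewrite ?invr_eq0 //.
  + apply: qcV1; rewrite opprK; apply: (qc_ext (a := 2%:Z + 0)); last by rewrite addr0.
    apply: qcMr => //; last by apply: c; rewrite /gmem; tauto.
    by rewrite -(hc i) -[cartan i i]opprK; apply: qcS => //; exact (qc_kf R1 hi hi).
  + apply: qcV1; apply: (qc_ext (a := -1 + 0)); last by [].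
    apply: qcMr => //; last by apply: c; rewrite /gmem; tauto.
    by rewrite -hb -[cartan j i]opprK; apply: qcS => //; exact (qc_kf R1 hj hi).
  + apply: qcV1; apply: (qc_ext (a := -1 + 0)); last by [].
    apply: qcMr => //; last by apply: c; rewrite /gmem; tauto.
    by rewrite -ha -[cartan i j]opprK; apply: qcS => //; exact (qc_kf R1 hi hj).
  + rewrite serreV; exact ((gserre_f R1 hi hj h)).
  + rewrite serreV; apply: serre_comm; last exact ((gserre_f R2 hi hj h)).
    all: try by (apply: c1; rewrite /gmem; tauto).
    exact (gkC R1 hi hj).
have ha : cartan i j = 0.
  rewrite /cartan; case: eqP => [E|_]; first by lia.
  by case: ifP => // /orP[] /eqP; lia.
have hb : cartan j i = 0 by rewrite cartanC.
have hke := qc_kie hq R2 hi hj; have hke' := qc_kie hq R2 hj hi.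
have hkf := qc_kf R1 hi hj; have hkf' := qc_kf R1 hj hi.
rewrite ha hb !oppr0 in hke hke' hkf hkf'.
have hS x y : qc q 0 x y -> qc q 0 y x by move=> /qc0 E; apply/qc0.
have F (x y z x' y' z' : A) : qc q 0 x x' -> qc q 0 x y' -> qc q 0 x z' ->
    qc q 0 y x' -> qc q 0 y y' -> qc q 0 y z' ->
    qc q 0 z x' -> qc q 0 z y' -> qc q 0 z z' ->
    (x * y + z) * (x' * y' + z') = (x' * y' + z') * (x * y + z).
  move=> /qc0 h1 /qc0 h2 /qc0 h3 /qc0 h4 /qc0 h5 /qc0 h6 /qc0 h7 /qc0 h8 /qc0 h9.
  by apply/commr_sym; apply: commrD; [apply: commrM | ]; apply/commr_sym;
    apply: commrD => //; apply: commrM.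
split=> /=; [|rewrite !(addrC (gf g1 _))]; apply: F.
all: first [(apply: c; rewrite /gmem; tauto) | (apply: c'; rewrite /gmem; tauto)
  | assumption | (apply: hS; assumption) | apply/qc0; exact (geC_far R1 hi hj h)
  | apply/qc0; exact (geC_far R2 hi hj h)
  | apply/qc0; exact (gfC_far R1 hi hj h) | apply/qc0; exact (gfC_far R2 hi hj h)
  | apply/qc0; exact (gkC R1 hi hj) | apply/qc0; exact (gkikiC R2 hi hj)].
Qed.

End Tensor.

(* The matrix unit [E_{l,a}] has weight [eps i l - eps i a] under conjugation by [k_i]. *)
Definition eps (i t : nat) : int := (t == i)%:Z - (t == i.+1)%:Z.

(** In this form the weights of consecutive f_t telescope along a root vector. *)
Lemma cartan_eps i t : - cartan i t = eps i t.+1 - eps i t.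
Proof.
rewrite /cartan /eps eqSS (eq_sym t i).
by case: (eqVneq i t.+1) => ?; case: (eqVneq t i.+1) => ?; case: (eqVneq i t) => ?;
  rewrite ?(eq_sym t.+1) //=; try lia; subst => //=; rewrite ?eqxx; lia.
Qed.

Lemma sum_cartan i a l : (a <= l)%N -> \sum_(a <= t < l) (- cartan i t) = eps i l - eps i a.
Proof.
move=> h; rewrite -(telescope_sumr (eps i) h).
by apply: eq_bigr => t _; rewrite cartan_eps.
Qed.

Section RootWeights.
Variables (N : nat) (q : CC) (hq : q != 0) (A : algType CC) (g : gens A).
Hypothesis HR : Uq_rels N q g.

Lemma qc_k_Root i l a : (0 < i < N)%N -> (0 < a)%N -> (a < l)%N -> (l <= N)%N ->
  qc q (eps i l - eps i a) (gk g i) (Root q g l a).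
Proof.
move=> hi h1 h2 h3; rewrite -sum_cartan ?(ltnW h2) //.
apply: qc_Root_r => // t ht.
have ht' : (0 < t < N)%N by lia.
exact (qc_kf HR hi ht').
Qed.

Lemma qc_f_Kprod i a l : (0 < i < N)%N -> (0 < a)%N -> (a <= l)%N -> (l <= N)%N ->
  qc q (eps i l - eps i a) (Kprod g a l) (gf g i).
Proof.
move=> hi h1; elim: l => [|l IH] h2 h3.
  by exfalso; lia.
case: (ltngtP a l.+1) h2 => // [h2 _|-> _]; last first.
  by rewrite subrr /Kprod big_geq //; apply/qc0; rewrite mul1r mulr1.
have -> : eps i l.+1 - eps i a = (eps i l - eps i a) + (- cartan l i).
  by rewrite cartanC cartan_eps [RHS]addrC addrA subrK.
rewrite /Kprod big_nat_recr //=; apply: qcMl => //; first by apply: IH; lia.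
have hl : (0 < l < N)%N by lia.
exact (qc_kf HR hl hi).
Qed.

End RootWeights.

(** * The coproduct of the lowering root vectors *)

Section RootTensor.
Variables (N : nat) (q : CC) (hq : q != 0) (A : algType CC) (g1 g2 : gens A).
Hypotheses (R1 : Uq_rels N q g1) (R2 : Uq_rels N q g2) (C12 : gcomm N g1 g2).

Lemma gcomm_Root x l k : (0 < k)%N -> (k < l)%N -> (l <= N)%N ->
  (exists2 i, (0 < i < N)%N & gmem g1 i x) -> x * Root q g2 l k = Root q g2 l k * x.
Proof.
move=> h1 h2 h3 [i hi hx]; apply: Root_comm => // t ht.
by apply: (C12 hi (j := t)) => //; [lia | rewrite /gmem; tauto].
Qed.

Lemma gcomm_Root1 x l k : (0 < k)%N -> (k < l)%N -> (l <= N)%N ->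
  (exists2 i, (0 < i < N)%N & gmem g2 i x) -> x * Root q g1 l k = Root q g1 l k * x.
Proof.
move=> h1 h2 h3 [i hi hx]; apply: Root_comm => // t ht; symmetry.
by apply: (C12 (i := t) _ hi) => //; [lia | rewrite /gmem; tauto].
Qed.

Lemma Root_gtens l k : (l <= N)%N -> (k < l)%N -> (0 < k)%N ->
  Root q (gtens g1 g2) l k = Root q g1 l k + Kprod g1 k l * Root q g2 l k +
  (q - q^-1) *: \sum_(k.+1 <= t < l) Root q g1 t k * Kprod g1 t l * Root q g2 l t.
Proof.
move=> hl; move: k; apply: low_ind => [k <-|k hk IH] h0.
  by rewrite !Root_low1 big_geq // scaler0 addr0 /Kprod big_nat1.
have hkN : (0 < k < N)%N by lia.
have m1 : gmem g1 k (gf g1 k) by rewrite /gmem; tauto.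
have m2 : gmem g1 k (gk g1 k) by rewrite /gmem; tauto.
have m3 : gmem g2 k (gf g2 k) by rewrite /gmem; tauto.
rewrite Root_lowS // IH //= [in RHS]big_ltn // Root_low1.
rewrite !(Root_lowS _ g1 hk) !(Root_lowS _ g2 hk).
have -> : Kprod g1 k l = gk g1 k * Kprod g1 k.+1 l by rewrite /Kprod big_ltn // ltnW.
set P := Root q g1 l k.+1; set Kp := Kprod g1 k.+1 l; set Q := Root q g2 l k.+1.
set S' := \sum_(_ <= _ < _) _; set S'' := \sum_(_ <= _ < _) _.
set f := gf g1 k; set ka := gk g1 k; set ph := gf g2 k.
have w1 : eps k l = 0 - (l == k.+1)%:Z by rewrite /eps; have -> : (l == k) = false by lia.
have w2 : eps k k.+1 = -1.
  by rewrite /eps eqxx; have -> : (k.+1 == k) = false by lia.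
have w3 : (l == k.+1) = false by lia.
have P1 : ka * P = q *: (P * ka).
  have := qc_k_Root hq R1 hkN (ltn0Sn k) hk hl; rewrite w1 w2 w3 /qc => ->.
  by rewrite -[0 - _ - _]/(1 : int) expr1z.
have P2 : ph * P = P * ph by apply: gcomm_Root1 => //; exists k.
have K1 : Kp * f = q *: (f * Kp).
  have := qc_f_Kprod hq R1 hkN (ltn0Sn k) (ltnW hk) hl; rewrite w1 w2 w3 /qc => ->.
  by rewrite -[_ - _]/(1 : int) expr1z.
have K2 : Kp * ka = ka * Kp.
  rewrite /Kp /Kprod big_seq; apply: (big_ind (fun x => x * ka = ka * x)).
  - by rewrite mul1r mulr1.
  - by move=> x y hx hy; rewrite -mulrA hy mulrA hx mulrA.
  - move=> t; rewrite mem_index_iota => ht; apply: (gkC R1 _ hkN); lia.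
have K3 : ph * Kp = Kp * ph.
  rewrite /Kp /Kprod big_seq; symmetry; apply: (big_ind (fun x => x * ph = ph * x)).
  - by rewrite mul1r mulr1.
  - by move=> x y hx hy; rewrite -mulrA hy mulrA hx mulrA.
  - move=> t; rewrite mem_index_iota => ht; apply: (C12 (i := t) _ hkN _ m3); [lia|].
    by rewrite /gmem; tauto.
have Q1 : f * Q = Q * f by apply: gcomm_Root => //; exists k.
have Q2 : ka * Q = Q * ka by apply: gcomm_Root => //; exists k.
have fph : f * ph = ph * f by apply: (C12 hkN hkN m1 m3).
have kaph : ka * ph = ph * ka by apply: (C12 hkN hkN m2 m3).
have S1 : S' * f - q^-1 *: (f * S') = S''.
  rewrite mulr_suml mulr_sumr scaler_sumr -sumrB; apply: eq_big_nat => t ht.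
  have E1 : f * Root q g2 l t = Root q g2 l t * f.
    by apply: gcomm_Root => //; [lia.. | exists k].
  have E2 : f * Kprod g1 t l = Kprod g1 t l * f.
    have := qc_f_Kprod hq R1 hkN (a := t) (l := l) ltac:(lia) ltac:(lia) hl.
    rewrite /eps.
    have -> : (l == k) = false by lia.
    have -> : (l == k.+1) = false by lia.
    have -> : (t == k) = false by lia.
    have -> : (t == k.+1) = false by lia.
    by rewrite /= => /qc0 ->.
  rewrite -mulrA -E1 mulrA -(mulrA _ _ f) -E2 !mulrA 2!(@scalerAl _ A) -2!mulrBl.
  by rewrite -Root_lowS //; lia.
have S2 : S' * (ka * ph) = q^-1 *: (ka * ph * S').
  rewrite mulr_suml mulr_sumr scaler_sumr; apply: eq_big_nat => t ht.
  have E1 : ph * Root q g2 l t = Root q g2 l t * ph.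
    apply: (Root_comm hq) => [|s hs]; first lia.
    have hs' : (0 < s < N)%N by lia.
    by apply: (gfC_far R2 hkN hs'); lia.
  have E2 : ka * Root q g2 l t = Root q g2 l t * ka.
    by apply: gcomm_Root => //; [lia.. | exists k].
  have E3 : Kprod g1 t l * ka = ka * Kprod g1 t l.
    rewrite /Kprod big_seq; apply: (big_ind (fun x => x * ka = ka * x)).
    - by rewrite mul1r mulr1.
    - by move=> x y hx hy; rewrite -mulrA hy mulrA hx mulrA.
    - move=> s; rewrite mem_index_iota => hs; apply: (gkC R1 _ hkN); lia.
  have E4 : ph * Kprod g1 t l = Kprod g1 t l * ph.
    rewrite /Kprod big_seq; symmetry; apply: (big_ind (fun x => x * ph = ph * x)).
    - by rewrite mul1r mulr1.
    - by move=> x y hx hy; rewrite -mulrA hy mulrA hx mulrA.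
    - move=> s; rewrite mem_index_iota => hs; apply: (C12 (i := s) _ hkN _ m3); [lia|].
      by rewrite /gmem; tauto.
  have E5 : ph * Root q g1 t k.+1 = Root q g1 t k.+1 * ph.
    by apply: gcomm_Root1 => //; [lia.. | exists k].
  have E6 : Root q g1 t k.+1 * ka = q^-1 *: (ka * Root q g1 t k.+1).
    have := qc_k_Root hq R1 hkN (a := k.+1) (l := t) ltac:(lia) ltac:(lia) ltac:(lia).
    rewrite w2 /eps.
    have -> : (t == k) = false by lia.
    have -> : (t == k.+1) = false by lia.
    by rewrite /qc -[_ - _]/(1 : int) expr1z => ->; rewrite scalerA mulVf // scale1r.
  rewrite !mulrA -[_ * Root q g2 l t * ka]mulrA -E2 !mulrA -[_ * Root q g2 l t * ph]mulrA.
  rewrite -E1 !mulrA -[_ * Kprod g1 t l * ka]mulrA E3 !mulrA E6 -!(@scalerAl _ A).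
  congr (_ *: _); rewrite -[_ * Kprod g1 t l * ph]mulrA -E4 !mulrA.
  by rewrite -[_ * Root q g1 t k.+1 * ph]mulrA -E5 !mulrA.
have P1' : P * ka = q^-1 *: (ka * P) by rewrite P1 scalerA mulVf // scale1r.
transitivity (P * f - q^-1 *: (f * P) + (P * ka) * ph - q^-1 *: (ka * ph * P) +
  (Kp * Q * f - q^-1 *: (f * Kp * Q)) + (Kp * (Q * ka) * ph - q^-1 *: (ka * ph * Kp * Q)) +
  (q - q^-1) *: (S' * f - q^-1 *: (f * S')) +
  (q - q^-1) *: (S' * (ka * ph) - q^-1 *: (ka * ph * S'))).
  by ncring ltac:(by ring).
rewrite S1 S2 subrr P1' -Q2 -!(mulrA Kp) -Q1 !(mulrA Kp) K1 K2.
rewrite -!(mulrA ka ph) P2 K3.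
by ncring ltac:(by field).
Qed.

End RootTensor.

(** * The q-oscillator realization *)

(** The shape in which [field] asks for the non-vanishing of q - q^-1. *)
Lemma sqr_sub1_neq0 (q : CC) : q != 0 -> q - q^-1 != 0 -> q * q - 1 != 0.
Proof.
move=> h1 h2; have -> : q * q - 1 = q * (q - q^-1) by rewrite mulrBr mulfV.
by rewrite mulf_neq0.
Qed.

Section Oscillator.
Variables (q : CC) (hq : q != 0) (hqq : q - q^-1 != 0) (A : algType CC).
Variables (y d g gi : nat -> A).

Definition omem i (x : A) := x = y i \/ x = d i \/ x = g i \/ x = gi i.

(** The two relations between [d] and [y] together express y d and d y through g and its inverse, as
    the q-integers of the number operator and of its successor. *)
Record oscillator : Prop := Oscillator {
  osc_gK : forall i, g i * gi i = 1;
  osc_giK : forall i, gi i * g i = 1;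
  osc_comm : forall i j, i != j -> forall x z, omem i x -> omem j z -> x * z = z * x;
  osc_gy : forall i, g i * y i = q *: (y i * g i);
  osc_gd : forall i, g i * d i = q^-1 *: (d i * g i);
  osc_dy : forall i, d i * y i - q *: (y i * d i) = gi i;
  osc_dyV : forall i, d i * y i - q^-1 *: (y i * d i) = g i }.

Definition osc_gens : gens A :=
  {| ge := fun i => y i * d i.+1; gf := fun i => y i.+1 * d i;
     gk := fun i => g i * gi i.+1; gki := fun i => gi i * g i.+1 |}.

Hypothesis HO : oscillator.

Let comm i j x z : i != j -> omem i x -> omem j z -> x * z = z * x.
Proof. by move=> h; apply: (osc_comm HO). Qed.

Lemma osc_gyij i j : qc q (j == i)%:Z (g i) (y j).
Proof.
case: eqP => [->|/eqP h]; first by rewrite /qc expr1z (osc_gy HO).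
by apply/qc0; apply: (@comm i j); rewrite 1?eq_sym // /omem; tauto.
Qed.

Lemma osc_gdij i j : qc q (- (j == i)%:Z) (g i) (d j).
Proof.
case: eqP => [->|/eqP h]; first by rewrite /qc -invr_expz expr1z (osc_gd HO).
by apply/qc0; apply: (@comm i j); rewrite 1?eq_sym // /omem; tauto.
Qed.

Lemma osc_giyij i j : qc q (- (j == i)%:Z) (gi i) (y j).
Proof. exact (qcV hq (osc_gK HO i) (osc_giK HO i) (osc_gyij i j)). Qed.

Lemma osc_gidij i j : qc q (j == i)%:Z (gi i) (d j).
Proof.
by rewrite -[(_ == _)%:Z]opprK; exact (qcV hq (osc_gK HO i) (osc_giK HO i) (osc_gdij i j)).
Qed.

Lemma osc_yyij i j : y i * y j = y j * y i.
Proof. by case: (eqVneq i j) => [->|h] //; apply: (comm h); rewrite /omem; tauto. Qed.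

Lemma osc_ddij i j : d i * d j = d j * d i.
Proof. by case: (eqVneq i j) => [->|h] //; apply: (comm h); rewrite /omem; tauto. Qed.

Lemma osc_ydij i j : i != j -> y i * d j = d j * y i.
Proof. by move=> h; apply: (comm h); rewrite /omem; tauto. Qed.

Lemma osc_ggij i j : g i * g j = g j * g i.
Proof. by case: (eqVneq i j) => [->|h] //; apply: (comm h); rewrite /omem; tauto. Qed.

Lemma osc_gigiij i j : gi i * gi j = gi j * gi i.
Proof. by case: (eqVneq i j) => [->|h] //; apply: (comm h); rewrite /omem; tauto. Qed.

Lemma osc_ggiij i j : g i * gi j = gi j * g i.
Proof.
case: (eqVneq i j) => [->|h]; last by apply: (comm h); rewrite /omem; tauto.
by rewrite (osc_gK HO) (osc_giK HO).
Qed.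

(** The q-commutator of [d i] and [y i] is [gi i], which itself q-commutes with [d i]; this nested
    q-commutator is the Serre expression up to a scalar. *)
Lemma osc_serre_d i : serre q (d i) (y i) = 0.
Proof.
have h := osc_gidij i i; rewrite eqxx /qc expr1z -(osc_dy HO) in h.
have : q^-1 *: ((d i * y i - q *: (y i * d i)) * d i -
  q *: (d i * (d i * y i - q *: (y i * d i)))) = 0 by rewrite h subrr scaler0.
move/eqP; rewrite -oppr_eq0 => /eqP <-; rewrite /serre.
by ncring ltac:(by field).
Qed.

Lemma osc_serre_y i : serre q (y i) (d i) = 0.
Proof.
have h := osc_giyij i i; rewrite eqxx /qc -invr_expz expr1z -(osc_dy HO) in h.
have : (d i * y i - q *: (y i * d i)) * y i -
  q^-1 *: (y i * (d i * y i - q *: (y i * d i))) = 0 by rewrite h subrr.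
move=> <-; rewrite /serre.
by ncring ltac:(by field).
Qed.

Lemma osc_yd i : y i * d i = (q - q^-1)^-1 *: (g i - gi i).
Proof.
rewrite -(osc_dy HO) -(osc_dyV HO).
have hs := sqr_sub1_neq0 hq hqq.
by ncring ltac:(by field; rewrite ?hq ?hs).
Qed.

Lemma osc_dy' i : d i * y i = (q - q^-1)^-1 *: (q *: g i - q^-1 *: gi i).
Proof.
rewrite -(osc_dy HO) -(osc_dyV HO).
have hs := sqr_sub1_neq0 hq hqq.
by ncring ltac:(by field; rewrite ?hq ?hs).
Qed.

Lemma osc_ef i : (y i * d i.+1) * (y i.+1 * d i) - (y i.+1 * d i) * (y i * d i.+1) =
  (q - q^-1)^-1 *: (g i * gi i.+1 - gi i * g i.+1).
Proof.
have n1 : i != i.+1 by lia.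
have h1 : d i.+1 * y i.+1 * d i = d i * (d i.+1 * y i.+1).
  by rewrite -mulrA (osc_ydij (i := i.+1)) 1?eq_sym // mulrA (osc_ddij i.+1) mulrA.
have h2 : d i * y i * d i.+1 = d i.+1 * (d i * y i).
  by rewrite -mulrA osc_ydij // mulrA (osc_ddij i) mulrA.
rewrite -(mulrA (y i)) (mulrA (d i.+1)) h1 (mulrA (y i)).
rewrite -(mulrA (y i.+1)) (mulrA (d i)) h2 (mulrA (y i.+1)).
rewrite !osc_yd !osc_dy'.
have c1 := osc_ggij i.+1 i; have c2 := osc_ggiij i.+1 i; have c3 := osc_ggiij i i.+1.
have c4 := osc_gigiij i.+1 i.
rewrite -?(@scalerAl _ A) -?(@scalerAr _ A) ?scalerA.
rewrite !(mulrDr, mulrDl, mulrBr, mulrBl, mulNr, mulrN, mulrA).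
rewrite -?(@scalerAl _ A) -?(@scalerAr _ A) ?c1 ?c2 ?c3 ?c4 -?c3.
have hs := sqr_sub1_neq0 hq hqq.
by ncring ltac:(by field; rewrite ?hq ?hs).
Qed.

Lemma osc_rels N : Uq_rels N q osc_gens.
Proof.
have K i : g i * gi i.+1 * (gi i * g i.+1) = 1.
  rewrite -mulrA (mulrA (gi i.+1)) osc_gigiij -mulrA (osc_giK HO) mulr1.
  exact: osc_gK.
have K' i : gi i * g i.+1 * (g i * gi i.+1) = 1.
  rewrite -mulrA (mulrA (g i.+1)) osc_ggij -mulrA (osc_gK HO) mulr1.
  exact: osc_giK.
move=> i j hi hj; split; first exact: K.
split; first exact: K'.
split.
  apply/(qc0 q) => /=; rewrite -[0]addr0; apply: qcMr => //; rewrite -[0]addr0; apply: qcMl => //;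
    apply/qc0;
    first [exact (osc_ggij _ _) | exact (osc_ggiij _ _) | exact (osc_gigiij _ _)
          | exact (esym (osc_ggiij _ _))].
split.
  apply/(@qcJ q A _ _ _ _ (K i) (K' i)) => /=.
  apply: (qc_ext (a := ((j == i)%:Z + - (j == i.+1)%:Z) + (- (j.+1 == i)%:Z + (j.+1 == i.+1)%:Z))).
    apply: qcMr => //; apply: qcMl => //;
    first [exact (osc_gyij _ _) | exact (osc_gdij _ _) | exact (osc_giyij _ _) | exact (osc_gidij _ _)].
  have := cartan_eps i j; rewrite /eps => /(congr1 -%R); rewrite opprK => ->; lia.
split.
  apply/(@qcJ q A _ _ _ _ (K i) (K' i)) => /=.
  apply: (qc_ext (a := ((j.+1 == i)%:Z + - (j.+1 == i.+1)%:Z) + (- (j == i)%:Z + (j == i.+1)%:Z))).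
    apply: qcMr => //; apply: qcMl => //;
    first [exact (osc_gyij _ _) | exact (osc_gdij _ _) | exact (osc_giyij _ _) | exact (osc_gidij _ _)].
  by rewrite cartan_eps /eps; lia.
split.
  case: eqP => [<-|/eqP h] /=; first exact: osc_ef.
  rewrite -(mulrA (y i)) (mulrA (d i.+1)) -(osc_ydij (i := j.+1)); last lia.
  rewrite -!mulrA (osc_ddij i.+1) (mulrA (y i)) (osc_yyij i) -!(mulrA (y j.+1)).
  by rewrite (mulrA (y i)) osc_ydij // -!mulrA subrr.
split=> h.
  have E x z : x ^+ 2 * z - (q + q^-1) *: (x * z * x) + z * x ^+ 2 = serre q x z :> A by [].
  rewrite !E /=; case/orP: h => /eqP h; subst; split.
  - rewrite (@osc_ydij j.+1 j.+2); last lia.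
    apply: serre_comm; last exact: osc_serre_y.
    all: try first [exact (osc_ddij _ _) | exact (osc_yyij _ _) | symmetry; apply: osc_ydij; lia
      | apply: osc_ydij; lia].
  - rewrite (@osc_ydij j.+1 j); last lia.
    apply: serre_comm; last exact: osc_serre_d.
    all: try first [exact (osc_ddij _ _) | exact (osc_yyij _ _) | symmetry; apply: osc_ydij; lia
      | apply: osc_ydij; lia].
  - rewrite (@osc_ydij i.+1 i.+2); last lia.
    apply: serre_comm; last exact: osc_serre_d.
    all: try first [exact (osc_ddij _ _) | exact (osc_yyij _ _) | symmetry; apply: osc_ydij; lia
      | apply: osc_ydij; lia].
  - rewrite (@osc_ydij i.+1 i); last lia.
    apply: serre_comm; last exact: osc_serre_y.
    all: try first [exact (osc_ddij _ _) | exact (osc_yyij _ _) | symmetry; apply: osc_ydij; lia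
      | apply: osc_ydij; lia].
have [n1 n2 n3] : [/\ i != j.+1, j != i.+1 & i != j] by split; lia.
have F a b c e : a != e -> b != c -> y a * d b * (y c * d e) = y c * d e * (y a * d b).
  move=> h1 h2; apply/(qc0 q); rewrite -[0]addr0; apply: qcMr => //; rewrite -[0]addr0;
  apply: qcMl => //; apply/qc0;
  first [exact (osc_ddij _ _) | exact (osc_yyij _ _) | exact (osc_ydij h1)
    | rewrite osc_ydij // eq_sym //].
by split; apply: F; lia.
Qed.

(** Each step of the recursion meets d_{k+1} y_{k+1} - q^-1 y_{k+1} d_{k+1} at the intermediate
    site, which is g_{k+1} by [osc_dyV]. *)
Lemma osc_Root l k : (k < l)%N ->
  Root q osc_gens l k = y l * (\prod_(k.+1 <= t < l) g t) * d k.
Proof.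
move: k; apply: low_ind => [k <-|k hk IH].
  by rewrite Root_low1 big_geq // mulr1.
rewrite Root_lowS // IH /= [in RHS]big_ltn //; set P := \prod_(_ <= _ < _) _.
have cP x : (forall t, (k.+1 < t < l)%N -> g t * x = x * g t) -> P * x = x * P.
  move=> h; rewrite /P big_seq; apply: (big_ind (fun z => z * x = x * z)).
  - by rewrite mul1r mulr1.
  - by move=> a b ha hb; rewrite -mulrA hb mulrA ha mulrA.
  - by move=> t; rewrite mem_index_iota; apply: h.
have Py : P * y k.+1 = y k.+1 * P.
  by apply: cP => t ht; apply: (@comm t k.+1); [lia | rewrite /omem; tauto..].
have Pd : P * d k = d k * P.
  by apply: cP => t ht; apply: (@comm t k); [lia | rewrite /omem; tauto..].
have Pg : P * g k.+1 = g k.+1 * P by apply: cP => t ht; apply: osc_ggij.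
have -> : y k.+1 * d k * (y l * P * d k.+1) = y l * P * (y k.+1 * d k.+1) * d k.
  have yd : y l * d k = d k * y l by apply: osc_ydij; lia.
  rewrite !mulrA (mulr_rule Py) mulrA (osc_yyij l) (mulr_rule (osc_ddij k.+1 k)) mulrA.
  by rewrite (mulr_rule Pd) mulrA (mulr_rule yd) !mulrA.
rewrite -Pg -(osc_dyV HO) !mulrA !(mulrBr, mulrBl) !mulrA -?(@scalerAr _ A) -?(@scalerAl _ A).
by rewrite !mulrA.
Qed.

End Oscillator.

(** * Site operators *)

Definition upd (mu : occ) v x : occ := fun w => if w == v then x else mu w.

Lemma updK mu v : upd mu v (mu v) = mu.
Proof. by apply/funext => w; rewrite /upd; case: eqP => [->|]. Qed.

Lemma upd_same mu v x : upd mu v x v = x.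
Proof. by rewrite /upd eqxx. Qed.

Lemma upd_upd mu v x y : upd (upd mu v x) v y = upd mu v y.
Proof. by apply/funext => w; rewrite /upd; case: eqP. Qed.

Lemma upd_neq mu v x w : w != v -> upd mu v x w = mu w.
Proof. by rewrite /upd => /negPf ->. Qed.

Lemma upd_comm mu v x w y : v != w -> upd (upd mu v x) w y = upd (upd mu w y) v x.
Proof.
move=> h; apply/funext => u; rewrite /upd.
by case: (eqVneq u w) => // ->; rewrite eq_sym (negPf h).
Qed.

Fact site_lin v (c : nat -> CC) (s : nat -> nat) (a : CC) (F G : occ -> CC) (mu : occ) :
  c (mu v) * (a * F (upd mu v (s (mu v))) + G (upd mu v (s (mu v)))) =
  a * (c (mu v) * F (upd mu v (s (mu v)))) + c (mu v) * G (upd mu v (s (mu v))).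
Proof. by ring. Qed.

Definition site v (c : nat -> CC) (s : nat -> nat) : lop :=
  @Lop (fun F mu => c (mu v) * F (upd mu v (s (mu v)))) (site_lin v c s).

Lemma site_comm v w c s c' s' : v != w -> site v c s * site w c' s' = site w c' s' * site v c s.
Proof.
move=> h; apply: lopP => F mu; rewrite !lop_mulE /=.
rewrite upd_neq 1?eq_sym // upd_neq // upd_comm //; ring.
Qed.

Lemma site_mul v c s c' s' :
  site v c s * site v c' s' = site v (fun m => c m * c' (s m)) (s' \o s).
Proof.
by apply: lopP => F mu; rewrite !lop_mulE /= upd_same upd_upd mulrA.
Qed.

Definition dlt (mu : occ) : occ -> CC := fun nu => if `[< nu = mu >] then 1 else 0.

Section Sites.
Variables (q : CC) (hq : q != 0) (hqq : q - q^-1 != 0).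

(** Operators act on functions, so evaluation at the predecessor raises a basis function [dlt mu].
    The factor [m != 0] removes the default value [predn 0 = 0]. All q-integers are put into [sd],
    so that raising never produces a coefficient that vanishes at a root of unity. *)
Definition sy v := site v (fun m => (m != 0)%N%:R) predn.
Definition sd v := site v (fun m => qint q m.+1) succn.
Definition sg v := site v (fun m => q ^+ m) id.
Definition sgi v := site v (fun m => q ^- m) id.

Lemma qintS_q m : qint q m.+1 - q * qint q m = q ^- m.
Proof.
have h : q ^+ m != 0 by rewrite expf_neq0.
have hs := sqr_sub1_neq0 hq hqq.
by rewrite /qint !exprS; field; rewrite hq h hs.
Qed.

Lemma qintS_qV m : qint q m.+1 - q^-1 * qint q m = q ^+ m.
Proof.
have h : q ^+ m != 0 by rewrite expf_neq0.
have hs := sqr_sub1_neq0 hq hqq.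
by rewrite /qint !exprS; field; rewrite hq h hs.
Qed.

Lemma qint0 : qint q 0 = 0.
Proof. by rewrite /qint expr0 invr1 subrr mul0r. Qed.

Lemma sgK v : sg v * sgi v = 1.
Proof.
apply: lopP => F mu; rewrite /sg /sgi site_mul /= updK mulfV ?mul1r //.
by rewrite expf_neq0.
Qed.

Lemma sgiK v : sgi v * sg v = 1.
Proof.
apply: lopP => F mu; rewrite /sg /sgi site_mul /= updK mulVf ?mul1r //.
by rewrite expf_neq0.
Qed.

Lemma sg_sy v : sg v * sy v = q *: (sy v * sg v).
Proof.
apply: lopP => F mu; rewrite /sg /sy !site_mul lop_scaleE /=.
by case: (mu v) => [|m] /=; rewrite ?mulr0 ?mul0r ?mulr0 // exprS; ring.
Qed.

Lemma sg_sd v : sg v * sd v = q^-1 *: (sd v * sg v).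
Proof.
apply: lopP => F mu; rewrite /sg /sd !site_mul lop_scaleE /= exprS.
by field.
Qed.

Lemma sd_sy v : sd v * sy v - q *: (sy v * sd v) = sgi v.
Proof.
apply: lopP => F mu; rewrite /sgi /sd /sy !site_mul lop_addE -scaleNr lop_scaleE /=.
rewrite updK -qintS_q; case: (mu v) (updK mu v) => [|m] /= h; rewrite ?h ?qint0; ring.
Qed.

Lemma sd_syV v : sd v * sy v - q^-1 *: (sy v * sd v) = sg v.
Proof.
apply: lopP => F mu; rewrite /sg /sd /sy !site_mul lop_addE -scaleNr lop_scaleE /=.
rewrite updK -qintS_qV; case: (mu v) (updK mu v) => [|m] /= h; rewrite ?h ?qint0; ring.
Qed.

(* In copy a the site a is Fourier transformed: multiplication and difference
   operator are exchanged there, so that the vacuum is not killed by [d a]. *)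
Definition Oy a i := if i == a then - sd (a, i) else sy (a, i).
Definition Od a i := if i == a then sy (a, i) else sd (a, i).
Definition Og a i := if i == a then q^-1 *: sgi (a, i) else sg (a, i).
Definition Ogi a i := if i == a then q *: sg (a, i) else sgi (a, i).

(** A common shape for all oscillator operators, from which commutation at different sites follows
    at once. *)
Lemma omem_site a i x : omem (Oy a) (Od a) (Og a) (Ogi a) i x ->
  exists c c' s, x = c *: site (a, i) c' s.
Proof.
have one v c s : exists c0 c' s', site v c s = c0 *: site v c' s'.
  by exists 1, c, s; rewrite scale1r.
rewrite /omem /Oy /Od /Og /Ogi; case: eqP => _ [|[|[|]]] ->; try exact: one.
- by exists (-1), (fun m => qint q m.+1), succn; rewrite scaleN1r.
- by exists q^-1, (fun m => q ^- m), id.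
- by exists q, (fun m => q ^+ m), id.
Qed.

Lemma site_commZ v w c c' s d d' s' : v != w ->
  (c *: site v c' s) * (d *: site w d' s') = (d *: site w d' s') * (c *: site v c' s).
Proof.
move=> h; rewrite -!(@scalerAl _ lop) -!(@scalerAr _ lop) !scalerA (site_comm _ _ _ _ h).
by rewrite mulrC.
Qed.

Lemma oscillatorP a : oscillator q (Oy a) (Od a) (Og a) (Ogi a).
Proof.
split.
- move=> i; rewrite /Og /Ogi; case: eqP => _; last exact: sgK.
  by rewrite -(@scalerAl _ lop) -(@scalerAr _ lop) sgiK scalerA mulVf // scale1r.
- move=> i; rewrite /Og /Ogi; case: eqP => _; last exact: sgiK.
  by rewrite -(@scalerAl _ lop) -(@scalerAr _ lop) sgK scalerA mulfV // scale1r.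
- move=> i j h x z /omem_site [c [c' [s ->]]] /omem_site [d [d' [s' ->]]].
  by apply: site_commZ; apply: contra h => /eqP [->].
- move=> i; rewrite /Og /Oy; case: eqP => _; last exact: sg_sy.
  have := qcV hq (sgK (a,i)) (sgiK (a,i)) (a := -1) (x := sd (a, i)).
  rewrite /qc opprK expr1z exprN1 => /(_ (sg_sd _)) E.
  by rewrite -(@scalerAl _ lop) mulrN E -(@scalerAr _ lop) mulNr !scalerN !scalerA mulVf // mulfV.
- move=> i; rewrite /Og /Od; case: eqP => _; last exact: sg_sd.
  have := qcV hq (sgK (a,i)) (sgiK (a,i)) (a := 1) (x := sy (a, i)).
  rewrite /qc expr1z exprN1 => /(_ (sg_sy _)) E.
  by rewrite -(@scalerAl _ lop) E -(@scalerAr _ lop) !scalerA.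
(* Origin of the factor [q] in [Ogi]: at the exchanged site the relation reads - sy sd + q sd sy = q
   (sd sy - q^-1 sy sd) = q sg. *)
- move=> i; rewrite /Ogi /Od /Oy; case: eqP => _; last exact: sd_sy.
  by rewrite -sd_syV; ncring ltac:(by field).
- move=> i; rewrite /Og /Od /Oy; case: eqP => _; last exact: sd_syV.
  by rewrite -sd_sy; ncring ltac:(by field).
Qed.
End Sites.

(** * The vacuum representation *)

(* Occupation numbers of the vector obtained from the vacuum by the word [w] in
   the root vectors E_{n+j,k}, encoded as pairs (j, k). *)
Definition wocc n (w : seq (nat * nat)) : occ := fun s =>
  (count (fun v => s == (v.2, v.2)) w + count (fun v => s == (v.2, n + v.1)) w)%N.

(** Weaker than being ordered. The rightmost letter acts first; if a later letter (j', k') had j' <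
    j and k' < k, then a term of E_{n+j,k} could move the quantum at n+j' of copy k' to n+j, and the
    result would no longer be a single basis vector. Reversed pairs within a row or a column are
    allowed. *)
Definition admissible n (w : seq (nat * nat)) :=
  all (fun v => [&& 0 < v.1, 0 < v.2 & v.2 <= n]%N) w &&
  pairwise (fun v u => ~~ ((u.1 < v.1)%N && (u.2 < v.2)%N)) w.

Lemma wocc_count n w j k : all (fun v => [&& 0 < v.1, 0 < v.2 & v.2 <= n]%N) w ->
  (0 < j)%N -> (0 < k <= n)%N -> wocc n w (k, (n + j)%N) = count_mem (j, k) w.
Proof.
move=> hw hj hk; rewrite /wocc.
rewrite (_ : count _ w = 0%N); last first.
  apply/eqP; rewrite eqn0Ngt -has_count; apply/hasPn => -[j' k'] _ /=.
  by apply/eqP => -[e1 e2]; lia.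
rewrite add0n; apply: eq_count => -[j' k'] /=; apply/eqP/eqP => [[-> /addnI ->]|[-> ->]] //.
Qed.

Section Vacuum.
Variables (q : CC) (hq : q != 0) (hqq : q - q^-1 != 0).

Definition opO a := osc_gens (Oy q a) (Od q a) (Og q a) (Ogi q a).

(** Tensor product of the copies p, ..., 1, starting from the trivial representation. *)
Fixpoint opG p : gens lop :=
  match p with
  | 0 => Gens (fun _ => 0) (fun _ => 0) (fun _ => 1) (fun _ => 1)
  | p'.+1 => gtens (opO p) (opG p')
  end.

Lemma omem_comm a b i j x z : a != b ->
  omem (Oy q a) (Od q a) (Og q a) (Ogi q a) i x ->
  omem (Oy q b) (Od q b) (Og q b) (Ogi q b) j z -> x * z = z * x.
Proof.
move=> h /omem_site [c [c' [s ->]]] /omem_site [d [d' [s' ->]]].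
by apply: site_commZ; apply: contra h => /eqP [->].
Qed.

Lemma opO_opG p a i j x z : (p < a)%N ->
  omem (Oy q a) (Od q a) (Og q a) (Ogi q a) i x -> gmem (opG p) j z -> GRing.comm x z.
Proof.
elim: p z => [|p IH] z h hx.
  by case=> [|[|[|]]] -> /=; first [exact: commr0 | exact: commr1].
have c t s : omem (Oy q p.+1) (Od q p.+1) (Og q p.+1) (Ogi q p.+1) s t -> GRing.comm x t.
  by move=> ht; apply: omem_comm hx ht; rewrite gtn_eqF.
have c' t : gmem (opG p) j t -> GRing.comm x t by apply: IH => //; lia.
by case=> [|[|[|]]] -> /=; repeat first [apply: commrD | apply: commrM];
  first [by apply: (c _ j); rewrite /omem; tauto | by apply: (c _ j.+1); rewrite /omem; tauto
        | by apply: c'; rewrite /gmem; tauto].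
Qed.

Lemma opG_comm N p : gcomm N (opO p.+1) (opG p).
Proof.
move=> i j _ _ x z hx hz; apply/commr_sym.
have c t s : omem (Oy q p.+1) (Od q p.+1) (Og q p.+1) (Ogi q p.+1) s t -> GRing.comm z t.
  by move=> ht; apply/commr_sym; apply: opO_opG ht hz.
by case: hx => [|[|[|]]] -> /=; apply: commrM;
  first [by apply: (c _ i); rewrite /omem; tauto | by apply: (c _ i.+1); rewrite /omem; tauto].
Qed.

Lemma opO_rels N p : Uq_rels N q (opO p).
Proof. by apply: osc_rels => //; apply: oscillatorP. Qed.

Lemma opG_rels N p : Uq_rels N q (opG p).
Proof.
elim: p => [|p IH] /=; last by apply: gtens_rels => //; [exact: opO_rels | exact: opG_comm].
move=> i j _ _ /=; split; first by rewrite mulr1.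
split; first by rewrite mulr1.
split=> //; split; first by rewrite mulr0 mul0r scaler0.
split; first by rewrite mulr0 mul0r scaler0.
split; first by rewrite mulr0 !subrr scaler0 if_same.
by split=> _; split; rewrite !(mulr0, mul0r) ?scaler0 ?subrr ?addr0.
Qed.

Definition diag (T : lop) := forall mu,
  exists2 c : CC, c != 0 & T (dlt mu) = (fun x => c * dlt mu x).

Lemma lopZf (T : lop) c F : T (fun x => c * F x) = (fun x => c * T F x).
Proof. by apply/funext => mu; rewrite lopZ. Qed.

Lemma lop0f (T : lop) : T (fun _ => 0) = (fun _ => 0).
Proof.
have -> : (fun _ => 0) = (fun x : occ => 0 * dlt x x) by apply/funext => x; rewrite mul0r.
by rewrite lopZf; apply/funext => mu; rewrite !mul0r.
Qed.

Lemma diag1 : diag 1.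
Proof. by move=> mu; exists 1; rewrite ?oner_neq0 //; apply/funext => x; rewrite mul1r. Qed.

Lemma diagM S T : diag S -> diag T -> diag (S * T).
Proof.
move=> hS hT mu; have [c hc ec] := hS mu; have [d hd ed] := hT mu.
exists (d * c); first by rewrite mulf_neq0.
by rewrite lop_mulE ed lopZf ec; apply/funext => x; rewrite mulrA.
Qed.

Lemma diag_prod (I : eqType) (r : seq I) (F : I -> lop) :
  (forall i, diag (F i)) -> diag (\prod_(i <- r) F i).
Proof. by move=> h; apply: big_ind => //; [exact: diag1 | exact: diagM]. Qed.

Lemma diagZ c T : c != 0 -> diag T -> diag (c *: T).
Proof.
move=> hc hT mu; have [d hd ed] := hT mu; exists (c * d); first by rewrite mulf_neq0.
by apply/funext => x; rewrite lop_scaleE ed mulrA.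
Qed.

Lemma diag_site v (c : nat -> CC) : (forall m, c m != 0) -> diag (site v c id).
Proof.
move=> h mu; exists (c (mu v)) => //; apply/funext => nu /=; rewrite updK /dlt.
by case: asboolP => [->|] //; rewrite !mulr0.
Qed.

Lemma diag_Og a i : diag (Og q a i).
Proof.
rewrite /Og; case: eqP => _; first apply: diagZ; rewrite ?invr_eq0 //.
  by apply: diag_site => m; rewrite invr_eq0 expf_neq0.
by apply: diag_site => m; rewrite expf_neq0.
Qed.

Lemma diag_Ogi a i : diag (Ogi q a i).
Proof.
rewrite /Ogi; case: eqP => _; first apply: diagZ; rewrite ?invr_eq0 //.
  by apply: diag_site => m; rewrite expf_neq0.
by apply: diag_site => m; rewrite invr_eq0 expf_neq0.
Qed.

Lemma diag_Kprod a i l : diag (Kprod (opO a) i l).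
Proof.
by apply: diag_prod => t /=; apply: diagM; [exact: diag_Og | exact: diag_Ogi].
Qed.

Lemma sy_dlt v mu : sy v (dlt mu) = dlt (upd mu v (mu v).+1).
Proof.
apply/funext => nu /=; rewrite /dlt.
case E: (nu v) => [|k] /=.
  rewrite mul0r; case: asboolP => // h.
  by have := E; rewrite h upd_same.
rewrite mul1r; congr (if `[< _ >] then _ else _); apply/propext; split=> [<-|h].
  by rewrite upd_same upd_upd -E updK.
by move: E; rewrite h upd_same => -[<-]; rewrite upd_upd updK.
Qed.

Lemma sd_dlt0 v mu : mu v = 0%N -> sd q v (dlt mu) = (fun _ => 0).
Proof.
move=> h; apply/funext => nu /=; rewrite /dlt; case: asboolP => [E|]; last by rewrite mulr0.
by have := h; rewrite -E upd_same.
Qed.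

(** Away from the exchanged site the rightmost factor d_t of the root vector is a genuine lowering
    operator. *)
Lemma opO_kill a l t mu : (t < l)%N -> a != t -> mu (a, t) = 0%N ->
  Root q (opO a) l t (dlt mu) = (fun _ => 0).
Proof.
move=> htl hat h0; rewrite (osc_Root hq hqq (oscillatorP hq hqq a) htl) lop_mulE.
by rewrite /Od eq_sym (negPf hat) sd_dlt0 // lop0f.
Qed.

Lemma opO_raise l k mu : (k < l)%N -> exists2 c : CC, c != 0 &
  Root q (opO k) l k (dlt mu) =
  (fun x => c * dlt (upd (upd mu (k, k) (mu (k, k)).+1) (k, l) (mu (k, l)).+1) x).
Proof.
move=> hkl; rewrite (osc_Root hq hqq (oscillatorP hq hqq k) hkl).
rewrite !lop_mulE /Od eqxx sy_dlt.
have [c hc ec] := diag_prod (index_iota k.+1 l) (diag_Og k) (upd mu (k, k) (mu (k, k)).+1).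
exists c => //; rewrite ec lopZf /Oy gtn_eqF // sy_dlt upd_neq //.
by apply/eqP => -[] /eqP; rewrite gtn_eqF.
Qed.

Lemma lop_sumE (I : Type) (r : seq I) (P : pred I) (F : I -> lop) G x :
  (\sum_(i <- r | P i) F i) G x = \sum_(i <- r | P i) F i G x.
Proof. by apply: (big_morph (fun T : lop => T G x)). Qed.

(** Used to let the factor in copy p+1 act first, where it kills the vector. *)
Lemma Root_opG_comm p a b c l s : (0 < a)%N -> (a < b)%N -> (b <= c)%N ->
  (0 < s)%N -> (s < l)%N ->
  Root q (opO p.+1) b a * Kprod (opO p.+1) b c * Root q (opG p) l s =
  Root q (opG p) l s * (Root q (opO p.+1) b a * Kprod (opO p.+1) b c).
Proof.
move=> h1 h2 h3 h4 h5; set N := (b + c + l)%N.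
have C : GRing.comm (Root q (opG p) l s) (Root q (opO p.+1) b a * Kprod (opO p.+1) b c).
  apply: commrM; last first.
    rewrite /Kprod big_seq; apply: (big_ind (GRing.comm (Root q (opG p) l s))).
    - exact: commr1.
    - by move=> x y; apply: commrM.
    - move=> t; rewrite mem_index_iota => ht; apply/commr_sym.
      apply: (gcomm_Root hq (@opG_comm N p)) => //; first lia.
      by exists t; [lia | rewrite /gmem; tauto].
  apply: Root_comm => // t ht; apply/commr_sym.
  apply: (gcomm_Root hq (@opG_comm N p)) => //; first lia.
  by exists t; [lia | rewrite /gmem; tauto].
by rewrite C.
Qed.

Lemma opG_kill p l t mu : (0 < t)%N -> (t < l)%N ->
  (forall a, (0 < a <= p)%N -> a != t /\ mu (a, t) = 0%N) ->
  Root q (opG p) l t (dlt mu) = (fun _ => 0).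
Proof.
move=> ht htl; elim: p => [|p IH] h.
  suff -> : Root q (opG 0) l t = 0 by [].
  move: t htl {ht h}; apply: low_ind => [k <-|k hk IH]; first by rewrite Root_low1.
  by rewrite Root_lowS // mulr0 mul0r scaler0 subrr.
rewrite (Root_gtens hq (@opO_rels l p.+1) (@opG_rels l p) (@opG_comm l p)) //.
have [h1 h2] := h p.+1 ltac:(lia).
apply/funext => x; rewrite !lop_addE lop_scaleE lop_sumE opO_kill // add0r.
rewrite lop_mulE IH ?lop0f ?add0r; last by move=> a ha; apply: h; lia.
rewrite big_nat big1 ?mulr0 // => s hs.
rewrite Root_opG_comm ?lop_mulE; try lia.
have [c hc ->] := diag_Kprod p.+1 s l mu.
by rewrite lopZf opO_kill //; [rewrite lopZ lop0f mulr0 | lia].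
Qed.

(** Only the term in which the whole root vector acts in copy k survives. In the other copies site k
    is empty; the terms splitting at a site t act by E_{l,t} in copies below k, where site t is
    empty by the first vacancy condition if t <= n and by the second if t > n. *)
Lemma opG_raise n p l k mu : (0 < k)%N -> (k <= p)%N -> (k <= n)%N -> (n < l)%N ->
  (forall a i, (0 < i <= n)%N -> i != a -> mu (a, i) = 0%N) ->
  (forall a i, (a < k)%N -> (n < i < l)%N -> mu (a, i) = 0%N) ->
  exists2 c : CC, c != 0 & Root q (opG p) l k (dlt mu) =
  (fun x => c * dlt (upd (upd mu (k, k) (mu (k, k)).+1) (k, l) (mu (k, l)).+1) x).
Proof.
move=> hk hkp hkn hnl c1 c2; elim: p hkp => [|p IH] hkp; first lia.
rewrite (Root_gtens hq (@opO_rels l p.+1) (@opG_rels l p) (@opG_comm l p)) //; last lia.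
case: (ltngtP k p.+1) hkp => // [hkp|e] _.
  have [c hc ec] := IH hkp.
  have [d hd ed] := diag_Kprod p.+1 k l (upd (upd mu (k, k) (mu (k, k)).+1) (k, l) (mu (k, l)).+1).
  exists (c * d); first by rewrite mulf_neq0.
  apply/funext => x; rewrite !lop_addE lop_scaleE lop_sumE.
  have K0 : mu (p.+1, k) = 0%N by apply: c1; lia.
  have n0 : p.+1 != k by lia.
  rewrite opO_kill //; last lia.
  rewrite add0r lop_mulE ec lopZf ed big_nat big1 ?mulr0 ?addr0 ?mulrA // => s hs.
  rewrite Root_opG_comm ?lop_mulE; try lia.
  have [c' hc' ->] := diag_Kprod p.+1 s l mu.
  by rewrite lopZf opO_kill //; [rewrite lopZ lop0f mulr0 | lia].
have [c hc ec] := @opO_raise l k mu ltac:(lia).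
exists c => //; apply/funext => x; rewrite !lop_addE lop_scaleE lop_sumE -e ec.
rewrite lop_mulE opG_kill ?lop0f ?addr0; [|lia..|]; last first.
  by move=> a ha; split; [lia | apply: c1; lia].
rewrite big_nat big1 ?mulr0 ?addr0 // => s hs.
rewrite lop_mulE opG_kill ?lop0f //; [lia..|].
move=> a ha; split; first lia.
by case: (leqP s n) => hsn; [apply: c1; lia | apply: c2; lia].
Qed.

Lemma vacuum_word n w : admissible n w -> exists2 c : CC, c != 0 &
  (\prod_(v <- w) Root q (opG n) (n + v.1) v.2) (dlt (wocc n [::])) =
  (fun x => c * dlt (wocc n w) x).
Proof.
elim: w => [|[j k] w IH].
  by move=> _; exists 1; rewrite ?oner_neq0 // big_nil; apply/funext => x; rewrite mul1r.
rewrite /admissible /= => /andP[/andP[/and3P[hj hk hkn] hw] /andP[hpw hp]].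
have [|c hc ec] := IH; first by rewrite /admissible hw.
have := @opG_raise n n (n + j) k (wocc n w) hk hkn hkn ltac:(lia).
case=> [a i hi hia|a i hak hi|d hd ed].
- rewrite /wocc -[0%N]addn0; congr addn; apply/eqP; rewrite eqn0Ngt -has_count.
    apply/hasPn => -[j' k'] _ /=; apply/eqP => -[e1 e2]; move: hia; rewrite e1 e2; lia.
  apply/hasPn => -[j' k'] /(allP hw) /= h; apply/eqP => -[e1 e2]; lia.
- rewrite /wocc -[0%N]addn0; congr addn; apply/eqP; rewrite eqn0Ngt -has_count.
    apply/hasPn => -[j' k'] /(allP hw) /= h; apply/eqP => -[e1 e2]; lia.
  apply/hasPn => -[j' k'] hv /=; apply/eqP => -[e1 e2].
  by have /= := allP hpw _ hv; lia.
exists (c * d); first by rewrite mulf_neq0.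
rewrite big_cons lop_mulE ec lopZf ed.
suff -> : upd (upd (wocc n w) (k, k) (wocc n w (k, k)).+1) (k, (n + j)%N)
    (wocc n w (k, (n + j)%N)).+1 = wocc n ((j, k) :: w).
  by apply/funext => x; rewrite mulrA.
have hne : (k, k) != (k, (n + j)%N) by apply/eqP => -[]; lia.
apply/funext => s; rewrite /upd /wocc /=.
case: (eqVneq s (k, (n + j)%N)) => [->|h1].
  by rewrite [(k, _) == _]eq_sym (negPf hne) add0n add1n addnS.
by case: (eqVneq s (k, k)) => [->|h2] /=; rewrite ?(negPf h1) ?(negPf h2) ?eqxx ?(negPf hne).
Qed.

End Vacuum.

(** * Linear extension from monomials *)

Section Mlift.
Variables (d : nat) (V : lmodType CC).

(** The common shape of [Phi], [dop], [gam] and [gami], so that linearity is proved once. *)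
Definition mlift (F : 'X_{1..d} -> V) (p : {mpoly CC[d]}) : V :=
  \sum_(r <- msupp p) p@_r *: F r.

Lemma mlift_sup F p (s : seq 'X_{1..d}) : uniq s -> {subset msupp p <= s} ->
  mlift F p = \sum_(r <- s) p@_r *: F r.
Proof.
move=> us hs; rewrite (bigID (mem (msupp p))) /= [X in _ + X]big1 ?addr0; last first.
  by move=> r /memN_msupp_eq0 ->; rewrite scale0r.
rewrite -big_filter; apply: perm_big; apply: uniq_perm; rewrite ?filter_uniq ?msupp_uniq //.
move=> r; rewrite mem_filter; case: (boolP (r \in msupp p)) => // /hs -> //.
Qed.

Lemma mlift_lin F (c : CC) p p' : mlift F (c *: p + p') = c *: mlift F p + mlift F p'.
Proof.
pose s := undup (msupp p ++ msupp p' ++ msupp (c *: p + p')).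
have us : uniq s by apply: undup_uniq.
rewrite !(@mlift_sup _ _ s) //; try by move=> r h; rewrite mem_undup !mem_cat h ?orbT.
rewrite scaler_sumr -big_split; apply: eq_bigr => r _ /=.
by rewrite mcoeffD mcoeffZ scalerDl scalerA.
Qed.

Lemma mliftX F r : mlift F 'X_[r] = F r.
Proof. by rewrite /mlift msuppX big_seq1 mcoeffX eqxx scale1r. Qed.

Lemma mlift0 F : mlift F 0 = 0.
Proof. by rewrite /mlift msupp0 big_nil. Qed.

Lemma mliftZ F c p : mlift F (c *: p) = c *: mlift F p.
Proof. by rewrite -[c *: p]addr0 mlift_lin mlift0 addr0. Qed.

Lemma mlift_ext F G p : (forall r, F r = G r) -> mlift F p = mlift G p.
Proof. by move=> h; apply: eq_bigr => r _; rewrite h. Qed.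

Lemma mlift_uniq (h : {mpoly CC[d]} -> V) p :
  is_lin h -> h p = mlift (fun r => h 'X_[r]) p.
Proof.
move=> hl; rewrite {1}(mpolyE p) /mlift.
have h0 : h 0 = 0.
  have := hl (-1) 0 0; rewrite scaler0 addr0 scaleN1r addNr; by [].
elim: (msupp p) => [|r s IH]; first by rewrite !big_nil.
by rewrite !big_cons hl IH.
Qed.

End Mlift.

(** * Algebra homomorphisms *)

Section AlgHom.
Variables (A B : algType CC) (phi : A -> B) (H : is_alg_hom phi).

Lemma hom1 : phi 1 = 1. Proof. by case: H => _ []. Qed.

Lemma homM x y : phi (x * y) = phi x * phi y. Proof. by case: H => _ []. Qed.

Lemma hom0 : phi 0 = 0.
Proof. by case: H => h _; have := h (-1) 0 0; rewrite scaler0 addr0 scaleN1r addNr. Qed.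

Lemma homZ c x : phi (c *: x) = c *: phi x.
Proof. by case: H => h _; have := h c x 0; rewrite !addr0 hom0 addr0. Qed.

Lemma homD x y : phi (x + y) = phi x + phi y.
Proof. by case: H => h _; have := h 1 x y; rewrite !scale1r. Qed.

Lemma homN x : phi (- x) = - phi x.
Proof. by rewrite -[- x]scaleN1r homZ scaleN1r. Qed.

Lemma homB x y : phi (x - y) = phi x - phi y.
Proof. by rewrite homD homN. Qed.

Lemma hom_sum (I : Type) (r : seq I) (F : I -> A) :
  phi (\sum_(i <- r) F i) = \sum_(i <- r) phi (F i).
Proof. by apply: (big_morph phi homD hom0). Qed.

Lemma hom_prod (I : Type) (r : seq I) (F : I -> A) :
  phi (\prod_(i <- r) F i) = \prod_(i <- r) phi (F i).
Proof. by apply: (big_morph phi homM hom1). Qed.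

Lemma hom_Root N q (g : gens A) (g' : gens B) l k : maps_gens N phi g g' ->
  (l <= N)%N -> (k < l)%N -> (0 < k)%N -> phi (Root q g l k) = Root q g' l k.
Proof.
move=> hm hl; move: k; apply: low_ind => [k e|k hk IH] h0.
  by subst l; rewrite !Root_low1; have [|_ [-> _]] := hm k; first lia.
rewrite (Root_lowS q g hk) (Root_lowS q g' hk) homB homZ !homM IH //.
by have [|_ [-> _]] := hm k; first lia.
Qed.

End AlgHom.

(** * Monomials in the root vectors E_{n+j,k} *)

Section Words.
Variables (n m : nat) (hn : (0 < n)%N) (hm : (0 < m)%N).
Local Notation mon := 'X_{1..nv n m}.
Implicit Types (v : nat * nat) (w : seq (nat * nat)).

Definition vi v : 'I_(nv n m) := vidx n m v.1 v.2.
Definition valid v := (0 < v.1 <= m)%N && (0 < v.2 <= n)%N.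
(** The order in which the factors appear in [Emon]. *)
Definition lexo v u := (v.1 < u.1)%N || ((v.1 == u.1) && (v.2 <= u.2)%N).
Definition vlist : seq (nat * nat) := [seq (j, k) | j <- iota 1 m, k <- iota 1 n].
Definition vof (i : nat) : nat * nat := ((i %/ n).+1, (i %% n).+1).

Lemma lexo_refl v : lexo v v.
Proof. by rewrite /lexo eqxx leqnn orbT. Qed.

Lemma lexo_trans : transitive lexo.
Proof. by move=> v u w; rewrite /lexo; case: v u w => [a b] [c d] [e f] /=; lia. Qed.

Lemma lexo_anti : antisymmetric lexo.
Proof.
move=> [a b] [c d]; rewrite /lexo /= => h; congr pair; move: h; lia.
Qed.

Lemma mem_vlist v : (v \in vlist) = valid v.
Proof.
case: v => j k; rewrite /valid /=; apply/allpairsP/idP => [[[a b] /= [h1 h2 [-> ->]]]|h].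
  by move: h1 h2; rewrite !mem_iota; lia.
by exists (j, k); split=> //=; rewrite mem_iota; lia.
Qed.

Lemma uniq_vlist : uniq vlist.
Proof. by apply: allpairs_uniq; rewrite ?iota_uniq // => -[a b] [c d] _ _ /= [-> ->]. Qed.

Lemma pairwise_vlist : pairwise lexo vlist.
Proof.
rewrite /vlist; have : pairwise ltn (iota 1 m) by rewrite -(sorted_pairwise ltn_trans) iota_ltn_sorted.
have : pairwise ltn (iota 1 n) by rewrite -(sorted_pairwise ltn_trans) iota_ltn_sorted.
elim: (iota 1 m) => [|j s IH] //= ht /andP[hj hs].
rewrite pairwise_cat IH // andbT; apply/andP; split.
  apply/allrelP => v u /mapP [k hk ->] /allpairsP [[a b] /= [ha hb ->]].
  by rewrite /lexo /=; have := allP hj _ ha => /= ->.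
elim: (iota 1 n) ht {IH} => [|k t IHt] //= /andP[hk ht]; rewrite IHt // andbT.
apply/allP => v /mapP [b hb ->]; rewrite /lexo /= eqxx ltnn /=.
by have := allP hk _ hb => /= /ltnW.
Qed.

Lemma nv_eq : nv n m = (m * n)%N.
Proof. by rewrite /nv prednK // muln_gt0 hm. Qed.

Lemma vi_val v : valid v -> vi v = (v.1.-1 * n + v.2.-1)%N :> nat.
Proof.
case: v => j k /andP[/= h1 h2]; rewrite /vi /vidx /= inordK // -/(nv n m) nv_eq.
have [j' e] : exists j', j = j'.+1 by exists j.-1; lia.
have : (j' < m)%N by lia.
rewrite e /= => h; have := leq_mul h (leqnn n); rewrite mulSn; lia.
Qed.

Lemma vof_vi v : valid v -> vof (vi v) = v.
Proof.
move=> h; rewrite /vof vi_val //; case: v h => j k /andP[/= h1 h2].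
rewrite divnMDl // modnMDl divn_small ?modn_small; try lia.
by congr pair; lia.
Qed.

Lemma valid_vof (i : 'I_(nv n m)) : valid (vof i).
Proof.
have hi : (i < m * n)%N by rewrite -nv_eq.
by rewrite /valid /vof /= ltn_divLR // hi ltn_pmod.
Qed.

Lemma vi_vof (i : 'I_(nv n m)) : vi (vof i) = i.
Proof. by apply/val_inj; rewrite /= (vi_val (valid_vof i)) /= -divn_eq. Qed.

Lemma vi_inj v u : valid v -> valid u -> vi v = vi u -> v = u.
Proof. by move=> hv hu h; rewrite -(vof_vi hv) h vof_vi. Qed.

Lemma mon_eq (r s : mon) : (forall v, valid v -> r (vi v) = s (vi v)) -> r = s.
Proof. by move=> h; apply/mnmP => i; rewrite -(vi_vof i); apply: h; apply: valid_vof. Qed.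

Definition wmon w : mon := [multinom count_mem (vof i) w | i < nv n m].

Lemma wmonE w v : valid v -> wmon w (vi v) = count_mem v w.
Proof. by move=> h; rewrite mnmE vof_vi. Qed.

Definition word (r : mon) := flatten [seq nseq (r (vi v)) v | v <- vlist].

Lemma count_word r v : valid v -> count_mem v (word r) = r (vi v).
Proof.
rewrite -mem_vlist /word; move: uniq_vlist; elim: vlist => [|u s IH] //= /andP[hu us].
rewrite inE count_cat count_nseq /= => /predU1P[->|hv].
  rewrite eqxx mul1n -[RHS]addn0; congr addn; apply/eqP; rewrite eqn0Ngt -has_count.
  apply/hasPn => x /flattenP [y /mapP [z hz ->]] /nseqP [-> _].
  by apply: contra hu => /eqP <-.
have hne : u != v by apply: contra hu => /eqP ->.
by rewrite (negPf hne) mul0n add0n IH.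
Qed.

Lemma wmon_word r : wmon (word r) = r.
Proof. by apply: mon_eq => v hv; rewrite wmonE // count_word. Qed.

Lemma valid_word r : all valid (word r).
Proof.
by apply/allP => x /flattenP [y /mapP [z hz ->]] /nseqP [-> _]; rewrite -mem_vlist.
Qed.

Lemma pairwise_word r : pairwise lexo (word r).
Proof.
rewrite /word; move: pairwise_vlist; elim: vlist => [|u s IH] //= /andP[hu hs].
rewrite pairwise_cat IH // andbT; apply/andP; split.
  apply/allrelP => x y /nseqP [-> _] /flattenP [z /mapP [t ht ->]] /nseqP [-> _].
  exact: (allP hu).
elim: (r (vi u)) => [|c IHc] //=; rewrite IHc andbT.
by apply/allP => x /nseqP [-> _]; apply: lexo_refl.
Qed.

(** Two sorted lists with the same multiplicities are equal. *)
Lemma wordK w : all valid w -> pairwise lexo w -> word (wmon w) = w.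
Proof.
move=> hw hp; apply: (sorted_eq lexo_trans lexo_anti).
- by rewrite (sorted_pairwise lexo_trans) pairwise_word.
- by rewrite (sorted_pairwise lexo_trans).
apply/allP => v; rewrite mem_cat => hv /=; apply/eqP.
have hval : valid v by case/orP: hv => [/(allP (valid_word _))|/(allP hw)].
by rewrite count_word // wmonE.
Qed.

Lemma lexo_admissible w : all valid w -> pairwise lexo w -> admissible n w.
Proof.
move=> hw hp; apply/andP; split.
  by apply: sub_all hw => v; rewrite /valid; lia.
by apply: sub_pairwise hp => v u; rewrite /lexo; case: v u => [a b] [c d] /=; lia.
Qed.

Section Emon.
Variables (q : CC) (U : algType CC) (g : gens U).
Local Notation b v := (Root q g (n + v.1) v.2).

Lemma EmonE r : Emon q g r = \prod_(v <- vlist) b v ^+ r (vi v).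
Proof.
rewrite /vlist big_allpairs /Emon.
have i1 t : iota 1 t = map succn (index_iota 0 t) by rewrite (iotaDl 1 0) /index_iota subn0.
rewrite !i1 big_map big_mkord; apply: eq_bigr => j _.
by rewrite big_map big_mkord; apply: eq_bigr.
Qed.

Lemma Emon_word r : Emon q g r = \prod_(v <- word r) b v.
Proof.
rewrite EmonE /word; move: vlist => s; rewrite big_flatten big_map; apply: eq_bigr => u _.
by rewrite big_nseq -Monoid.iteropE.
Qed.

Lemma word_Emon w : all valid w -> pairwise lexo w ->
  Emon q g (wmon w) = \prod_(v <- w) b v.
Proof. by move=> h1 h2; rewrite Emon_word wordK. Qed.

End Emon.
End Words.

(** * Linear independence of the monomials *)

Section Independence.
Variables (n m : nat) (hn : (0 < n)%N) (hm : (0 < m)%N).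
Variables (q : CC) (hq : q != 0) (hqq : q - q^-1 != 0).
Variables (U : algType CC) (g : gens U) (HU : is_Uq (n + m) q g).
Local Notation mon := 'X_{1..nv n m}.
Local Notation bw w := (\prod_(v <- w) Root q g (n + v.1) v.2).
Implicit Types (w : seq (nat * nat)) (p : Cx n m).

Lemma PhiX (r : mon) : Phi q g ('X_[r] : Cx n m) = Emon q g r.
Proof. exact: mliftX. Qed.

Lemma Phi_lin (c : CC) p p' : Phi q g (c *: p + p') = c *: Phi q g p + Phi q g p'.
Proof. exact: mlift_lin. Qed.

Lemma PhiZ c p : Phi q g (c *: p) = c *: Phi q g p.
Proof. exact: mliftZ. Qed.

Lemma Phi0 : Phi q g (0 : Cx n m) = 0.
Proof. exact: mlift0. Qed.

Lemma wocc_wmon w w' : all (valid n m) w -> all (valid n m) w' ->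
  wocc n w = wocc n w' -> wmon n m w = wmon n m w'.
Proof.
move=> hw hw' h; apply: (mon_eq hn hm) => v hv; rewrite !(wmonE hn hm) //.
have hs u : all (valid n m) u -> all (fun v => [&& 0 < v.1, 0 < v.2 & v.2 <= n]%N) u.
  by apply: sub_all => x; rewrite /valid; lia.
case: v hv => j k hv; have [h1 h2] : (0 < j)%N /\ (0 < k <= n)%N by move: hv; rewrite /valid /=; lia.
by rewrite -(wocc_count (hs _ hw)) // -(wocc_count (hs _ hw')) // h.
Qed.

(** Initiality of [U] turns the generators [opG n] into a representation. *)
Lemma vacuum_rep : exists S : U -> lop, is_alg_hom S /\
  forall w, all (valid n m) w -> admissible n w -> exists2 c : CC, c != 0 &
  S (bw w) (dlt (wocc n [::])) = (fun x => c * dlt (wocc n w) x).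
Proof.
have [_ /(_ _ _ (@opG_rels q hq hqq (n + m) n)) [[S [hS hg]] _]] := HU.
exists S; split => // w hw hwa; have [c hc ec] := vacuum_word hq hqq hwa.
exists c => //; rewrite -ec (hom_prod hS); congr (lfun _ _).
apply: eq_big_seq => v /(allP hw); rewrite /valid => hv.
by rewrite (hom_Root hS q hg) //; lia.
Qed.

(** Distinct ordered monomials send the vacuum to nonzero multiples of distinct basis vectors;
    evaluation at the occupation numbers of [r] isolates the coefficient of [r]. *)
Lemma Phi_coef p w c (S : U -> lop) : is_alg_hom S ->
  (forall w, all (valid n m) w -> admissible n w -> exists2 c : CC, c != 0 &
  S (bw w) (dlt (wocc n [::])) = (fun x => c * dlt (wocc n w) x)) ->
  all (valid n m) w ->
  S (Phi q g p) (dlt (wocc n [::])) = (fun x => c * dlt (wocc n w) x) ->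
  forall r, r != wmon n m w -> p@_r = 0.
Proof.
move=> hS hv hw e r hr.
case: (boolP (r \in msupp p)) => [hrp|/memN_msupp_eq0 //].
have e1 (s : mon) : exists2 c : CC, c != 0 &
    S (Emon q g s) (dlt (wocc n [::])) = (fun x => c * dlt (wocc n (word s)) x).
  rewrite (Emon_word q g s); apply: (hv (word s)); first exact: (valid_word hn hm).
  by apply: (lexo_admissible hn hm); [exact: (valid_word hn hm) | exact: pairwise_word].
have := congr1 (fun F => F (wocc n (word r))) e.
rewrite /Phi (hom_sum hS) lop_sumE (bigD1_seq r) ?msupp_uniq //= big1 ?addr0; last first.
  move=> s hs; rewrite (homZ hS) lop_scaleE.
  have [c' _ ->] := e1 s; rewrite /dlt asboolF ?mulr0 //.
  move/(wocc_wmon (valid_word hn hm _) (valid_word hn hm _)); rewrite !(wmon_word hn hm) // => E.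
  by rewrite E eqxx in hs.
rewrite (homZ hS) lop_scaleE; have [c' hc' ->] := e1 r.
rewrite {1}/dlt asboolT // mulr1 /dlt asboolF ?mulr0; last first.
  move/(wocc_wmon (valid_word hn hm _) hw); rewrite (wmon_word hn hm) // => E.
  by rewrite E eqxx in hr.
by move/eqP; rewrite mulf_eq0 (negPf hc') orbF => /eqP.
Qed.

Lemma Phi_inj p : Phi q g p = 0 -> p = 0.
Proof.
move=> h0; have [S [hS hv]] := vacuum_rep.
have e w : S (Phi q g p) (dlt (wocc n [::])) = (fun x => 0 * dlt (wocc n w) x).
  by rewrite h0 (hom0 hS); apply/funext => x; rewrite mul0r.
apply/mpolyP => r; rewrite mcoeff0.
have hv1 : valid n m (1, 1)%N by rewrite /valid /= hn hm.
(* [Phi_coef] says nothing about the exponent of its own word, so the zero vector is presented as a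
   multiple of two different basis vectors; the second word handles r = 0. *)
case: (eqVneq r (wmon n m [::])) => hr; last exact: (Phi_coef hS hv _ (e [::]) hr).
have hw : all (valid n m) [:: (1, 1)%N] by rewrite /= hv1.
apply: (Phi_coef hS hv hw (e _)); rewrite hr; apply/eqP => /(congr1 (fun r : mon => r (vi n m (1,1)%N))).
by rewrite !(wmonE hn hm).
Qed.

(** An admissible word need not be ordered, but it sends the vacuum to a single basis vector. If it
    lies in the image of [Phi], only the monomial with the same multiplicities can occur. *)
Lemma Phi_proportional p w : all (valid n m) w -> admissible n w ->
  Phi q g p = bw w -> exists c, bw w = c *: Emon q g (wmon n m w).
Proof.
move=> hw ha e; have [S [hS hv]] := vacuum_rep.
have [c _ ec] := hv w hw ha; rewrite -e in ec.
exists p@_(wmon n m w); rewrite -e.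
have -> : p = p@_(wmon n m w) *: 'X_[wmon n m w].
  apply/mpolyP => r; rewrite mcoeffZ mcoeffX.
  case: eqP => [<-|/eqP hr]; first by rewrite mulr1.
  by rewrite (Phi_coef hS hv hw ec) ?mulr0 // eq_sym.
by rewrite mcoeffZ mcoeffX eqxx mulr1 PhiZ PhiX.
Qed.

Lemma Phi_inj2 p p' : Phi q g p = Phi q g p' -> p = p'.
Proof.
move=> h; apply/eqP; rewrite -subr_eq0; apply/eqP/Phi_inj.
rewrite -scaleN1r addrC Phi_lin scaleN1r.
by apply/eqP; rewrite addrC subr_eq0; apply/eqP.
Qed.

Lemma Emon_neq0 (r : mon) : Emon q g r != 0.
Proof.
apply/eqP => h; have := @Phi_inj 'X_[r]; rewrite PhiX => /(_ h).
move/(congr1 (fun p : Cx n m => p@_r)); rewrite mcoeffX eqxx mcoeff0 => /eqP.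
by rewrite oner_eq0.
Qed.

(** * The grading by simple roots *)

(** The grading is encoded by an automorphism with eigenvalues 2^h. The number 2 serves as a scalar
    that is certainly not a root of unity. *)
Definition theta_gens c : gens U :=
  Gens (fun i => (2%:R : CC) ^ (- (i == c)%:Z) *: ge g i)
       (fun i => (2%:R : CC) ^ (i == c)%:Z *: gf g i) (gk g) (gki g).

Definition is_theta c (th : U -> U) := is_alg_hom th /\ maps_gens (n + m) th g (theta_gens c).

Let two0 : (2%:R : CC) != 0.
Proof. by rewrite Num.Theory.pnatr_eq0. Qed.

(** Transported to the rationals, where injectivity of the powers follows from the order. *)
Lemma two_exp_inj : injective (fun a : int => (2%:R : CC) ^ a).
Proof.
move=> a b; have E (z : int) : (2%:R : CC) ^ z = ratr ((2%:R : rat) ^ z).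
  by rewrite fmorphXz rmorph_nat.
by rewrite !E => /fmorph_inj; apply: ieexprIz.
Qed.

(** All defining relations are homogeneous; in the relation between e_i and f_i the two scalars
    cancel. *)
Lemma theta_ex c : exists th, is_theta c th.
Proof.
case: HU => HR hU; have [|[th [h1 h2]] _] := hU U (theta_gens c); last by exists th.
move=> i j hi hj; have := HR i j hi hj.
move=> [h1 [h2 [h3 [h4 [h5 [h6 [h7 h8]]]]]]] /=.
do 3! split => //.
split; first by rewrite -scalerAr -scalerAl h4 !scalerA mulrC.
split; first by rewrite -scalerAr -scalerAl h5 !scalerA mulrC.
have s2 (a b : U) (x y : CC) : (x *: a) ^+ 2 * (y *: b) = (x * x * y) *: (a ^+ 2 * b).
  by rewrite !expr2 -!(@scalerAl _ U) -!(@scalerAr _ U) -?(@scalerAl _ U) !scalerA; congr (_ *: _); ring.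
have s3 (a b : U) (x y : CC) : (x *: a) * (y *: b) * (x *: a) = (x * x * y) *: (a * b * a).
  by rewrite -!(@scalerAl _ U) -!(@scalerAr _ U) -?(@scalerAl _ U) !scalerA; congr (_ *: _); ring.
have s4 (a b : U) (x y : CC) : (y *: b) * (x *: a) ^+ 2 = (x * x * y) *: (b * a ^+ 2).
  by rewrite !expr2 -!(@scalerAl _ U) -!(@scalerAr _ U) -?(@scalerAl _ U) !scalerA; congr (_ *: _); ring.
split.
  rewrite -!scalerAr -!scalerAl !scalerA [X in _ - X *: _]mulrC -scalerBr h6; case: (i =P j) => [->|_]; last by rewrite scaler0.
  by rewrite -expfzDr // ?addNr ?subrr expr0z scale1r.
split.
  move=> /h7 [e1 e2]; rewrite !s2 !s3 !s4 ![(q + q^-1) *: _]scalerA ![(q + q^-1) * _]mulrC -!scalerA.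
  by rewrite -!scalerBr -!scalerDr e1 e2 !scaler0.
move=> /h8 [e1 e2]; rewrite -!(@scalerAl _ U) -?(@scalerAr _ U) -?(@scalerAl _ U) e1 e2.
by split; rewrite !scalerA mulrC.
Qed.

Definition wt c (h : int) (x : U) := forall th, is_theta c th -> th x = 2%:R ^ h *: x.

Lemma wtM c h h' x y : wt c h x -> wt c h' y -> wt c (h + h') (x * y).
Proof.
move=> h1 h2 th Hth; have [hh _] := Hth.
by rewrite (homM hh) h1 // h2 // -scalerAl -scalerAr scalerA expfzDr.
Qed.

Lemma wtD c h x y : wt c h x -> wt c h y -> wt c h (x + y).
Proof.
move=> h1 h2 th Hth; have [hh _] := Hth.
by rewrite (homD hh) h1 // h2 // scalerDr.
Qed.

Lemma wtZ c h a x : wt c h x -> wt c h (a *: x).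
Proof.
move=> h1 th Hth; have [hh _] := Hth.
by rewrite (homZ hh) h1 // !scalerA mulrC.
Qed.

Lemma wtB c h x y : wt c h x -> wt c h y -> wt c h (x - y).
Proof. by move=> h1 h2; rewrite -scaleN1r; apply: wtD => //; apply: wtZ. Qed.

Lemma wt1 c : wt c 0 1.
Proof. by move=> th [hh _]; rewrite (hom1 hh) expr0z scale1r. Qed.

Lemma wt_e c i : (0 < i < n + m)%N -> wt c (- (i == c)%:Z) (ge g i).
Proof. by move=> hi th [_ /(_ i hi) [-> _]]. Qed.

Lemma wt_f c i : (0 < i < n + m)%N -> wt c (i == c)%:Z (gf g i).
Proof. by move=> hi th [_ /(_ i hi) [_ [-> _]]]. Qed.

Lemma wt_k c i : (0 < i < n + m)%N -> wt c 0 (gk g i).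
Proof. by move=> hi th [_ /(_ i hi) [_ [_ [-> _]]]]; rewrite expr0z scale1r. Qed.

Lemma wt_ki c i : (0 < i < n + m)%N -> wt c 0 (gki g i).
Proof. by move=> hi th [_ /(_ i hi) [_ [_ [_ ->]]]]; rewrite expr0z scale1r. Qed.

Lemma wt_Root c l k : (l <= n + m)%N -> (k < l)%N -> (0 < k)%N ->
  wt c ((k <= c)%N && (c < l)%N)%:Z (Root q g l k).
Proof.
move=> hl; move: k; apply: low_ind => [k e|k hk IH] h0.
  have -> : (k <= c < l)%N = (k == c) by lia.
  by subst l; rewrite Root_low1; apply: wt_f; lia.
have -> : (k <= c < l)%N%:Z = (k.+1 <= c < l)%N%:Z + (k == c)%:Z by lia.
rewrite Root_lowS //; apply: wtB; first by apply: wtM; [exact: IH | apply: wt_f; lia].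
by apply: wtZ; rewrite addrC; apply: wtM; [apply: wt_f; lia | exact: IH].
Qed.

Definition hgt c w := count (fun v => (v.2 <= c)%N && (c < n + v.1)%N) w.

Lemma wt_word c w : all (valid n m) w -> wt c (hgt c w)%:Z (bw w).
Proof.
elim: w => [|v w IH] /=; first by rewrite big_nil => _; apply: wt1.
move=> /andP[hv hw]; rewrite big_cons /hgt /= PoszD; apply: wtM; last exact: IH.
by move: hv; rewrite /valid => hv; apply: wt_Root; lia.
Qed.

(** The automorphism rescales each monomial by its own power of 2. Injectivity of [Phi] compares
    these scalars with 2^h coefficient by coefficient. *)
Lemma wt_supp c h p r : wt c h (Phi q g p) -> r \in msupp p -> (hgt c (word r))%:Z = h.
Proof.
move=> hw hr; have [th Hth] := theta_ex c; have [hh _] := Hth.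
pose p' : Cx n m := \sum_(s <- msupp p) (p@_s * 2%:R ^ (hgt c (word s))%:Z) *: 'X_[s].
have e : Phi q g p' = Phi q g (2%:R ^ h *: p).
  rewrite PhiZ -(hw _ Hth) /p'.
  have -> (s : seq mon) (F : mon -> CC) : Phi q g (\sum_(r <- s) F r *: 'X_[r] : Cx n m) =
     \sum_(r <- s) F r *: Emon q g r.
    elim: s => [|x s IH]; first by rewrite !big_nil Phi0.
    by rewrite !big_cons Phi_lin IH PhiX.
  rewrite (hom_sum hh); apply: eq_bigr => s _.
  rewrite (homZ hh) -scalerA; congr (_ *: _); rewrite (Emon_word q g s).
  by rewrite (wt_word (c := c) (valid_word hn hm s) Hth).
move/Phi_inj2/(congr1 (fun p : Cx n m => p@_r)): e.
rewrite /p' raddf_sum /= (bigD1_seq r) ?msupp_uniq //= big1 => [|s hs]; last first.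
  by rewrite mcoeffZ mcoeffX (negPf hs) mulr0.
rewrite addr0 !mcoeffZ mcoeffX eqxx mulr1 mulrC => /mulIf; rewrite -mcoeff_msupp => /(_ hr).
exact: two_exp_inj.
Qed.

Lemma zero_by_wt x (h : nat -> int) : (exists p, x = Phi q g p) -> (forall c, wt c (h c) x) ->
  (forall w, all (valid n m) w -> (forall c, (0 < c < n + m)%N -> (hgt c w)%:Z = h c) -> False) ->
  x = 0.
Proof.
move=> [p ->] hw hF; suff -> : p = 0 by rewrite Phi0.
case: (boolP (p == 0)) => [/eqP //|hp].
have : mlead p \in msupp p by apply: mlead_supp.
move=> hr; case: (hF (word (mlead p)) (valid_word hn hm _)) => c hc.
exact (wt_supp (hw c) hr).
Qed.

End Independence.

(** * Skew derivations and the quantum Weyl algebra *)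

Section Weyl.
Variables (n m : nat) (hn : (0 < n)%N) (hm : (0 < m)%N) (q : CC) (hq : q != 0).
Local Notation mon := 'X_{1..nv n m}.
Local Notation X r := ('X_[r] : Cx n m).
Local Notation vi := (vi n m).
Local Notation valid := (valid n m).
Implicit Types (v u : nat * nat) (r : mon).

Lemma xop_lin j k : is_lin (@xop n m j k).
Proof. by move=> c x y; rewrite /xop mulrDr -scalerAr. Qed.

Lemma dop_lin j k : is_lin (@dop n m q j k).
Proof.
move=> c x y; have E p : dop q j k p =
    mlift (fun r : mon => qint q (r (vidx n m j k)) *: X (r - U_(vidx n m j k))%MM) p.
  by apply: eq_bigr => r _; rewrite scalerA mulrC.
by rewrite !E mlift_lin.
Qed.

Lemma gam_lin j k : is_lin (@gam n m q j k).
Proof.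
move=> c x y; have E p : gam q j k p = mlift (fun r : mon => q ^+ (r (vidx n m j k)) *: X r) p.
  by apply: eq_bigr => r _; rewrite scalerA mulrC.
by rewrite !E mlift_lin.
Qed.

Lemma gami_lin j k : is_lin (@gami n m q j k).
Proof.
move=> c x y; have E p : gami q j k p = mlift (fun r : mon => q ^- (r (vidx n m j k)) *: X r) p.
  by apply: eq_bigr => r _; rewrite scalerA mulrC.
by rewrite !E mlift_lin.
Qed.

Lemma inAq_linear (F : Cx n m -> Cx n m) : inAq q F -> is_lin F.
Proof.
elim=> {F} [j k _ _|j k _ _|j k _ _|j k _ _||c F G _ hF _ hG|F G _ hF _ hG|F G _ hF e] //.
- exact: xop_lin.
- exact: dop_lin.
- exact: gam_lin.
- exact: gami_lin.
- move=> a x y; rewrite hF hG !scalerDr !scalerA [c * a]mulrC -!addrA; congr (_ + _).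
  by rewrite addrCA.
- by move=> a x y; rewrite /= hG hF.
- by move=> a x y; rewrite -!e hF.
Qed.

Lemma xopX v r : xop v.1 v.2 (X r) = X (U_(vi v) + r)%MM.
Proof. by rewrite /xop mpolyXD. Qed.

Lemma dopX v r : dop q v.1 v.2 (X r) = qint q (r (vi v)) *: X (r - U_(vi v))%MM.
Proof. by rewrite /dop msuppX big_seq1 mcoeffX eqxx mulr1. Qed.

Lemma gamX v r : gam q v.1 v.2 (X r) = q ^+ r (vi v) *: X r.
Proof. by rewrite /gam msuppX big_seq1 mcoeffX eqxx mulr1. Qed.

Lemma gamiX v r : gami q v.1 v.2 (X r) = q ^- r (vi v) *: X r.
Proof. by rewrite /gami msuppX big_seq1 mcoeffX eqxx mulr1. Qed.

(** The eigenvalue functions on monomials that are realized by operators of the quantum Weyl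
    algebra. *)
Definition qlin (f : mon -> CC) :=
  exists2 F : Cx n m -> Cx n m, inAq q F & forall r, F (X r) = f r *: X r.

Lemma linZ (F : Cx n m -> Cx n m) c p : is_lin F -> F (c *: p) = c *: F p.
Proof.
move=> h; have h0 : F 0 = 0.
  by have := h (-1) 0 0; rewrite scaler0 addr0 scaleN1r addNr.
by rewrite -[c *: p]addr0 h h0 addr0.
Qed.

Lemma qlin_ext f f' : qlin f -> f =1 f' -> qlin f'.
Proof. by move=> [F h1 h2] e; exists F => // r; rewrite -e. Qed.

Lemma qlinM f f' : qlin f -> qlin f' -> qlin (fun r => f r * f' r).
Proof.
move=> [F h1 h2] [G h3 h4]; exists (F \o G); first exact: inAq_comp.
by move=> r /=; rewrite h4 linZ ?h2 ?scalerA 1?mulrC //; apply: inAq_linear.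
Qed.

Lemma inAqZ (c : CC) (F : Cx n m -> Cx n m) : inAq q F -> inAq q (fun p => c *: F p).
Proof.
move=> h; apply: (inAq_ext (F := fun p => (c - 1) *: F p + F p)); first exact: inAq_lin.
by move=> p; rewrite scalerBl scale1r subrK.
Qed.

Lemma qlin_const c : qlin (fun _ => c).
Proof. by exists (fun p => c *: id p); first exact: inAqZ (inAq_id _ _ _). Qed.

Lemma qlin_var v (z : int) : valid v -> qlin (fun r => q ^ (z * (r (vi v))%:Z)).
Proof.
case: v => j k /andP[/= hj hk].
have pos (N : nat) : qlin (fun r => q ^ (N%:Z * (r (vi (j, k)))%:Z)).
  elim: N => [|N IH].
    by apply: (qlin_ext (qlin_const 1)) => r; rewrite mul0r expr0z.
  have h : qlin (fun r => q ^+ r (vi (j, k))).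
    by exists (gam q j k); [exact: inAq_g | move=> r; rewrite (gamX (j, k))].
  apply: (qlin_ext (qlinM h IH)) => r; rewrite exprnP -expfzDr // intS mulrDl mul1r //.
have neg (N : nat) : qlin (fun r => q ^ (- N%:Z * (r (vi (j, k)))%:Z)).
  elim: N => [|N IH].
    by apply: (qlin_ext (qlin_const 1)) => r; rewrite oppr0 mul0r expr0z.
  have h : qlin (fun r => q ^- r (vi (j, k))).
    by exists (gami q j k); [exact: inAq_gi | move=> r; rewrite (gamiX (j, k))].
  apply: (qlin_ext (qlinM h IH)) => r.
  by rewrite exprnN -expfzDr // intS opprD mulrDl mulN1r.
by case: z => z; [exact: pos | rewrite NegzE; exact: neg].
Qed.

Lemma qlin_sum s (w : nat * nat -> int) : all valid s ->
  qlin (fun r => q ^ (\sum_(u <- s) w u * (r (vi u))%:Z)).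
Proof.
elim: s => [|u s IH] /=.
  by move=> _; apply: (qlin_ext (qlin_const 1)) => r; rewrite big_nil expr0z.
move=> /andP[hu /IH h]; apply: (qlin_ext (qlinM (qlin_var (w u) hu) h)) => r.
by rewrite big_cons expfzDr.
Qed.

Variables (U : algType CC) (g : gens U).
Local Notation b v := (Root q g (n + v.1) v.2).

Definition aq (T : mon -> U) :=
  exists2 F : Cx n m -> Cx n m, inAq q F & forall r, Phi q g (F (X r)) = T r.

Lemma aq_ext T T' : aq T -> T =1 T' -> aq T'.
Proof. by move=> [F h1 h2] e; exists F => // r; rewrite -e. Qed.

Lemma aqD T T' : aq T -> aq T' -> aq (fun r => T r + T' r).
Proof.
move=> [F h1 h2] [G h3 h4]; exists (fun p => 1 *: F p + G p); first exact: inAq_lin.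
by move=> r; rewrite Phi_lin scale1r h2 h4.
Qed.

Lemma aq0 : aq (fun _ => 0).
Proof.
exists (fun p => 0 *: id p); first exact: inAqZ (inAq_id _ _ _).
by move=> r; rewrite scale0r Phi0.
Qed.

Lemma aq_sum (s : seq (nat * nat)) (T : nat * nat -> mon -> U) :
  (forall v, v \in s -> aq (T v)) -> aq (fun r => \sum_(v <- s) T v r).
Proof.
elim: s => [|v s IH] h; first by apply: (aq_ext aq0) => r; rewrite big_nil.
have h1 := h v (mem_head _ _).
have h2 := IH (fun u hu => h u (mem_behead (s := v :: s) hu)).
by apply: (aq_ext (aqD h1 h2)) => r; rewrite big_cons.
Qed.

(** The general shape of a summand of ad e_i or ad f_i: the operator x_{v'} F' d_v F, with F and F'
    diagonal. *)
Lemma aq_term v v' f f' : valid v -> valid v' -> qlin f -> qlin f' ->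
  aq (fun r => (f r * qint q (r (vi v)) * f' (r - U_(vi v))%MM) *:
               Emon q g (U_(vi v') + (r - U_(vi v)))%MM).
Proof.
move=> /andP[hv1 hv2] /andP[hv1' hv2'] [F h1 h2] [G h3 h4].
have hd := inAq_d q hv1 hv2; have hx := inAq_x q hv1' hv2'.
exists (xop v'.1 v'.2 \o G \o dop q v.1 v.2 \o F); first by do 3! apply: inAq_comp => //.
move=> r /=; rewrite h2 (linZ _ _ (inAq_linear hd)) dopX scalerA.
rewrite (linZ _ _ (inAq_linear h3)) h4 scalerA (linZ _ _ (inAq_linear hx)) xopX.
by rewrite PhiZ PhiX.
Qed.

Lemma aq_diag f : qlin f -> aq (fun r => f r *: Emon q g r).
Proof. by move=> [F h1 h2]; exists F => // r; rewrite h2 PhiZ PhiX. Qed.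

Definition Pr r s : U := \prod_(u <- s) b u ^+ r (vi u).

Lemma PrE r : Emon q g r = Pr r (vlist n m).
Proof. exact: EmonE. Qed.

Lemma Pr_cat r s s' : Pr r (s ++ s') = Pr r s * Pr r s'.
Proof. by rewrite /Pr big_cat. Qed.

Lemma Pr_cons r u s : Pr r (u :: s) = b u ^+ r (vi u) * Pr r s.
Proof. by rewrite /Pr big_cons. Qed.

Lemma Pr_eq r r' s : {in s, forall u, r (vi u) = r' (vi u)} -> Pr r s = Pr r' s.
Proof. by move=> h; apply: eq_big_seq => u /h ->. Qed.

Lemma qc_Pr (z : nat * nat -> int) x r s : {in s, forall u, qc q (z u) x (b u)} ->
  qc q (\sum_(u <- s) z u * (r (vi u))%:Z) x (Pr r s).
Proof.
move=> h; rewrite /Pr; elim: s h => [|u s IH] h; first by rewrite !big_nil; apply: qc01.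
rewrite !big_cons; apply: qcMr => //; first by apply: qcXr => //; apply: h; rewrite mem_head.
by apply: IH => w hw; apply: h; rewrite in_cons hw orbT.
Qed.

(** * Twisted Leibniz rules on ordered monomials *)

Section SkewDerivation.
Variables (D t1 t2 : U -> U) (w1 w2 : nat * nat -> int).
Hypotheses (DM : forall x y, D (x * y) = D x * t2 y + t1 x * D y).
Hypotheses (t11 : t1 1 = 1) (t21 : t2 1 = 1).
Hypotheses (t1M : {morph t1 : x y / x * y}) (t2M : {morph t2 : x y / x * y}).
Hypotheses (t1b : forall v, valid v -> t1 (b v) = q ^ w1 v *: b v).
Hypotheses (t2b : forall v, valid v -> t2 (b v) = q ^ w2 v *: b v).

Lemma skew1 : D 1 = 0.
Proof.
have := DM 1 1; rewrite t11 t21 !mulr1 mul1r => h.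
by apply: (addIr (D 1)); rewrite add0r -h.
Qed.

Lemma tw_exp (t : U -> U) (w : nat * nat -> int) v N :
  t 1 = 1 -> {morph t : x y / x * y} -> t (b v) = q ^ w v *: b v ->
  t (b v ^+ N) = q ^ (w v * N%:Z) *: b v ^+ N.
Proof.
move=> h1 hM hb; elim: N => [|N IH]; first by rewrite mulr0 expr0z scale1r expr0.
rewrite exprS hM hb IH -scalerAl -scalerAr scalerA -expfzDr // intS mulrDr mulr1 //.
Qed.

Lemma tw_Pr (t : U -> U) (w : nat * nat -> int) r s :
  t 1 = 1 -> {morph t : x y / x * y} -> {in s, forall v, t (b v) = q ^ w v *: b v} ->
  t (Pr r s) = q ^ (\sum_(u <- s) w u * (r (vi u))%:Z) *: Pr r s.
Proof.
move=> h1 hM; elim: s => [|u s IH] hb.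
  by rewrite /Pr !big_nil expr0z scale1r.
rewrite Pr_cons hM IH => [|x hx]; last by apply: hb; rewrite in_cons hx orbT.
rewrite (tw_exp _ h1 hM (hb u (mem_head _ _))) big_cons expfzDr //.
by rewrite -scalerAl -scalerAr scalerA.
Qed.

(** The Leibniz rule gives c times the sum over i of q^(w1 i + (w2 + t)(N - i)), times b^N y. The
    two exponents differ by 2 and [e] is their mean, so the geometric sum is q^(e N) times the
    q-integer of N + 1. *)
Lemma skew_exp v y c (t e : int) N : valid v -> D (b v) = c *: y -> qc q t y (b v) ->
  (w1 v = e + 1 /\ w2 v + t = e - 1) \/ (w1 v = e - 1 /\ w2 v + t = e + 1) ->
  q - q^-1 != 0 ->
  D (b v ^+ N.+1) = (c * (q ^ (e * N%:Z) * qint q N.+1)) *: (b v ^+ N * y).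
Proof.
move=> hv hD hy hw hqq; have hs := sqr_sub1_neq0 hq hqq.
elim: N => [|N IH].
  rewrite mulr0 expr0z mul1r expr0 mul1r expr1 hD /qint expr1 divff ?mulr1 //.
rewrite exprSr DM IH hD t2b // (tw_exp N.+1 t11 t1M (t1b hv)).
have E0 : b v ^+ N * y * b v = q ^ t *: (b v ^+ N.+1 * y).
  by rewrite -mulrA hy -scalerAr mulrA -exprSr.
rewrite -!scalerAr -!scalerAl E0 !scalerA -scalerDl; congr (_ *: _).
have h0 (z : int) : q ^ z != 0 by rewrite expfz_neq0.
have E1 : q ^ (e * N.+1%:Z) = q ^ (e * N%:Z) * q ^ e.
  by rewrite -expfzDr // intS mulrDr mulr1 addrC.
have E2 : q ^ w2 v * q ^ t = q ^ (w2 v + t) by rewrite expfzDr.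
have E3 (a : int) : q ^ (a * N.+1%:Z) = (q ^ a) ^+ N.+1 by rewrite exprnP exprz_exp.
have E4 : q ^ (e * N%:Z) = (q ^ e) ^+ N by rewrite exprnP exprz_exp.
transitivity (c * (q ^ (e * N%:Z) * qint q N.+1 * (q ^ w2 v * q ^ t) + q ^ (w1 v * N.+1%:Z))).
  by ring.
congr (_ * _); rewrite E2 E1 E3 E4 /qint.
have hN : q ^+ N != 0 by rewrite expf_neq0.
have hE := h0 e.
case: hw => [[-> ->]|[-> ->]]; rewrite !expfzDr // ?expr1z ?exprN1 !exprMn !exprS.
  by field; rewrite hN hq hs.
by rewrite exprVn; field; rewrite hN hq hs.
Qed.

Lemma Pr_inc v' r s : v' \notin s -> valid v' -> all valid s -> Pr (U_(vi v') + r)%MM s = Pr r s.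
Proof.
move=> hs hv' hvs; apply: Pr_eq => u hu'; rewrite mnmDE mnm1E.
case: eqP => // /(vi_inj hn hm hv' (allP hvs _ hu')) E.
by rewrite E hu' in hs.
Qed.

Lemma Pr_dec v r s : v \notin s -> valid v -> all valid s -> Pr (r - U_(vi v))%MM s = Pr r s.
Proof.
move=> hs hv hvs; apply: Pr_eq => u hu'; rewrite mnmBE mnm1E.
case: eqP => [/(vi_inj hn hm hv (allP hvs _ hu')) E'|]; last by rewrite subn0.
by rewrite E' hu' in hs.
Qed.

Lemma insert_head v' (z : nat * nat -> int) L L3 r : all valid (L ++ v' :: L3) ->
  uniq (L ++ v' :: L3) -> {in L, forall u, qc q (z u) (b v') (b u)} ->
  b v' * Pr r (L ++ v' :: L3) =
  q ^ (\sum_(u <- L) z u * (r (vi u))%:Z) *: Pr (U_(vi v') + r)%MM (L ++ v' :: L3).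
Proof.
rewrite all_cat /= cat_uniq /= => /and3P[v2 hv' v3] /and3P[_ n1 /andP[n2 _]] hz.
have {}n1 : v' \notin L by apply: contra n1 => h; rewrite /= h.
rewrite !Pr_cat !Pr_cons mnmDE mnm1E eqxx !Pr_inc //.
have := qc_Pr r hz; rewrite /qc => E.
rewrite (mulrA (b v')) E -scalerAl; congr (_ *: _).
by rewrite add1n exprS !mulrA.
Qed.

(** The extra factor is moved to its own block: to the left over [L] if the block lies in [s1],
    which gives the exponents - z, and to the right over [L] if it lies in [s2]. *)
Lemma insert_Pr v' (z : nat * nat -> int) s1 s2 : all valid (s1 ++ s2) -> uniq (s1 ++ s2) ->
  v' \in s1 ++ s2 ->
  (forall L L1 L2, s1 = L1 ++ v' :: L -> s2 = L2 -> {in L, forall u, qc q (z u) (b v') (b u)}) ->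
  (forall L L1 L2, s2 = L ++ v' :: L2 -> s1 = L1 -> {in L, forall u, qc q (z u) (b v') (b u)}) ->
  exists2 f, qlin f & forall r, Pr r s1 * b v' * Pr r s2 = f r *: Pr (U_(vi v') + r)%MM (s1 ++ s2).
Proof.
move=> hv hu hin h1 h2; have hv' : valid v' := allP hv _ hin.
have inc r : (U_(vi v') + r)%MM (vi v') = (r (vi v')).+1 by rewrite mnmDE mnm1E eqxx.
case: (boolP (v' \in s1)) => [hs|hs].
  case/splitPr: hs hv hu {hin} h1 h2 => L1 L hv hu h1 h2.
  have hz := h1 L L1 s2 (erefl _) (erefl _).
  move: hv hu; rewrite -!catA /= !all_cat /= all_cat => /andP[v1 /andP[_ /andP[v2 v3]]].
  rewrite cat_uniq /= => /and3P[_ n1 /andP[n2 _]].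
  have {}n1 : v' \notin L1 by apply: contra n1 => h; rewrite /= h.
  move: n2; rewrite mem_cat negb_or => /andP[n2 n3].
  exists (fun r => q ^ (\sum_(u <- L) (- z u) * (r (vi u))%:Z)).
    exact: qlin_sum.
  move=> r; rewrite !Pr_cat !Pr_cons Pr_cat inc !Pr_inc //.
  have E : Pr r L * b v' = q ^ (\sum_(u <- L) (- z u) * (r (vi u))%:Z) *: (b v' * Pr r L).
    have := qcS hq (qc_Pr r hz); rewrite /qc => ->; congr (q ^ _ *: _).
    by rewrite -sumrN; apply: eq_bigr => u _; rewrite mulNr.
  rewrite -!mulrA (mulrA (Pr r L)) E -scalerAl -!scalerAr; congr (_ *: _).
  by rewrite exprSr !mulrA.
have hs2 : v' \in s2 by move: hin; rewrite mem_cat (negPf hs).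
case/splitPr: hs2 hv hu {hin} h1 h2 => L L3 hv hu h1 h2.
have hz := h2 L s1 L3 (erefl _) (erefl _).
have hvL : all valid (L ++ v' :: L3) by move: hv; rewrite (all_cat _ s1) => /andP[].
have huL : uniq (L ++ v' :: L3) by move: hu; rewrite (cat_uniq s1) => /and3P[].
exists (fun r => q ^ (\sum_(u <- L) z u * (r (vi u))%:Z)).
  by apply: qlin_sum; move: hvL; rewrite all_cat => /andP[].
have hv1 : all valid s1 by move: hv; rewrite (all_cat _ s1) => /andP[].
move=> r; have e1 : Pr (U_(vi v') + r)%MM s1 = Pr r s1 by apply: Pr_inc.
by rewrite -mulrA (insert_head r hvL huL hz) -scalerAr [Pr _ (s1 ++ _)]Pr_cat e1.
Qed.

Lemma skew_Pr r s : uniq s -> D (Pr r s) =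
  \sum_(v <- s) t1 (Pr r (take (index v s) s)) * D (b v ^+ r (vi v)) *
                t2 (Pr r (drop (index v s).+1 s)).
Proof.
elim: s => [|u s IH] /=; first by rewrite /Pr !big_nil skew1.
move=> /andP[hu hs]; rewrite Pr_cons DM IH // big_cons eqxx /= drop0.
rewrite [Pr r [::]]big_nil t11 mul1r; congr (_ + _).
rewrite mulr_sumr; apply: eq_big_seq => v hv.
have -> : (u == v) = false by apply: contraNF hu => /eqP ->.
by rewrite /= Pr_cons t1M !mulrA.
Qed.

Hypothesis hqq : q - q^-1 != 0.

(* Between v and its image v' in the order of the monomials, b v' has to
   q-commute with every root vector. *)
Definition skew_ok v := D (b v) = 0 \/ exists c v' t e z,
  [/\ valid v', v' != v, D (b v) = c *: b v', qc q t (b v') (b v) &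
      ((w1 v = e + 1 /\ w2 v + t = e - 1) \/ (w1 v = e - 1 /\ w2 v + t = e + 1)) /\
      (forall u, valid u -> u != v -> u != v' ->
        (lexo v u && lexo u v') || (lexo v' u && lexo u v) -> qc q (z u) (b v') (b u))].

Lemma skew_exp0 v N : D (b v) = 0 -> D (b v ^+ N) = 0.
Proof.
move=> h; elim: N => [|N IH]; first by rewrite expr0 skew1.
by rewrite exprS DM h IH mul0r mulr0 addr0.
Qed.

Lemma aq_skew : (forall v, valid v -> skew_ok v) -> aq (fun r => D (Emon q g r)).
Proof.
move=> hok; have hu := uniq_vlist n m.
apply: (aq_ext (T := fun r => \sum_(v <- vlist n m)
   t1 (Pr r (take (index v (vlist n m)) (vlist n m))) * D (b v ^+ r (vi v)) *
   t2 (Pr r (drop (index v (vlist n m)).+1 (vlist n m))))); last first.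
  by move=> r; rewrite PrE skew_Pr.
apply: aq_sum => v hvl; have hv : valid v by rewrite -mem_vlist.
case: (hok v hv) => [h0|[c [v' [t [e [z [hv' hne hD ht [hw hz]]]]]]]].
  by apply: (aq_ext aq0) => r; rewrite skew_exp0 // mulr0 mul0r.
set p1 := take _ _; set p2 := drop _ _.
have E : vlist n m = p1 ++ v :: p2.
  rewrite /p1 /p2 -[in LHS](cat_take_drop (index v (vlist n m)) (vlist n m)); congr (_ ++ _).
  by rewrite (drop_nth v) ?index_mem // nth_index.
have hval : all valid (vlist n m) by apply/allP => u; rewrite mem_vlist.
have hpw := pairwise_vlist n m.
(* The remaining power of [b v] itself may lie between the new factor and its block, and there the
   exponent is [t]. *)
pose z' u := if u == v then t else z u.
have [| | |L L1 L2 e1 e2|L L1 L2 e1 e2|f' hf' ef'] :=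
  @insert_Pr v' z' (rcons p1 v) p2; rewrite ?cat_rcons -?E //.
- by rewrite mem_vlist.
- move=> u huL; rewrite /z'; case: eqP => [->|/eqP huv] //.
  have hLv : u \in p1.
    have : u \in rcons p1 v by rewrite e1 mem_cat in_cons huL !orbT.
    by rewrite mem_rcons in_cons (negPf huv).
  have hvu : valid u by apply: (allP hval); rewrite E mem_cat hLv.
  have h1 : lexo u v.
    move: hpw; rewrite E pairwise_cat => /and3P[/allrelP h _ _].
    by apply: h => //; rewrite mem_head.
  have h2 : lexo v' u && (u != v').
    have : pairwise lexo (rcons p1 v) && uniq (rcons p1 v).
      apply/andP; split.
        by move: hpw; rewrite E -cat_rcons pairwise_cat => /and3P[].
      by move: hu; rewrite E -cat_rcons cat_uniq => /and3P[].
    rewrite e1 pairwise_cat cat_uniq /= => /andP[/and3P[_ _ /andP[h _]] /and3P[_ _ /andP[h' _]]].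
    rewrite (allP h) //=; by apply: contraNneq h' => <-.
  by case/andP: h2 => h2 h3; apply: hz => //; rewrite h1 h2 orbT.
- move=> u huL; have hLv : u \in p2 by rewrite e1 mem_cat huL.
  have hvu : valid u by apply: (allP hval); rewrite E mem_cat in_cons hLv !orbT.
  have hup : uniq (v :: p2) by move: hu; rewrite E cat_uniq => /and3P[].
  have huv : u != v by move: hup => /= /andP[h _]; apply: contraNneq h => <-.
  rewrite /z' (negPf huv).
  have hpp : pairwise lexo (v :: p2) by move: hpw; rewrite E pairwise_cat => /and3P[].
  have h1 : lexo v u by move: hpp => /= /andP[/allP h _]; apply: h.
  have h2 : lexo u v' && (u != v').
    move: hpp hup => /= /andP[_ ] + /andP[_].
    rewrite e1 pairwise_cat cat_uniq /= => /and3P[/allrelP h _ _] /and3P[_ h' _].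
    rewrite h ?mem_head //=; apply: contraNneq h' => <-.
    by apply/orP; left.
  by case/andP: h2 => h2 h3; apply: hz => //; rewrite h1 h2.
have v1 : all valid p1 by move: hval; rewrite E all_cat => /andP[].
have v2 : all valid p2 by move: hval; rewrite E all_cat /= => /and3P[].
have nv : v \notin p1 /\ v \notin p2.
  move: hu; rewrite E cat_uniq /= => /and3P[_ h /andP[h' _]]; split=> //.
  by apply: contra h => hh; rewrite hh.
(* The factor q^(- e) corrects the shift between r_v = N + 1, on which [f] is evaluated, and the
   exponent e N of [skew_exp]. *)
pose f r := q ^ (\sum_(u <- p1) w1 u * (r (vi u))%:Z) * q ^ (\sum_(u <- p2) w2 u * (r (vi u))%:Z) *
  (q ^ (e * (r (vi v))%:Z) * (q ^ (- e) * c)).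
have hf : qlin f.
  apply: qlinM; first by apply: qlinM; apply: qlin_sum.
  by apply: qlinM; [apply: qlin_var | apply: qlin_const].
apply: (aq_ext (aq_term hv hv' hf hf')) => r.
case Er : (r (vi v)) => [|N].
  (* For r_v = 0 the subtraction of exponents is truncated, but its coefficient is the q-integer of
     0. *)
  by rewrite expr0 skew1 mulr0 mul0r /qint expr0 invr1 subrr mul0r mulr0 mul0r scale0r.
rewrite (skew_exp N hv hD ht hw hqq).
rewrite (tw_Pr (w := w1) r t11 t1M) => [|u /(allP v1)]; last exact: t1b.
rewrite (tw_Pr (w := w2) r t21 t2M) => [|u /(allP v2)]; last exact: t2b.
rewrite -!(@scalerAl _ U) -!(@scalerAr _ U) -!(@scalerAl _ U) !scalerA.
have -> : Pr r p1 * (b v ^+ N * b v') * Pr r p2 =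
   f' (r - U_(vi v))%MM *: Emon q g (U_(vi v') + (r - U_(vi v)))%MM.
  have -> : Emon q g (U_(vi v') + (r - U_(vi v)))%MM =
    Pr (U_(vi v') + (r - U_(vi v)))%MM (rcons p1 v ++ p2) by rewrite PrE E cat_rcons.
  rewrite -ef' -cats1 Pr_cat Pr_cons [Pr _ [::]]big_nil mulr1 !Pr_dec; try tauto.
  by rewrite mnmBE mnm1E eqxx Er subn1 /= !mulrA.
rewrite scalerA; congr (_ *: _); rewrite /f Er.
have -> : q ^ (e * N.+1%:Z) * (q ^ (- e) * c) = q ^ (e * N%:Z) * c.
  rewrite mulrA -expfzDr //; congr (q ^ _ * _); rewrite intS; ring.
by ring.
Qed.

End SkewDerivation.
End Weyl.

(** * The adjoint action on the root vectors E_{n+j,k} *)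

Lemma wmon_perm n m w w' : perm_eq w w' -> wmon n m w = wmon n m w'.
Proof. by move=> /permP h; apply/mnmP => i; rewrite !mnmE h. Qed.

(** The definition peels off the lowest generator. Peeling off the highest one gives the same
    element because f_l and f_k commute for k + 1 < l; this is the form suited to f_{n+i}. *)
Lemma Root_rev N q (A : algType CC) (g : gens A) : Uq_rels N q g -> forall l, (l < N)%N ->
  forall k, (k < l)%N -> (0 < k)%N ->
  Root q g l.+1 k = gf g l * Root q g l k - q^-1 *: (Root q g l k * gf g l).
Proof.
move=> HR l hl; apply: low_ind => [k e|k hk IH] h0.
  by subst l; rewrite Root_lowS // !Root_low1.
rewrite [LHS]Root_lowS; last by lia.
rewrite IH // (Root_lowS q g hk).
have c : gf g l * gf g k = gf g k * gf g l by apply: (gfC_far HR); lia.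
rewrite !(mulrDr, mulrDl, mulrBr, mulrBl, mulNr, mulrN, mulrA).
rewrite -?(@scalerAl _ A) -?(@scalerAr _ A) ?(@scalerA _ A) ?(@mulrA A).
rewrite ?c ?(mulr_rule c) ?mulrA.
by ncring ltac:(by ring).
Qed.

Section Adjoint.
Variables (n m : nat) (hn : (0 < n)%N) (hm : (0 < m)%N).
Variables (q : CC) (hq : q != 0) (hqq : q - q^-1 != 0).
Variables (U : algType CC) (g : gens U) (HU : is_Uq (n + m) q g).
Variables (ad : U -> U -> U) (Had : is_ad n (n + m) g ad).
Variables (rho : U -> Cx n m -> Cx n m) (Hrho : is_rho q g ad rho).
Local Notation N := (n + m)%N.
Local Notation mon := 'X_{1..nv n m}.
Local Notation B j k := (Root q g (n + j) k).
Local Notation bw w := (\prod_(v <- w) Root q g (n + v.1) v.2).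
Local Notation inPhi x := (exists p : Cx n m, x = Phi q g p).

Let HR : Uq_rels N q g := proj1 HU.

Lemma Uql_k i : (0 < i < N)%N -> Uql n N g (gk g i).
Proof. by move=> h; apply: subalg_gen; exists i; tauto. Qed.

Lemma Uql_ki i : (0 < i < N)%N -> Uql n N g (gki g i).
Proof. by move=> h; apply: subalg_gen; exists i; tauto. Qed.

Lemma Uql_e i : (0 < i < N)%N -> i != n -> Uql n N g (ge g i).
Proof. by move=> h h'; apply: subalg_gen; exists i; tauto. Qed.

Lemma Uql_f i : (0 < i < N)%N -> i != n -> Uql n N g (gf g i).
Proof. by move=> h h'; apply: subalg_gen; exists i; tauto. Qed.

(** The existence of [rho] enters here, as stability of the span of the ordered monomials. *)
Lemma ad_im a x : Uql n N g a -> inPhi x -> inPhi (ad a x).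
Proof. by move=> ha [p ->]; exists (rho a p); rewrite Hrho. Qed.

Lemma inPhi_lin (c : CC) x y : inPhi x -> inPhi y -> inPhi (c *: x + y).
Proof. by move=> [p ->] [p' ->]; exists (c *: p + p'); rewrite Phi_lin. Qed.

Lemma inPhiZ (c : CC) x : inPhi x -> inPhi (c *: x).
Proof. by move=> [p ->]; exists (c *: p); rewrite PhiZ. Qed.

Lemma inPhi_word w : all (valid n m) w -> pairwise lexo w -> inPhi (bw w).
Proof.
move=> h1 h2; exists 'X_[wmon n m w]; rewrite PhiX.
by rewrite (word_Emon hn hm q g h1 h2).
Qed.

Lemma word_neq0 w : all (valid n m) w -> pairwise lexo w -> bw w != 0.
Proof.
by move=> h1 h2; rewrite -(word_Emon hn hm q g h1 h2); apply: (Emon_neq0 hn hm hq hqq HU).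
Qed.

Lemma B_im j k : valid n m (j, k) -> inPhi (B j k).
Proof.
move=> h; have [|//|p hp] := @inPhi_word [:: (j, k)]; first by rewrite /= h.
by exists p; rewrite -hp big_seq1.
Qed.

Lemma BB_im j k j' k' : valid n m (j, k) -> valid n m (j', k') -> lexo (j, k) (j', k') ->
  inPhi (B j k * B j' k').
Proof.
move=> h h' hl; have [||p hp] := @inPhi_word [:: (j, k); (j', k')]; rewrite /= ?h ?h' ?hl //.
by exists p; rewrite -hp big_cons big_seq1.
Qed.

Lemma BB_neq0 j k j' k' : valid n m (j, k) -> valid n m (j', k') -> lexo (j, k) (j', k') ->
  B j k * B j' k' != 0.
Proof.
move=> h h' hl; have := @word_neq0 [:: (j, k); (j', k')]; rewrite /= h h' hl.
by rewrite big_cons big_seq1; apply.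
Qed.

(* For i <= n - 1 the coproduct of U_q(l) involves k_i, for i >= n + 1 its inverse. *)
Definition kap i := if (i < n)%N then gk g i else gki g i.
Definition kapi i := if (i < n)%N then gki g i else gk g i.

Section OneGen.
Variables (i : nat) (hi : (0 < i < N)%N) (hin : i != n).

Lemma kapK : kap i * kapi i = 1.
Proof. by rewrite /kap /kapi; case: ifP => _; rewrite ?(gk_gki HR hi) ?(gki_gk HR hi). Qed.

Lemma kapiK : kapi i * kap i = 1.
Proof. by rewrite /kap /kapi; case: ifP => _; rewrite ?(gk_gki HR hi) ?(gki_gk HR hi). Qed.

Lemma ad_f b : ad (gf g i) b = gf g i * b - kap i * b * kapi i * gf g i.
Proof.
have [_ /(_ i hi b) [_ [_ [h1 h2]]]] := Had; rewrite /kap /kapi.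
case: (ltngtP i n) hin => // h _; first by have [_ ->] := h1 h.
by have [_ ->] := h2 h.
Qed.

Lemma ad_e b : ad (ge g i) b = ge g i * b * kap i - b * ge g i * kap i.
Proof.
have [_ /(_ i hi b) [_ [_ [h1 h2]]]] := Had; rewrite /kap /kapi.
case: (ltngtP i n) hin => // h _; first by have [-> _] := h1 h.
by have [-> _] := h2 h.
Qed.

(** The coproduct of f_i puts the twist by [kap] on the left factor; in [ad_eM] the coproduct of e_i
    puts the inverse twist on the right factor. *)
Lemma ad_fM x y : ad (gf g i) (x * y) =
  ad (gf g i) x * y + (kap i * x * kapi i) * ad (gf g i) y.
Proof.
rewrite !ad_f mulrBl mulrBr !mulrA addrA subrK.
by rewrite -[_ * kapi i * kap i]mulrA kapiK mulr1.
Qed.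

Lemma ad_eM x y : ad (ge g i) (x * y) =
  ad (ge g i) x * (kapi i * y * kap i) + x * ad (ge g i) y.
Proof.
rewrite !ad_e mulrBl mulrBr !mulrA -![_ * kap i * kapi i]mulrA kapK !mulr1.
by rewrite addrA subrK.
Qed.

Lemma ad_lin a : Uql n N g a -> is_lin (ad a).
Proof. by case: Had => -[_ [h _]] _; apply: h. Qed.

Lemma ad_fZ (c : CC) x : ad (gf g i) (c *: x) = c *: ad (gf g i) x.
Proof. by rewrite !ad_f scalerBr -!scalerAr -!scalerAl. Qed.

Lemma ad_eZ (c : CC) x : ad (ge g i) (c *: x) = c *: ad (ge g i) x.
Proof. by rewrite !ad_e scalerBr -!scalerAr -!scalerAl. Qed.

Lemma wt_kap c : wt n m g c 0 (kap i).
Proof. by rewrite /kap; case: ifP => _; [apply: wt_k | apply: wt_ki]. Qed.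

Lemma wt_kapi c : wt n m g c 0 (kapi i).
Proof. by rewrite /kapi; case: ifP => _; [apply: wt_ki | apply: wt_k]. Qed.

Lemma wt_ad_f c h b : wt n m g c h b -> wt n m g c (h + (i == c)%:Z) (ad (gf g i) b).
Proof.
move=> hb; rewrite ad_f; apply: wtB.
  by rewrite addrC; apply: wtM => //; apply: wt_f.
apply: wtM; last exact: wt_f.
rewrite -[h]addr0; apply: wtM; last exact: wt_kapi.
by rewrite -[h]add0r; apply: wtM => //; apply: wt_kap.
Qed.

Lemma wt_ad_e c h b : wt n m g c h b -> wt n m g c (h - (i == c)%:Z) (ad (ge g i) b).
Proof.
move=> hb; rewrite ad_e -[h - _]addr0; apply: wtB; apply: wtM; try exact: wt_kap.
  by rewrite addrC; apply: wtM => //; apply: wt_e.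
by apply: wtM => //; apply: wt_e.
Qed.

(* q-exponent of conjugation by kap i on B j k *)
Definition om (v : nat * nat) : int :=
  if (i < n)%N then (v.2 == i.+1)%:Z - (v.2 == i)%:Z
  else (n + v.1 == i.+1)%:Z - (n + v.1 == i)%:Z.

Lemma qc_kap j k : valid n m (j, k) -> qc q (om (j, k)) (kap i) (B j k).
Proof.
rewrite /valid /= => hv; rewrite /kap /om /=.
have h := qc_k_Root hq HR hi (a := k) (l := n + j) ltac:(lia) ltac:(lia) ltac:(lia).
case: (ltngtP i n) hin => // h' _; last first.
  apply: (qc_ext (qcV hq (gk_gki HR hi) (gki_gk HR hi) h)).
  rewrite /eps; have -> : (k == i) = false by lia.
  have -> : (k == i.+1) = false by lia.
  by rewrite subrr subr0 opprB.
apply: (qc_ext h); rewrite /eps.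
have -> : (n + j == i)%N = false by lia.
have -> : (n + j == i.+1)%N = false by lia.
by rewrite subrr sub0r opprB.
Qed.

Lemma kapJ j k : valid n m (j, k) -> kap i * B j k * kapi i = q ^ om (j, k) *: B j k.
Proof. by move=> /qc_kap h; exact (proj2 (@qcJ q U _ _ _ _ kapK kapiK) h). Qed.

Lemma kapiJ j k : valid n m (j, k) -> kapi i * B j k * kap i = q ^ (- om (j, k)) *: B j k.
Proof. by move=> /qc_kap h; exact (proj2 (@qcJ q U _ _ _ _ kapiK kapK) (qcV hq kapK kapiK h)). Qed.

End OneGen.

(** * Values of ad e_i and ad f_i on a single root vector *)

Lemma hgt_n w : all (valid n m) w -> hgt n n w = size w.
Proof.
move=> h; apply/eqP; rewrite -all_count; apply: sub_all h => v; rewrite /valid /=; lia.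
Qed.

(** Every root vector E_{n+j,k} has degree 1 in f_n, so an element of degree 1 there can only
    involve monomials with a single factor. *)
Lemma zero_single x (h : nat -> int) : inPhi x -> (forall c, wt n m g c (h c) x) -> h n = 1 ->
  (forall v, valid n m v -> (forall c, (0 < c < N)%N ->
    ((v.2 <= c)%N && (c < n + v.1)%N)%:Z = h c) -> False) -> x = 0.
Proof.
move=> hx hw h1 hF; apply: (zero_by_wt hn hm hq hqq HU hx hw) => w hwv hc.
have := hc n ltac:(lia); rewrite hgt_n // h1; case: w hwv hc => [|v [|u w]] // hwv hc _.
by apply: (hF v) => [|c /hc <-]; [case/andP: hwv | rewrite /hgt /= addn0].
Qed.

Lemma wt_B c j k : valid n m (j, k) -> wt n m g c ((k <= c)%N && (c < n + j)%N)%:Z (B j k).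
Proof. by rewrite /valid /= => h; apply: wt_Root; lia. Qed.

(** The degree of E_{n+j,k} is the interval [k, n+j) of simple roots. Adding a root i < n gives an
    interval again only for i = k - 1; the three lemmas that follow are the analogous cases of
    removing a root or working at the upper end. *)
Lemma adf_lo0 i j k : (0 < i < n)%N -> valid n m (j, k) -> k != i.+1 ->
  ad (gf g i) (B j k) = 0.
Proof.
move=> hi hv hk; have [hi' hin] : (0 < i < N)%N /\ i != n by lia.
apply: (@zero_single _ (fun c => ((k <= c)%N && (c < n + j)%N)%:Z + (i == c)%:Z)
  (ad_im (Uql_f hi' hin) (B_im hv)) (fun c => wt_ad_f hi' hin (wt_B hv))).
  by move: hv; rewrite /valid /=; lia.
move=> v hv' hc; move: hv hv'; rewrite /valid /= => hv hv'.
have h1 := hc i hi'; have h2 := hc i.+1 ltac:(lia).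
have h3 : (0 < i.-1)%N -> _ := fun h => hc i.-1 ltac:(lia).
by clear -hi hk hv hv' h1 h2 h3; lia.
Qed.

Lemma ade_lo0 i j k : (0 < i < n)%N -> valid n m (j, k) -> k != i ->
  ad (ge g i) (B j k) = 0.
Proof.
move=> hi hv hk; have [hi' hin] : (0 < i < N)%N /\ i != n by lia.
apply: (@zero_single _ (fun c => ((k <= c)%N && (c < n + j)%N)%:Z - (i == c)%:Z)
  (ad_im (Uql_e hi' hin) (B_im hv)) (fun c => wt_ad_e hi' hin (wt_B hv))).
  by move: hv; rewrite /valid /=; lia.
move=> v hv' hc; move: hv hv'; rewrite /valid /= => hv hv'.
have h1 := hc i hi'; have h2 := hc i.+1 ltac:(lia).
have h3 : (0 < i.-1)%N -> _ := fun h => hc i.-1 ltac:(lia).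
by clear -hi hk hv hv' h1 h2 h3; lia.
Qed.

Lemma adf_hi0 i j k : (0 < i < m)%N -> valid n m (j, k) -> j != i ->
  ad (gf g (n + i)) (B j k) = 0.
Proof.
move=> hi hv hk; have [hi' hin] : (0 < n + i < N)%N /\ (n + i != n)%N by lia.
apply: (@zero_single _ (fun c => ((k <= c)%N && (c < n + j)%N)%:Z + ((n + i)%N == c)%:Z)
  (ad_im (Uql_f hi' hin) (B_im hv)) (fun c => wt_ad_f hi' hin (wt_B hv))).
  by move: hv; rewrite /valid /=; lia.
move=> v hv' hc; move: hv hv'; rewrite /valid /= => hv hv'.
have h1 := hc _ hi'; have h2 := hc (n + i.-1)%N ltac:(lia).
by clear -hi hk hv hv' h1 h2; lia.
Qed.

Lemma ade_hi0 i j k : (0 < i < m)%N -> valid n m (j, k) -> j != i.+1 ->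
  ad (ge g (n + i)) (B j k) = 0.
Proof.
move=> hi hv hk; have [hi' hin] : (0 < n + i < N)%N /\ (n + i != n)%N by lia.
apply: (@zero_single _ (fun c => ((k <= c)%N && (c < n + j)%N)%:Z - ((n + i)%N == c)%:Z)
  (ad_im (Uql_e hi' hin) (B_im hv)) (fun c => wt_ad_e hi' hin (wt_B hv))).
  by move: hv; rewrite /valid /=; lia.
move=> v hv' hc; move: hv hv'; rewrite /valid /= => hv hv'.
have h1 := hc _ hi'; have h2 : (i.+1 < m)%N -> _ := fun h => hc (n + i.+1)%N ltac:(lia).
by clear -hi hk hv hv' h1 h2; lia.
Qed.

Lemma ade0_comm i b : (0 < i < N)%N -> i != n -> ad (ge g i) b = 0 ->
  ge g i * b = b * ge g i.
Proof.
move=> hi hin; rewrite ad_e // => /eqP; rewrite subr_eq0 => /eqP h.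
by rewrite -[LHS]mulr1 -[RHS]mulr1 -(kapK hi) !mulrA h.
Qed.

Lemma om_lo i j k : (0 < i < n)%N -> om i (j, k) = (k == i.+1)%:Z - (k == i)%:Z.
Proof. by rewrite /om /= => /andP[_ ->]. Qed.

Lemma om_hi i j k : om (n + i) (j, k) = (j == i.+1)%:Z - (j == i)%:Z.
Proof. by rewrite /om /= ltnNge leq_addr /= -addnS !eqn_add2l. Qed.

(** This is the recursion for root vectors, multiplied by - q. *)
Lemma adf_lo1 i j : (0 < i < n)%N -> (0 < j <= m)%N ->
  ad (gf g i) (B j i.+1) = (- q) *: B j i.
Proof.
move=> hi hj; have [hi' hin] : (0 < i < N)%N /\ i != n by lia.
rewrite ad_f // kapJ //; last by rewrite /valid /=; lia.
rewrite om_lo // eqxx (_ : (i.+1 == i) = false) ?subr0 ?expr1z; last lia.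
rewrite (Root_lowS q g (k := i)); last lia.
by ncring ltac:(by field).
Qed.

Lemma adf_hi1 i k : (0 < i < m)%N -> (0 < k <= n)%N ->
  ad (gf g (n + i)) (B i k) = B i.+1 k.
Proof.
move=> hi hk; have [hi' hin] : (0 < n + i < N)%N /\ (n + i != n)%N by lia.
rewrite ad_f // kapJ //; last by rewrite /valid /=; lia.
rewrite om_hi // eqxx (_ : (i == i.+1) = false) ?sub0r ?exprN1; last lia.
rewrite addnS (Root_rev HR); try lia.
by rewrite -scalerAl.
Qed.

Lemma ef_comm i b X : (0 < i < N)%N -> ge g i * b = b * ge g i ->
  (ge g i * (b * gf g i) - (b * gf g i) * ge g i) * X =
    (q - q^-1)^-1 *: (b * (gk g i - gki g i) * X) /\
  (ge g i * (gf g i * b) - (gf g i * b) * ge g i) * X =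
    (q - q^-1)^-1 *: ((gk g i - gki g i) * b * X).
Proof.
move=> hi h; have := gef HR hi hi; rewrite eqxx => E; split.
  have -> : ge g i * (b * gf g i) - b * gf g i * ge g i =
    b * (ge g i * gf g i - gf g i * ge g i) by rewrite mulrA h -!mulrA -mulrBr.
  by rewrite E -scalerAr -scalerAl.
have -> : ge g i * (gf g i * b) - gf g i * b * ge g i =
  (ge g i * gf g i - gf g i * ge g i) * b by rewrite -[gf g i * b * _]mulrA -h !mulrA -mulrBl.
by rewrite E -!scalerAl.
Qed.

(** With b = E_{n+j,i+1} commuting with e_i, the commutator reduces to b (k_i - k_i^-1) - q^-1 (k_i
    - k_i^-1) b, up to the denominator. The k_i parts cancel, and the k_i^-1 part is absorbed by the
    factor k_i of the adjoint action. *)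
Lemma ade_lo1 i j : (0 < i < n)%N -> (0 < j <= m)%N ->
  ad (ge g i) (B j i) = (- q^-1) *: B j i.+1.
Proof.
move=> hi hj; have [hi' hin] : (0 < i < N)%N /\ i != n by lia.
have hv : valid n m (j, i.+1) by rewrite /valid /=; lia.
set b := B j i.+1.
have eb : ge g i * b = b * ge g i.
  by apply: (ade0_comm hi' hin); apply: ade_lo0 => //; lia.
have [E1 E2] := ef_comm (kap i) hi' eb.
have kE : kap i = gk g i by rewrite /kap; case/andP: hi => _ ->.
have kiE : kapi i = gki g i by rewrite /kapi; case/andP: hi => _ ->.
have := kapK hi'; have := kapiK hi'; rewrite ad_e // (Root_lowS q g (k := i)); last lia.
have := qc_kap hi' hin hv; have := qcV hq (kapK hi') (kapiK hi') (qc_kap hi' hin hv).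
rewrite om_lo // eqxx (_ : (i.+1 == i) = false) ?subr0; last lia.
rewrite -/b kE kiE /qc exprN1 expr1z => h1 h2 h3 h4.
transitivity (
  (ge g i * (b * gf g i) - b * gf g i * ge g i) * gk g i -
  q^-1 *: ((ge g i * (gf g i * b) - gf g i * b * ge g i) * gk g i)).
  by ncring ltac:(by ring).
rewrite kE in E1 E2; rewrite E1 E2 !(mulrBr, mulrBl) h1 h2.
rewrite -?(@scalerAl _ U) -?(mulrA b) h3.
have hs := sqr_sub1_neq0 hq hqq.
by ncring ltac:(by field; rewrite hq hs).
Qed.

Lemma ade_hi1 i k : (0 < i < m)%N -> (0 < k <= n)%N ->
  ad (ge g (n + i)) (B i.+1 k) = B i k.
Proof.
move=> hi hk; have [hi' hin] : (0 < n + i < N)%N /\ (n + i != n)%N by lia.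
have hv : valid n m (i, k) by rewrite /valid /=; lia.
set b := B i k.
have eb : ge g (n + i) * b = b * ge g (n + i).
  by apply: (ade0_comm hi' hin); apply: ade_hi0 => //; lia.
have [E1 E2] := ef_comm (kap (n + i)) hi' eb.
have kE : kap (n + i) = gki g (n + i) by rewrite /kap ltnNge leq_addr.
have kiE : kapi (n + i) = gk g (n + i) by rewrite /kapi ltnNge leq_addr.
have := kapK hi'; have := kapiK hi'; rewrite ad_e // addnS (Root_rev HR); try lia.
have := qc_kap hi' hin hv; have := qcV hq (kapK hi') (kapiK hi') (qc_kap hi' hin hv).
rewrite om_hi // eqxx (_ : (i == i.+1) = false) ?sub0r ?opprK; last lia.
rewrite -/b kE kiE /qc exprN1 expr1z => h1 h2 h3 h4.
transitivity (
  (ge g (n + i) * (gf g (n + i) * b) - gf g (n + i) * b * ge g (n + i)) * gki g (n + i) -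
  q^-1 *: ((ge g (n + i) * (b * gf g (n + i)) - b * gf g (n + i) * ge g (n + i)) * gki g (n + i))).
  by ncring ltac:(by ring).
rewrite kE in E1 E2; rewrite E1 E2 !(mulrBr, mulrBl) h1 h2.
rewrite -?(@scalerAl _ U) -?(mulrA b) h3.
have hs := sqr_sub1_neq0 hq hqq.
by ncring ltac:(by field; rewrite hq hs).
Qed.

(** * Commutation relations of the root vectors *)

(** Once an admissible reversed pair is known to lie in the span of the ordered monomials, only its
    coefficient remains to be found. *)
Lemma pair_prop j k j' k' : valid n m (j, k) -> valid n m (j', k') -> lexo (j', k') (j, k) ->
  admissible n [:: (j, k); (j', k')] -> inPhi (B j k * B j' k') ->
  exists c, B j k * B j' k' = c *: (B j' k' * B j k).
Proof.
move=> h h' hl ha [p hp].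
have [|//||c hc] := @Phi_proportional n m hn hm q hq hqq U g HU p [:: (j, k); (j', k')].
- by rewrite /= h h'.
- by rewrite -hp big_cons big_seq1.
exists c; move: hc; rewrite big_cons big_seq1 => ->; congr (_ *: _).
rewrite (@wmon_perm _ _ _ [:: (j', k'); (j, k)]); last first.
  by apply/permP => P /=; rewrite !addn0 addnC.
by rewrite (word_Emon hn hm) /= ?h ?h' ?hl // big_cons big_seq1.
Qed.

Lemma scale_inj (c c' : CC) (x : U) : x != 0 -> c *: x = c' *: x -> c = c'.
Proof.
move=> hx /eqP; rewrite -subr_eq0 -scalerBl scaler_eq0 (negPf hx) orbF subr_eq0.
by move/eqP.
Qed.

(** For l = k + 1, applying ad f_k to the square of E_{n+j,k+1} puts the reversed product into the
    span, and ad e_k brings both sides back to multiples of that square, which determines the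
    scalar. Larger distances follow by applying ad f_k to the relation for k + 1. *)
Lemma row_comm j k l : (0 < j <= m)%N -> (0 < k)%N -> (k < l <= n)%N ->
  B j l * B j k = q *: (B j k * B j l).
Proof.
move=> hj hk hkl; have [d hd] : exists d, l = (k + d).+1 by exists (l - k.+1)%N; lia.
elim: d k hk hkl hd => [|d IH] k hk hkl hd; last first.
  have hi : (0 < k < n)%N by lia.
  have [hi' hin] : (0 < k < N)%N /\ k != n by lia.
  have hv : valid n m (j, l) by rewrite /valid /=; lia.
  have hv' : valid n m (j, k.+1) by rewrite /valid /=; lia.
  have := congr1 (ad (gf g k)) (IH k.+1 ltac:(lia) ltac:(lia) ltac:(lia)).
  rewrite ad_fZ // !ad_fM // adf_lo1 // adf_lo0 //; last lia.
  rewrite mulr0 mul0r add0r addr0 kapJ // om_lo // (_ : (l == k.+1) = false); last lia.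
  rewrite (_ : (l == k) = false) ?subrr ?expr0z ?scale1r; last lia.
  rewrite -scalerAr -scalerAl !scalerA mulrC -scalerA => /scalerI; apply.
  by rewrite oppr_eq0.
have el : l = k.+1 by lia.
clear hd; subst l.
have hi : (0 < k < n)%N by lia.
have [hi' hin] : (0 < k < N)%N /\ k != n by lia.
have hv : valid n m (j, k.+1) by rewrite /valid /=; lia.
have hv' : valid n m (j, k) by rewrite /valid /=; lia.
have o1 : om k (j, k.+1) = 1 by rewrite om_lo // eqxx (_ : (k.+1 == k) = false) ?subr0; last lia.
have him : inPhi (B j k.+1 * B j k).
  have h1 := ad_im (Uql_f hi' hin) (BB_im hv hv (lexo_refl _)).
  have h2 := BB_im hv' hv; rewrite /lexo /= eqxx ltnn /= in h2.
  have {}h2 := inPhiZ q (h2 ltac:(lia)).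
  have [p hp] := inPhiZ (- (q^-1 * q^-1)) (inPhi_lin 1 h2 h1).
  exists p; rewrite -hp ad_fM // adf_lo1 // kapJ // o1 expr1z.
  by ncring ltac:(by field).
have [||c hc] := pair_prop hv hv' _ _ him.
- by rewrite /lexo /= eqxx ltnn /=; lia.
- by rewrite /admissible /=; move: hv hv'; rewrite /valid /=; lia.
rewrite hc; congr (_ *: _).
have := congr1 (ad (ge g k)) hc; rewrite ad_eZ // !ad_eM //.
rewrite [ad _ (B j k.+1)]ade_lo0 //; last lia.
rewrite ade_lo1 // mul0r mulr0 add0r addr0 kapiJ // o1 exprN1.
rewrite -!scalerAr -!scalerAl !scalerA => /(scale_inj (BB_neq0 hv hv (lexo_refl _))).
(* Solves the scalar equation [h] for [c]: its right side is c / q * - q^-1, and the outer factor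
   undoes it. *)
move=> h; have : c = - q * (q * (c / q * - q^-1)) by field.
by rewrite -h => ->; field.
Qed.

Lemma col_comm j k : (0 < j < m)%N -> (0 < k <= n)%N ->
  B j.+1 k * B j k = q *: (B j k * B j.+1 k).
Proof.
move=> hj hk.
have [hi' hin] : (0 < n + j < N)%N /\ (n + j != n)%N by lia.
have hv : valid n m (j.+1, k) by rewrite /valid /=; lia.
have hv' : valid n m (j, k) by rewrite /valid /=; lia.
have him : inPhi (B j.+1 k * B j k).
  have h1 := ad_im (Uql_f hi' hin) (BB_im hv' hv' (lexo_refl _)).
  have h2 := BB_im hv' hv; rewrite /lexo /= ltnSn /= in h2.
  have [p hp] := inPhi_lin (- q^-1) (h2 isT) h1.
  exists p; rewrite -hp ad_fM // adf_hi1 // kapJ // om_hi //.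
  rewrite eqxx (_ : (j == j.+1) = false) ?sub0r ?exprN1; last lia.
  by ncring ltac:(by field).
have [||c hc] := pair_prop hv hv' _ _ him.
- by rewrite /lexo /= ltnSn.
- by rewrite /admissible /=; move: hv hv'; rewrite /valid /=; lia.
rewrite hc; congr (_ *: _).
have := congr1 (ad (ge g (n + j))) hc; rewrite ad_eZ // !ad_eM //.
rewrite [ad _ (B j k)]ade_hi0 //; last lia.
rewrite ade_hi1 // mul0r mulr0 add0r addr0 kapiJ // om_hi //.
rewrite eqxx (_ : (j == j.+1) = false) ?sub0r ?opprK ?expr1z; last lia.
by rewrite -scalerAr => /(scale_inj (BB_neq0 hv' hv' (lexo_refl _))) ->.
Qed.

(** The product is obtained from ad f_{n+j} of the row product E_{n+j,k} E_{n+j,l}. Applying ad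
    e_{n+j} leads back to row j, where [row_comm] contributes the same factor [q] as the twist, so
    the coefficient is 1. *)
Lemma nest_comm j k l : (0 < j < m)%N -> (0 < k)%N -> (k < l <= n)%N ->
  B j.+1 k * B j l = B j l * B j.+1 k.
Proof.
move=> hj hk hkl.
have [hi' hin] : (0 < n + j < N)%N /\ (n + j != n)%N by lia.
have hv : valid n m (j.+1, k) by rewrite /valid /=; lia.
have hv2 : valid n m (j, k) by rewrite /valid /=; lia.
have hv3 : valid n m (j.+1, l) by rewrite /valid /=; lia.
have hv' : valid n m (j, l) by rewrite /valid /=; lia.
have him : inPhi (B j.+1 k * B j l).
  have h1 := BB_im hv2 hv'; rewrite /lexo /= eqxx ltnn /= in h1.
  have {}h1 := ad_im (Uql_f hi' hin) (h1 ltac:(lia)).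
  have h2 := BB_im hv2 hv3; rewrite /lexo /= ltnSn /= in h2.
  have [p hp] := inPhi_lin (- q^-1) (h2 isT) h1.
  exists p; rewrite -hp ad_fM // !adf_hi1 //; try lia.
  rewrite kapJ // om_hi // eqxx (_ : (j == j.+1) = false) ?sub0r ?exprN1; last lia.
  by ncring ltac:(by field).
have [||c hc] := pair_prop hv hv' _ _ him.
- by rewrite /lexo /= ltnSn.
- by rewrite /admissible /=; move: hv hv'; rewrite /valid /=; lia.
rewrite hc; suff -> : c = 1 by rewrite scale1r.
have := congr1 (ad (ge g (n + j))) hc; rewrite ad_eZ // !ad_eM //.
rewrite [ad _ (B j l)]ade_hi0 //; last lia.
rewrite ade_hi1 //; last lia.
rewrite mul0r mulr0 add0r addr0 kapiJ // om_hi //.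
rewrite eqxx (_ : (j == j.+1) = false) ?sub0r ?opprK ?expr1z; last lia.
rewrite (row_comm (j := j) (k := k) (l := l)); try lia.
rewrite -scalerAr scalerA => /scale_inj h.
have {}h := h (BB_neq0 hv2 hv' _); rewrite /lexo /= eqxx ltnn /= in h.
have {}h := h ltac:(lia).
by apply: (mulIf hq); rewrite mul1r.
Qed.

(** * The adjoint action in the quantum Weyl algebra *)

(** The variable (j, i+1) is replaced by its immediate predecessor (j, i), so nothing lies strictly
    between them and the function [z] may be arbitrary. *)
Lemma aq_ad_f_lo i : (0 < i < n)%N -> aq (m := m) q g (fun r : mon => ad (gf g i) (Emon q g r)).
Proof.
move=> hi; have [hi' hin] : (0 < i < N)%N /\ i != n by lia.
apply: (@aq_skew n m hn hm q hq U g _ (fun x => kap i * x * kapi i) id (om i) (fun _ => 0)) => //.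
- by move=> x y; apply: ad_fM.
- by rewrite mulr1 kapK.
- by move=> x y; rewrite !mulrA -[_ * kapi i * kap i]mulrA kapiK // mulr1.
- by move=> [j k] hv; apply: kapJ.
- by move=> v _; rewrite expr0z scale1r.
move=> [j k] hv; case: (eqVneq k i.+1) => [hk|hk]; last by left; apply: adf_lo0.
have hj : (0 < j <= m)%N by move: hv; rewrite /valid /=; lia.
right; exists (- q), (j, i), (-1), 0, (fun _ => 0); rewrite hk /=; split.
- by move: hv; rewrite /valid /=; lia.
- by apply/eqP => -[]; lia.
- by rewrite adf_lo1.
- by apply: (qcS hq (a := 1)); rewrite /qc expr1z row_comm //; lia.
split; first by left; rewrite om_lo // eqxx (_ : (i.+1 == i) = false) //; lia.
move=> [a c] _; rewrite !xpair_eqE /lexo /=; lia.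
Qed.

Lemma aq_ad_e_lo i : (0 < i < n)%N -> aq (m := m) q g (fun r : mon => ad (ge g i) (Emon q g r)).
Proof.
move=> hi; have [hi' hin] : (0 < i < N)%N /\ i != n by lia.
apply: (@aq_skew n m hn hm q hq U g _ id (fun x => kapi i * x * kap i)
  (fun _ => 0) (fun v => - om i v)) => //.
- by move=> x y; apply: ad_eM.
- by rewrite mulr1 kapiK.
- by move=> x y; rewrite !mulrA -[_ * kap i * kapi i]mulrA kapK // mulr1.
- by move=> v _; rewrite expr0z scale1r.
- by move=> [j k] hv; apply: kapiJ.
move=> [j k] hv; case: (eqVneq k i) => [hk|hk]; last by left; apply: ade_lo0.
have hj : (0 < j <= m)%N by move: hv; rewrite /valid /=; lia.
right; exists (- q^-1), (j, i.+1), 1, 1, (fun _ => 0); rewrite hk /=; split.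
- by move: hv; rewrite /valid /=; lia.
- by apply/eqP => -[]; lia.
- by rewrite ade_lo1.
- by rewrite /qc expr1z row_comm //; lia.
split; first by right; rewrite om_lo // eqxx (_ : (i == i.+1) = false) //; lia.
move=> [a c] _; rewrite !xpair_eqE /lexo /=; lia.
Qed.

(** Between (i, k) and (i+1, k) lie the end of row i and the beginning of row i+1. The new factor
    commutes with the former by [nest_comm] and has exponent 1 with the latter by [row_comm], whence
    the choice of [z]. *)
Lemma aq_ad_f_hi i : (0 < i < m)%N -> aq (m := m) q g (fun r : mon => ad (gf g (n + i)) (Emon q g r)).
Proof.
move=> hi; have [hi' hin] : (0 < n + i < N)%N /\ (n + i != n)%N by lia.
apply: (@aq_skew n m hn hm q hq U g _ (fun x => kap (n + i) * x * kapi (n + i)) id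
  (om (n + i)) (fun _ => 0)) => //.
- by move=> x y; apply: ad_fM.
- by rewrite mulr1 kapK.
- by move=> x y; rewrite !mulrA -[_ * kapi _ * kap _]mulrA kapiK // mulr1.
- by move=> [j k] hv; apply: kapJ.
- by move=> v _; rewrite expr0z scale1r.
move=> [j k] hv; case: (eqVneq j i) => [hk|hk]; last by left; apply: adf_hi0.
have hj : (0 < k <= n)%N by move: hv; rewrite /valid /=; lia.
right; exists 1, (i.+1, k), 1, 0, (fun u => (u.1 == i.+1)%:Z); rewrite hk /=; split.
- by move: hv; rewrite /valid /=; lia.
- by apply/eqP => -[]; lia.
- by rewrite adf_hi1 // scale1r.
- by rewrite /qc expr1z col_comm.
split; first by right; rewrite om_hi // eqxx (_ : (i == i.+1) = false) //; lia.
move=> [a c]; rewrite !xpair_eqE /lexo /valid /= => hac h1 h2 h3.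
case: (eqVneq a i.+1) => [ea|na]; first by rewrite ea /qc expr1z row_comm //; lia.
by have -> : a = i by [lia]; apply/qc0; apply: nest_comm; lia.
Qed.

Lemma aq_ad_e_hi i : (0 < i < m)%N -> aq (m := m) q g (fun r : mon => ad (ge g (n + i)) (Emon q g r)).
Proof.
move=> hi; have [hi' hin] : (0 < n + i < N)%N /\ (n + i != n)%N by lia.
apply: (@aq_skew n m hn hm q hq U g _ id (fun x => kapi (n + i) * x * kap (n + i))
  (fun _ => 0) (fun v => - om (n + i) v)) => //.
- by move=> x y; apply: ad_eM.
- by rewrite mulr1 kapiK.
- by move=> x y; rewrite !mulrA -[_ * kap _ * kapi _]mulrA kapK // mulr1.
- by move=> v _; rewrite expr0z scale1r.
- by move=> [j k] hv; apply: kapiJ.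
move=> [j k] hv; case: (eqVneq j i.+1) => [hk|hk]; last by left; apply: ade_hi0.
have hj : (0 < k <= n)%N by move: hv; rewrite /valid /=; lia.
right; exists 1, (i, k), (-1), (-1), (fun u => - (u.1 == i)%:Z); rewrite hk /=; split.
- by move: hv; rewrite /valid /=; lia.
- by apply/eqP => -[]; lia.
- by rewrite ade_hi1 // scale1r.
- by apply: (qcS hq (a := 1)); rewrite /qc expr1z col_comm.
split; first by left; rewrite om_hi // eqxx (_ : (i.+1 == i) = false) //; lia.
move=> [a c]; rewrite !xpair_eqE /lexo /valid /= => hac h1 h2 h3.
case: (eqVneq a i) => [ea|na].
  by rewrite ea; apply: (qcS hq (a := 1)); rewrite /qc expr1z row_comm //; lia.
by have -> : a = i.+1 by [lia]; apply/qc0; rewrite nest_comm //; lia.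
Qed.

Definition kw i (v : nat * nat) : int := eps i (n + v.1) - eps i v.2.

Lemma qc_k_B i v : (0 < i < N)%N -> valid n m v -> qc q (kw i v) (gk g i) (Root q g (n + v.1) v.2).
Proof.
by move=> hi; rewrite /valid => hv; apply: (qc_k_Root hq HR hi); lia.
Qed.

Lemma qc_k_Emon i (r : mon) : (0 < i < N)%N ->
  qc q (\sum_(u <- vlist n m) kw i u * (r (vi n m u))%:Z) (gk g i) (Emon q g r).
Proof.
move=> hi; rewrite PrE; apply: qc_Pr => // u; rewrite (mem_vlist hn hm) => hu.
exact: qc_k_B.
Qed.

Lemma ad_k i b : (0 < i < N)%N -> ad (gk g i) b = gk g i * b * gki g i.
Proof. by move=> hi; have [_ /(_ i hi b) []] := Had. Qed.

Lemma ad_ki i b : (0 < i < N)%N -> ad (gki g i) b = gki g i * b * gk g i.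
Proof. by move=> hi; have [_ /(_ i hi b) [_ []]] := Had. Qed.

Lemma all_vlist : all (valid n m) (vlist n m).
Proof. by apply/allP => u; rewrite mem_vlist. Qed.

Lemma aq_ad_k i : (0 < i < N)%N -> aq (m := m) q g (fun r : mon => ad (gk g i) (Emon q g r)).
Proof.
move=> hi; apply: (aq_ext (aq_diag g (qlin_sum hq (kw i) all_vlist))) => r.
rewrite ad_k //; symmetry.
exact (proj2 (@qcJ q U _ _ _ _ (gk_gki HR hi) (gki_gk HR hi)) (qc_k_Emon r hi)).
Qed.

Lemma aq_ad_ki i : (0 < i < N)%N -> aq (m := m) q g (fun r : mon => ad (gki g i) (Emon q g r)).
Proof.
move=> hi; apply: (aq_ext (aq_diag g (qlin_sum hq (fun u => - kw i u) all_vlist))) => r.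
rewrite ad_ki //; symmetry.
have h := qcV hq (gk_gki HR hi) (gki_gk HR hi) (qc_k_Emon r hi).
rewrite (proj2 (@qcJ q U _ _ _ _ (gki_gk HR hi) (gk_gki HR hi)) h).
by rewrite -sumrN; congr (q ^ _ *: _); apply: eq_bigr => u _; rewrite mulNr.
Qed.

Lemma inAq_of_aq a : Uql n N g a -> aq (m := m) q g (fun r : mon => ad a (Emon q g r)) ->
  inAq q (rho a).
Proof.
move=> ha [F h1 h2]; apply: (inAq_ext h1) => p.
apply: (Phi_inj2 hn hm hq hqq HU); rewrite Hrho //.
have hF : is_lin (fun p => Phi q g (F p)).
  by move=> c x y; rewrite (inAq_linear h1) Phi_lin.
have hA : is_lin (fun p : Cx n m => ad a (Phi q g p)).
  by move=> c x y; rewrite Phi_lin (ad_lin ha).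
rewrite (mlift_uniq p hF) (mlift_uniq p hA); apply: mlift_ext => r.
by rewrite h2 PhiX.
Qed.

Lemma inAq_rho a : Uql n N g a -> inAq q (rho a).
Proof.
elim=> {a} [a [i [hi ha]]||c x y hx IHx hy IHy|x y hx IHx hy IHy].
- have hg : Uql n N g a by apply: subalg_gen; exists i.
  apply: inAq_of_aq => //; case: ha => [->|[->|[hin ha]]]; [exact: aq_ad_k|exact: aq_ad_ki|].
  case: (ltngtP i n) hin => // h _.
    by case: ha => ->; [apply: aq_ad_e_lo | apply: aq_ad_f_lo]; lia.
  have ei : i = (n + (i - n))%N by lia.
  by case: ha => ->; rewrite ei; [apply: aq_ad_e_hi | apply: aq_ad_f_hi]; lia.
- apply: (inAq_ext (inAq_id _ _ _)) => p; apply: (Phi_inj2 hn hm hq hqq HU).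
  by rewrite Hrho; [have [[h _] _] := Had; rewrite h | exact: subalg_one].
- apply: (inAq_ext (inAq_lin c IHx IHy)) => p; apply: (Phi_inj2 hn hm hq hqq HU).
  rewrite Phi_lin !Hrho //; last exact: subalg_lin.
  by have [[_ [_ [h _]]] _] := Had; exact (esym (h c x y hx hy _)).
apply: (inAq_ext (inAq_comp IHx IHy)) => p; apply: (Phi_inj2 hn hm hq hqq HU).
rewrite /= !Hrho //; last exact: subalg_mul.
by have [[_ [_ [_ h]]] _] := Had; exact (esym (h x y hx hy _)).
Qed.

End Adjoint.

(** * The action on the induced module *)

Section Induced.
Variables (n m : nat) (hn : (0 < n)%N) (hm : (0 < m)%N).
Variables (q : CC) (hq : q != 0) (hqq : q - q^-1 != 0).
Variables (U : algType CC) (g : gens U) (HU : is_Uq (n + m) q g).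
Variables (V : lmodType CC) (sigma : U -> V -> V).
Variables (M : lmodType CC) (act : U -> M -> M) (incl : V -> M).
Hypothesis HM : is_induced (Uqp n (n + m) g) sigma act incl.
Variables (ad : U -> U -> U) (Had : is_ad n (n + m) g ad).
Variables (rho : U -> Cx n m -> Cx n m) (Hrho : is_rho q g ad rho).
Local Notation N := (n + m)%N.
Local Notation mon := 'X_{1..nv n m}.
Local Notation X r := ('X_[r] : Cx n m).
Local Notation E := (Root q g).
Local Notation vi := (vi n m).
Local Notation TH := (Theta q g act incl).
Let HR : Uq_rels N q g := proj1 HU.

(** The general rule a x = sum of ad(a_(1)) x a_(2): the second tensor factor moves to the right,
    where it meets V. *)
Lemma f_split i x : (0 < i < N)%N -> i != n ->
  gf g i * x = ad (gf g i) x + kap n g i * x * kapi n g i * gf g i.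
Proof. by move=> hi hin; rewrite (ad_f Had hi hin) subrK. Qed.

Lemma e_split i x : (0 < i < N)%N -> i != n ->
  ge g i * x = ad (ge g i) x * kapi n g i + x * ge g i.
Proof.
move=> hi hin; rewrite (ad_e Had hi hin) mulrBl -![_ * kap n g i * _]mulrA.
by rewrite (kapK HU hi) !mulr1 subrK.
Qed.

Lemma Uql_Root l k : (0 < k)%N -> (k < l)%N -> (l <= n)%N -> Uql n N g (E l k).
Proof.
move=> h0 hkl hl; move: k hkl h0; apply: low_ind => [k e|k hk IH] h0.
  by subst l; rewrite Root_low1; apply: Uql_f; lia.
have hf : Uql n N g (gf g k) by apply: Uql_f; lia.
have h := IH isT; rewrite Root_lowS // addrC -scaleNr.
by apply: subalg_lin; apply: subalg_mul.
Qed.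

Lemma Uql_Kprod a l : (0 < a)%N -> (l <= N)%N -> Uql n N g (Kprod g a l).
Proof.
move=> ha hl; rewrite /Kprod big_seq; apply: big_ind.
- exact: subalg_one.
- by move=> x y; apply: subalg_mul.
by move=> i; rewrite mem_index_iota => hi; apply: Uql_k; lia.
Qed.

Lemma adM a b x : Uql n N g a -> Uql n N g b -> ad (a * b) x = ad a (ad b x).
Proof. by move=> ha hb; have [[_ [_ [_ h]]] _] := Had; apply: h. Qed.

Lemma ad_linl (c : CC) a b x : Uql n N g a -> Uql n N g b ->
  ad (c *: a + b) x = c *: ad a x + ad b x.
Proof. by move=> ha hb; have [[_ [_ [h _]]] _] := Had; apply: h. Qed.

Lemma adZl (c : CC) a x : Uql n N g a -> ad (c *: a) x = c *: ad a x.
Proof.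
move=> ha; have := ad_linl (c - 1) x ha ha.
by rewrite scalerBl scale1r subrK => ->; rewrite scalerBl scale1r subrK.
Qed.

(* The coproduct of E_{n,c}, in the form used for the Levi action. *)
Lemma Root_split c x : (c < n)%N -> (0 < c)%N ->
  E n c * x = ad (E n c) x + ad (Kprod g c n) x * E n c +
  (q - q^-1) *: \sum_(c.+1 <= l < n) ad (E l c * Kprod g l n) x * E n l.
Proof.
move=> hc; move: c hc x; apply: low_ind => [k e|k hk IH] x h0.
  have hi : (0 < k < N)%N by lia.
  have hin : k != n by lia.
  rewrite big_geq; last lia.
  rewrite scaler0 addr0 (_ : Kprod g k n = gk g k); last by rewrite /Kprod -e big_nat1.
  rewrite (_ : E n k = gf g k); last by rewrite -e Root_low1.
  rewrite (ad_k Had _ hi) (f_split x hi hin); congr (_ + _ * _).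
  by rewrite /kap /kapi (_ : (k < n)%N) //; lia.
have hi : (0 < k < N)%N by lia.
have hin : k != n by lia.
have hkn : (k < n)%N by lia.
have uf := Uql_f g hi hin; have uk := Uql_k g hi.
have fs y : gf g k * y = ad (gf g k) y + ad (gk g k) y * gf g k.
  by rewrite (ad_k Had _ hi) (f_split y hi hin) /kap /kapi hkn.
have ua : Uql n N g (E n k.+1) by apply: Uql_Root; lia.
have uK : Uql n N g (Kprod g k.+1 n) by apply: Uql_Kprod; lia.
rewrite [in RHS]big_ltn // Root_low1.
have -> : Kprod g k n = gk g k * Kprod g k.+1 n by rewrite /Kprod big_ltn // ltnW.
(* Moving f_k past x replaces x by ad f_k x and ad k_k x, so the induction hypothesis is needed at
   three arguments. *)
have := IH (ad (gf g k) x) isT; have := IH (ad (gk g k) x) isT; have := IH x isT.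
rewrite (Root_lowS q g hk).
set a := E n k.+1 in ua *; set f := gf g k in uf fs *; set ka := gk g k in uk fs *.
set K := Kprod g k.+1 n in uK *.
set S1 := \sum_(_ <= _ < _) _ => I1; set S2 := \sum_(_ <= _ < _) _ => I2.
set S3 := \sum_(_ <= _ < _) _ => I3; set S4 := \sum_(_ <= _ < _) _.
have w2 : eps k k.+1 = -1 by rewrite /eps eqxx; have -> : (k.+1 == k) = false by lia.
have P1 l : (k.+1 < l <= n)%N -> E l k.+1 * ka = q^-1 *: (ka * E l k.+1).
  move=> hl; have := qc_k_Root hq HR hi (a := k.+1) (l := l) ltac:(lia) ltac:(lia) ltac:(lia).
  rewrite w2 /eps; have -> : (l == k) = false by lia.
  have -> : (l == k.+1) = false by lia.
  by rewrite /qc -[_ - _]/(1 : int) expr1z => ->; rewrite scalerA mulVf // scale1r.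
have Kk l : (0 < l)%N -> Kprod g l n * ka = ka * Kprod g l n.
  move=> hl; rewrite /Kprod big_seq; apply: (big_ind (fun x => x * ka = ka * x)).
  - by rewrite mul1r mulr1.
  - by move=> y z hy hz; rewrite -mulrA hz mulrA hy mulrA.
  - by move=> t; rewrite mem_index_iota => ht; apply: (gkC HR _ hi); lia.
have Kf l : (k < l <= n)%N -> Kprod g l n * f = q ^ (l == k.+1)%:Z *: (f * Kprod g l n).
  move=> hl; have := qc_f_Kprod hq HR hi (a := l) (l := n) ltac:(lia) ltac:(lia) ltac:(lia).
  rewrite /eps; have -> : (n == k) = false by lia.
  have -> : (n == k.+1) = false by lia.
  by have -> : (l == k) = false by [lia]; rewrite /qc subrr sub0r sub0r opprK.
have e1 : ad a (ad ka x) = q^-1 *: ad ka (ad a x).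
  by rewrite -!adM // P1 ?adZl //; [exact: subalg_mul | lia].
(* This factor [q] against the [q^-1] of the recursion produces the coefficient q - q^-1 of the new
   summand l = k + 1. *)
have e2 : ad K (ad f x) = q *: ad f (ad K x).
  rewrite -!adM // (Kf k.+1) ?eqxx ?expr1z ?adZl //; [exact: subalg_mul | lia].
have e3 : ad K (ad ka x) = ad ka (ad K x) by rewrite -!adM // Kk.
have e4 : ad (a * f - q^-1 *: (f * a)) x = ad a (ad f x) - q^-1 *: ad f (ad a x).
  rewrite addrC -scaleNr ad_linl ?adM //; try exact: subalg_mul.
  by rewrite scaleNr addrC.
have eS : S3 + S2 * f - q^-1 *: (f * S1) = S4.
  rewrite mulr_suml mulr_sumr scaler_sumr -big_split -sumrB; apply: eq_big_nat => l hl /=.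
  have ul : Uql n N g (E l k.+1) by apply: Uql_Root; lia.
  have uKl : Uql n N g (Kprod g l n) by apply: Uql_Kprod; lia.
  have uT : Uql n N g (E l k.+1 * Kprod g l n) by apply: subalg_mul.
  set T := E l k.+1 * Kprod g l n in uT *.
  have c1 : E n l * f = f * E n l.
    symmetry; apply: (Root_comm hq) => [|s hs]; first lia.
    have hs' : (0 < s < N)%N by lia.
    by apply: (gfC_far HR hi hs'); lia.
  have c2 : ad T (ad ka x) = q^-1 *: ad ka (ad T x).
    rewrite -!adM // -(adZl _ _ (subalg_mul uk uT)); congr (ad _ x).
    by rewrite /T -mulrA Kk ?mulrA ?P1 -?scalerAl //; lia.
  have c3 : E l k * Kprod g l n = T * f - q^-1 *: (f * T).
    rewrite (Root_lowS q g (k := k) (l := l)); last lia.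
    rewrite /T -[E l k.+1 * Kprod g l n * f]mulrA (Kf l); last lia.
    rewrite (_ : (l == k.+1) = false) ?expr0z ?scale1r; last lia.
    by rewrite mulrBl -scalerAl !mulrA.
  have -> : ad (E l k * Kprod g l n) x = ad T (ad f x) - q^-1 *: ad f (ad T x).
    rewrite c3 addrC -scaleNr ad_linl ?adM //; try exact: subalg_mul.
    by rewrite scaleNr addrC.
  rewrite c2 [f * _]mulrA fs -!scalerAl (mulr_rule c1).
  by ncring ltac:(by ring).
have -> : (a * f - q^-1 *: (f * a)) * x = a * (f * x) - q^-1 *: (f * (a * x)).
  by ncring ltac:(by ring).
rewrite (fs x) mulrDr mulrA I3 I2 I1 -eS e4 !adM // e1 e2 e3.
have := fs (ad a x); have := fs (ad K x) => F1 F2.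
rewrite [f * (_ + _ + _)]mulrDr [f * (_ + _)]mulrDr F2 [f * (ad K x * a)]mulrA F1.
by ncring ltac:(by ring).
Qed.

Lemma act_lin a : is_lin (act a).
Proof. by case: HM => -[_ [h _]] _; apply: h. Qed.

Lemma act_linl (c : CC) a b w : act (c *: a + b) w = c *: act a w + act b w.
Proof. by have [[_ [_ [h _]]] _] := HM; apply: h. Qed.

Lemma actM a b w : act (a * b) w = act a (act b w).
Proof. by have [[_ [_ [_ h]]] _] := HM; apply: h. Qed.

Lemma act0 w : act 0 w = 0.
Proof. by have := act_linl (-1) 0 0 w; rewrite scaler0 addr0 scaleN1r addNr. Qed.

Lemma actZ (c : CC) a w : act (c *: a) w = c *: act a w.
Proof. by have := act_linl c a 0 w; rewrite act0 !addr0. Qed.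

Lemma actD a b w : act (a + b) w = act a w + act b w.
Proof. by have := act_linl 1 a b w; rewrite !scale1r. Qed.

Lemma actB a b w : act (a - b) w = act a w - act b w.
Proof. by rewrite actD -[- b]scaleN1r actZ scaleN1r. Qed.

Lemma act_sum (I : eqType) (s : seq I) (P : pred I) (F : I -> U) w :
  act (\sum_(i <- s | P i) F i) w = \sum_(i <- s | P i) act (F i) w.
Proof. by apply: (big_morph (act^~ w)) => [a b|]; [apply: actD | apply: act0]. Qed.

Lemma lin_scale (W1 W2 : lmodType CC) (h : W1 -> W2) c x : is_lin h -> h (c *: x) = c *: h x.
Proof.
move=> hl; have h0 : h 0 = 0.
  by have := hl (-1) 0 0; rewrite scaler0 addr0 scaleN1r addNr.
by have := hl c x 0; rewrite h0 !addr0.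
Qed.

Lemma lin_add (W1 W2 : lmodType CC) (h : W1 -> W2) x y : is_lin h -> h (x + y) = h x + h y.
Proof. by move=> hl; have := hl 1 x y; rewrite !scale1r. Qed.

Lemma Theta_Phi (p : Cx n m) v : TH p v = act (Phi q g p) (incl v).
Proof.
rewrite /Theta /Phi act_sum; apply: eq_bigr => r _.
by rewrite actZ.
Qed.

Lemma ThetaX (r : mon) v : TH (X r) v = act (Emon q g r) (incl v).
Proof. by rewrite Theta_Phi PhiX. Qed.

Lemma ThetaZ c (p : Cx n m) v : TH (c *: p) v = c *: TH p v.
Proof. by rewrite !Theta_Phi PhiZ actZ. Qed.

Lemma incl_lin : is_lin incl.
Proof. by have [_ []] := HM. Qed.

Lemma incl_act p v : Uqp n N g p -> incl (sigma p v) = act p (incl v).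
Proof. by move=> hp; have [_ [_ [h _]]] := HM; apply: h. Qed.

Lemma Theta_rho a (r : mon) v : Uql n N g a ->
  TH (rho a (X r)) v = act (ad a (Emon q g r)) (incl v).
Proof. by move=> ha; rewrite Theta_Phi Hrho // PhiX. Qed.

Lemma Uqp_e i : (0 < i < N)%N -> Uqp n N g (ge g i).
Proof. by move=> h; apply: subalg_gen; exists i; tauto. Qed.

Lemma Uqp_k i : (0 < i < N)%N -> Uqp n N g (gk g i).
Proof. by move=> h; apply: subalg_gen; exists i; tauto. Qed.

Lemma Uqp_ki i : (0 < i < N)%N -> Uqp n N g (gki g i).
Proof. by move=> h; apply: subalg_gen; exists i; tauto. Qed.

Lemma Uqp_f i : (0 < i < N)%N -> i != n -> Uqp n N g (gf g i).
Proof. by move=> h h'; apply: subalg_gen; exists i; tauto. Qed.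

Lemma Uqp_Root l k : (0 < k)%N -> (k < l)%N -> (l <= N)%N -> (n < k)%N || (l <= n)%N ->
  Uqp n N g (E l k).
Proof.
move=> h0 hkl hl; move: k hkl h0; apply: low_ind => [k e|k hk IH] h0 h1.
  by subst l; rewrite Root_low1; apply: Uqp_f; lia.
have hf : Uqp n N g (gf g k) by apply: Uqp_f; lia.
have h := IH isT ltac:(lia); rewrite Root_lowS // addrC -scaleNr.
by apply: subalg_lin; apply: subalg_mul.
Qed.

Lemma kapX i x : (0 < i < N)%N -> i != n -> kap n g i * x * kapi n g i = ad (kap n g i) x.
Proof.
move=> hi hin; rewrite /kap /kapi; case: ifP => _; first by rewrite (ad_k Had).
by rewrite (ad_ki Had).
Qed.

Lemma Uql_kap i : (0 < i < N)%N -> Uql n N g (kap n g i).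
Proof. by move=> hi; rewrite /kap; case: ifP => _; [apply: Uql_k | apply: Uql_ki]. Qed.

Lemma Uqp_kapi i : (0 < i < N)%N -> Uqp n N g (kapi n g i).
Proof. by move=> hi; rewrite /kapi; case: ifP => _; [apply: Uqp_ki | apply: Uqp_k]. Qed.

Lemma act_f i (r : mon) v : (0 < i < N)%N -> i != n ->
  act (gf g i) (TH (X r) v) = TH (rho (gf g i) (X r)) v +
                              TH (rho (kap n g i) (X r)) (sigma (gf g i) v).
Proof.
move=> hi hin; rewrite ThetaX -actM f_split // actD !Theta_rho; [|exact: Uql_kap|exact: Uql_f].
by rewrite kapX // actM incl_act //; apply: Uqp_f.
Qed.

Lemma act_e i (r : mon) v : (0 < i < N)%N -> i != n ->
  act (ge g i) (TH (X r) v) = TH (rho (ge g i) (X r)) (sigma (kapi n g i) v) +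
                              TH (X r) (sigma (ge g i) v).
Proof.
move=> hi hin; rewrite !ThetaX -actM e_split // actD Theta_rho; last exact: Uql_e.
by rewrite !actM !incl_act //; [apply: Uqp_e | apply: Uqp_kapi].
Qed.

Lemma act_k i (r : mon) v : (0 < i < N)%N ->
  act (gk g i) (TH (X r) v) = TH (rho (gk g i) (X r)) (sigma (gk g i) v).
Proof.
move=> hi; rewrite ThetaX Theta_rho; last exact: Uql_k.
rewrite (ad_k Had _ hi) incl_act; last exact: Uqp_k.
by rewrite -!actM -!mulrA (gki_gk HR hi) mulr1.
Qed.

Lemma act_Root c (r : mon) v : (0 < c < n)%N ->
  act (E n c) (TH (X r) v) =
    TH (rho (E n c) (X r)) v + TH (rho (Kprod g c n) (X r)) (sigma (E n c) v)
    + (q - q^-1) *: \sum_(c.+1 <= l < n)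
        TH (rho (E l c * Kprod g l n) (X r)) (sigma (E n l) v).
Proof.
move=> hc; rewrite ThetaX -actM Root_split; [|lia..].
rewrite !actD actZ act_sum !Theta_rho; [|apply: Uql_Kprod; lia|apply: Uql_Root; lia].
rewrite actM incl_act; last by apply: Uqp_Root; lia.
congr (_ + _ *: _); apply: eq_big_nat => l hl.
rewrite Theta_rho; last by apply: subalg_mul; [apply: Uql_Root; lia | apply: Uql_Kprod; lia].
by rewrite actM incl_act //; apply: Uqp_Root; lia.
Qed.

(** * Cutting the list of variables at one position, and the action of f_n *)

Definition rows a l : seq (nat * nat) := [seq (j, k) | j <- iota a l, k <- iota 1 n].
Definition rowseg j a l : seq (nat * nat) := [seq (j, k) | k <- iota a l].

Lemma vlist_rows j : (0 < j <= m)%N ->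
  vlist n m = rows 1 j.-1 ++ rowseg j 1 n ++ rows j.+1 (m - j).
Proof.
move=> hj; rewrite /vlist -/(rows 1 m).
have -> : rows 1 m = rows 1 (j.-1 + (1 + (m - j))) by congr rows; lia.
have rD a b c : rows a (b + c) = rows a b ++ rows (a + b) c.
  by rewrite /rows iotaD map_cat flatten_cat.
rewrite rD rD; congr (_ ++ (_ ++ _)).
  by rewrite /rows /= cats0 /rowseg; congr (map (pair _) _); lia.
by congr rows; lia.
Qed.

Lemma rowseg_split j k : (0 < k <= n)%N ->
  rowseg j 1 n = rowseg j 1 k.-1 ++ (j, k) :: rowseg j k.+1 (n - k).
Proof.
move=> hk; rewrite /rowseg; have -> : iota 1 n = iota 1 (k.-1 + (1 + (n - k))).
  by congr iota; lia.
rewrite iotaD map_cat; congr (_ ++ _).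
by have -> : (1 + k.-1 = k)%N by lia.
Qed.

Lemma expz_sum (I : Type) (s : seq I) (F : I -> int) :
  q ^ (\sum_(i <- s) F i) = \prod_(i <- s) q ^ F i.
Proof. by apply: (big_morph (exprz q)) => [a b|]; rewrite ?expr0z // expfzDr. Qed.

Lemma oprod_diag (F : nat -> Cx n m -> Cx n m) (c : nat -> CC) (r : mon) s :
  (forall t, is_lin (F t)) -> (forall t, F t (X r) = c t *: X r) ->
  oprod [seq F t | t <- s] (X r) = (\prod_(t <- s) c t) *: X r.
Proof.
move=> hl hF; elim: s => [|t s IH] /=; first by rewrite big_nil scale1r.
rewrite -/(oprod _) IH big_cons (lin_scale _ _ (hl t)) hF scalerA mulrC //.
Qed.

Lemma oprod_lin (F : nat -> Cx n m -> Cx n m) s :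
  (forall t, is_lin (F t)) -> is_lin (oprod [seq F t | t <- s]).
Proof.
move=> hl; elim: s => [|t s IH] // c x y.
by rewrite -[LHS]/(F t (oprod [seq F t | t <- s] (c *: x + y))) IH hl.
Qed.

(** f_n is the root vector E_{n+1,n}, whose place is at the end of the first row; each factor it
    passes on the way contributes a [q]. *)
Lemma act_fn (r : mon) v : act (gf g n) (TH (X r) v) =
  TH (xop 1 n (oprod [seq gam q 1 t | t <- iota 1 n.-1] (X r))) v.
Proof.
have hv1 : valid n m (1, n)%N by rewrite /valid /=; lia.
rewrite (@oprod_diag _ (fun t => q ^+ r (vi (1, t)%N))); last first.
- by move=> t; exact: (gamX q (1, t)%N).
- by move=> t; apply: gam_lin.
rewrite (lin_scale _ _ (@xop_lin n m 1 n)) (xopX (1, n)%N) ThetaZ !ThetaX -actM -actZ.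
congr (act _ _); rewrite !PrE (vlist_rows (j := 1)); last lia.
rewrite (rowseg_split 1 (k := n)) ?leqnn ?hn //= subnn -catA /=.
have eqv : rowseg 1 1 n.-1 ++ (1, n)%N :: rows 2 (m - 1) = vlist n m.
  rewrite (vlist_rows (j := 1)); last lia.
  by rewrite (rowseg_split 1 (k := n)) ?leqnn ?hn //= subnn -catA.
have := @insert_head n m hn hm q hq U g (1, n)%N (fun _ => 1) (rowseg 1 1 n.-1) (rows 2 (m - 1)) r.
rewrite eqv => /(_ (all_vlist hn hm) (uniq_vlist n m)) /=.
rewrite addn1 Root_low1 => ->; last first.
  move=> u /mapP [t]; rewrite mem_iota => ht -> /=; rewrite /qc expr1z.
  have := row_comm hn hm hq hqq HU Had Hrho (j := 1) (k := t) (l := n) ltac:(lia) ltac:(lia) ltac:(lia).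
  by rewrite addn1 Root_low1.
congr (_ *: _); rewrite expz_sum big_map; apply: eq_bigr => t _.
by rewrite mul1r.
Qed.

(** * The action of e_n *)

Definition Dn x := ge g n * x - x * ge g n.

Lemma hnN : (0 < n < N)%N.
Proof. lia. Qed.

Lemma DnM x y : Dn (x * y) = Dn x * y + x * Dn y.
Proof. by rewrite /Dn; ncring ltac:(by ring). Qed.

Lemma en_f_comm t : (0 < t < N)%N -> t != n -> ge g n * gf g t = gf g t * ge g n.
Proof.
move=> ht htn; have := gef HR hnN ht; rewrite eq_sym (negPf htn) => /eqP.
by rewrite subr_eq0 => /eqP.
Qed.

Lemma en_Root_comm l k : (0 < k)%N -> (k < l)%N -> (l <= N)%N -> (n < k)%N || (l <= n)%N ->
  ge g n * E l k = E l k * ge g n.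
Proof.
by move=> h0 h1 h2 h3; apply: (Root_comm hq) => // t ht; apply: en_f_comm; lia.
Qed.

(** E_{n+1,k} is a q-commutator of f_n with E_{n,k}, and the latter commutes with e_n. The
    q-commutation with k_n cancels the k_n^-1 part; in [Dn_coln] it is the k_n part that cancels. *)
Lemma Dn_row1 k : (0 < k < n)%N -> Dn (E (n + 1) k) = E n k * gk g n.
Proof.
move=> hk; rewrite addn1 (Root_rev HR); try lia.
have eb : ge g n * E n k = E n k * ge g n by apply: en_Root_comm; lia.
have [E1 E2] := ef_comm HU 1 hnN eb; rewrite !mulr1 in E1 E2.
have h := qc_k_Root hq HR hnN (a := k) (l := n) ltac:(lia) ltac:(lia) ltac:(lia).
have h' := qcV hq (gk_gki HR hnN) (gki_gk HR hnN) h.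
have w : eps n n - eps n k = 1.
  rewrite /eps eqxx; have -> : (n == n.+1) = false by lia.
  have -> : (k == n) = false by lia.
  by have -> : (k == n.+1) = false by lia.
rewrite w /qc expr1z in h; rewrite w /qc exprN1 in h'.
transitivity ((ge g n * (gf g n * E n k) - gf g n * E n k * ge g n) -
  q^-1 *: (ge g n * (E n k * gf g n) - E n k * gf g n * ge g n)).
  by rewrite /Dn; ncring ltac:(by ring).
rewrite E1 E2 !(mulrBr, mulrBl) h h'.
have hs := sqr_sub1_neq0 hq hqq.
by ncring ltac:(by field; rewrite hq hs).
Qed.

Lemma Dn_corner : Dn (E (n + 1) n) = (q - q^-1)^-1 *: (gk g n - gki g n).
Proof. by rewrite addn1 Root_low1 /Dn (gef HR hnN hnN) eqxx. Qed.

Lemma Dn_coln j : (1 < j <= m)%N -> Dn (E (n + j) n) = - (gki g n * E (n + j) (n + 1)).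
Proof.
move=> hj; rewrite (Root_lowS q g (k := n)); last lia.
rewrite addn1; set b := E (n + j) n.+1.
have eb : ge g n * b = b * ge g n by apply: en_Root_comm; lia.
have [E1 E2] := ef_comm HU 1 hnN eb; rewrite !mulr1 in E1 E2.
have h := qc_k_Root hq HR hnN (a := n.+1) (l := n + j) ltac:(lia) ltac:(lia) ltac:(lia).
have h' := qcV hq (gk_gki HR hnN) (gki_gk HR hnN) h.
have w : eps n (n + j) - eps n n.+1 = 1.
  rewrite /eps eqxx; have -> : (n.+1 == n) = false by lia.
  have -> : (n + j == n)%N = false by lia.
  by have -> : (n + j == n.+1)%N = false by lia.
rewrite w /qc expr1z -/b in h; rewrite w /qc exprN1 -/b in h'.
transitivity ((ge g n * (b * gf g n) - b * gf g n * ge g n) -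
  q^-1 *: (ge g n * (gf g n * b) - gf g n * b * ge g n)).
  by rewrite /Dn; ncring ltac:(by ring).
rewrite E1 E2 !(mulrBr, mulrBl) h h'.
have hs := sqr_sub1_neq0 hq hqq.
by ncring ltac:(by field; rewrite hq hs).
Qed.

(** For k = n - 1 the two terms cancel because moving f_{n-1} past k_n^-1 costs a factor [q]. Below
    that, e_n commutes with both ingredients of the recursion. *)
Lemma Dn_inner j k : (1 < j <= m)%N -> (0 < k < n)%N -> Dn (E (n + j) k) = 0.
Proof.
move=> hj /andP[h0 hkn]; move: k hkn h0; apply: low_ind => [k e|k hk IH] h0.
  have ht : (0 < k < N)%N by lia.
  rewrite (Root_lowS q g (k := k)); last lia.
  have ef := en_f_comm ht ltac:(lia).
  have Df : Dn (gf g k) = 0 by rewrite /Dn ef subrr.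
  have DZ (c : CC) x : Dn (c *: x) = c *: Dn x by rewrite /Dn scalerBr -scalerAr -scalerAl.
  have DB x y : Dn (x - y) = Dn x - Dn y by rewrite /Dn; ncring ltac:(by ring).
  rewrite DB DZ !DnM Df mulr0 mul0r addr0 add0r e Dn_coln // addn1.
  have c1 : E (n + j) n.+1 * gf g k = gf g k * E (n + j) n.+1.
    symmetry; apply: (Root_comm hq) => [|s hs]; first lia.
    have hs' : (0 < s < N)%N by lia.
    by apply: (gfC_far HR ht hs'); lia.
  have c2 : gf g k * gki g n = q *: (gki g n * gf g k).
    have := qcS hq (qc_kif hq HR hnN ht); rewrite /cartan -e.
    have -> : (k.+1 == k) = false by lia.
    by rewrite eqxx /qc opprK expr1z.
  rewrite mulNr -mulrA c1 mulrN [gf g k * (_ * _)]mulrA c2 -scalerAl scalerN scalerA mulVf //.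
  by rewrite scale1r mulrA opprK addNr.
rewrite (Root_lowS q g (k := k)); last lia.
have ef := en_f_comm (t := k) ltac:(lia) ltac:(lia).
have eE : ge g n * E (n + j) k.+1 = E (n + j) k.+1 * ge g n.
  by have /eqP := IH isT; rewrite /Dn subr_eq0 => /eqP.
rewrite /Dn mulrBr mulrBl -scalerAr -scalerAl !mulrA eE ef.
by rewrite -!mulrA eE ef subrr.
Qed.

(** Needed to bring E_{n,k} k_n to the far left of a monomial. Each f_i in E_{n,k} q-commutes with
    E_{n+1,t} because ad f_i kills the latter. *)
Lemma qc_row1 k t : (0 < k < n)%N -> (0 < t <= k)%N ->
  qc q (- (t == k)%:Z - 1) (E n k * gk g n) (E (n + 1) t).
Proof.
move=> hk ht; have hv : valid n m (1, t)%N by rewrite /valid /=; lia.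
apply: qcMl => //; last first.
  apply: (qc_ext (qc_k_B hn hm hq hqq HU hnN hv)); rewrite /kw /eps /= addn1 eqxx.
  have -> : (n.+1 == n) = false by lia.
  have -> : (t == n) = false by lia.
  by have -> : (t == n.+1) = false by lia.
apply: qcS => //.
have -> : (t == k)%:Z = \sum_(k <= i < n) (t == i)%:Z.
  rewrite big_ltn; last lia.
  by rewrite [Y in _ = _ + Y]big_nat big1 ?addr0 // => i hi; have -> : (t == i) = false by lia.
apply: qc_Root_r => //; first lia.
move=> i hi; have hi' : (0 < i < n)%N by lia.
have hiN : (0 < i < N)%N by lia.
rewrite -[(t == i)%:Z]opprK; apply: qcS => //.
have := adf_lo0 hn hm hq hqq HU Had Hrho hi' hv ltac:(lia).
have hin : i != n by lia.
rewrite (ad_f Had hiN hin) (kapJ hn hm hq hqq HU hiN hin hv) om_lo // => /eqP.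
rewrite subr_eq0 -scalerAl (_ : (t == i.+1) = false) ?sub0r; last lia.
by move/eqP.
Qed.

(** The mirror case: k_n^-1 E_{n+j,n+1} is brought to the far right of a monomial, where it acts on
    V. *)
Lemma qc_coln j j' l : (1 < j <= j')%N -> (j' <= m)%N -> (0 < l <= n)%N ->
  qc q ((j' == j)%:Z + (l == n)%:Z) (gki g n * E (n + j) (n + 1)) (E (n + j') l).
Proof.
move=> hj hj' hl; have hv : valid n m (j', l)%N by rewrite /valid /=; lia.
rewrite addrC; apply: qcMl => //.
  apply: (qc_ext (qcV hq (gk_gki HR hnN) (gki_gk HR hnN) (qc_k_B hn hm hq hqq HU hnN hv))).
  rewrite /kw /eps /=.
  have -> : (n + j' == n)%N = false by lia.
  have -> : (n + j' == n.+1)%N = false by lia.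
  have -> : (l == n.+1) = false by lia.
  by rewrite !subr0 sub0r opprK.
rewrite -[(j' == j)%:Z]opprK; apply: qcS => //.
have -> : - (j' == j)%:Z = \sum_(n + 1 <= i < n + j) - ((n + j')%N == i.+1)%:Z :> int.
  have -> : (n + j = (n + j.-1).+1)%N by lia.
  rewrite big_nat_recr /=; last lia.
  rewrite big_nat big1 ?add0r => [|i hi]; last by have -> : (n + j' == i.+1)%N = false by lia.
  by congr (- _%:Z); rewrite -addnS eqn_add2l; congr (_ == _); lia.
apply: qc_Root_r => //; first lia.
move=> i hi; have [s es] : exists s, i = (n + s)%N by exists (i - n)%N; lia.
subst i; have hs : (0 < s < m)%N by lia.
have hiN : (0 < n + s < N)%N by lia.
have hin : (n + s != n)%N by lia.
apply: qcS => //.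
have := adf_hi0 hn hm hq hqq HU Had Hrho hs hv ltac:(lia).
rewrite (ad_f Had hiN hin) (kapJ hn hm hq hqq HU hiN hin hv) om_hi // => /eqP.
rewrite subr_eq0 -scalerAl (_ : (j' == s) = false) ?subr0; last lia.
by rewrite -addnS eqn_add2l; move/eqP.
Qed.

Lemma take_drop_index (v : nat * nat) s p1 p2 : uniq s -> s = p1 ++ v :: p2 ->
  take (index v s) s = p1 /\ drop (index v s).+1 s = p2.
Proof.
move=> hu e; have hv : v \notin p1.
  move: hu; rewrite e cat_uniq /= => /and3P[_ h _]; apply: contra h => h; apply/orP; by left.
rewrite e index_cat (negPf hv) /= eqxx addn0 take_size_cat //.
by rewrite -cat_rcons drop_size_cat // size_rcons.
Qed.

Definition dn_term (r : mon) v : U :=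
  Pr q g r (take (index v (vlist n m)) (vlist n m)) *
  Dn (Root q g (n + v.1) v.2 ^+ r (vi v)) *
  Pr q g r (drop (index v (vlist n m)).+1 (vlist n m)).

Lemma Dn_Emon (r : mon) : Dn (Emon q g r) = \sum_(v <- vlist n m) dn_term r v.
Proof.
rewrite PrE; have h := @skew_Pr n m q U g Dn id id DnM (erefl _) (erefl _) (fun _ _ => erefl _) r.
exact: (h _ (uniq_vlist n m)).
Qed.

Lemma Dn_exp0 x d : Dn x = 0 -> Dn (x ^+ d) = 0.
Proof.
by move/eqP; rewrite subr_eq0 => /eqP h; rewrite /Dn; apply/eqP; rewrite subr_eq0;
  apply/eqP; apply: commrX.
Qed.

Lemma Emon_dec (r : mon) v p1 p2 : valid n m v -> vlist n m = p1 ++ v :: p2 ->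
  Emon q g (r - U_(vi v))%MM = Pr q g r p1 * Root q g (n + v.1) v.2 ^+ (r (vi v)).-1 * Pr q g r p2.
Proof.
move=> hv e; have hu := uniq_vlist n m; have ha := all_vlist hn hm.
move: hu ha; rewrite PrE e cat_uniq all_cat /= => /and3P[_ h1 /andP[h2 _]] /and3P[h3 _ h4].
rewrite Pr_cat Pr_cons !(Pr_dec hn hm) //; last by apply: contra h1 => h; rewrite h.
by rewrite mnmBE mnm1E eqxx subn1 mulrA.
Qed.

(** [skew_exp] without twists: both w1 and w2 are 0, which forces t = 2 e with e = 1 or e = -1. *)
Lemma Dn_exp v y (c : CC) (t e : int) d : valid n m v ->
  Dn (Root q g (n + v.1) v.2) = c *: y ->
  qc q t y (Root q g (n + v.1) v.2) -> (e = -1 /\ t = - 2%:Z) \/ (e = 1 /\ t = 2%:Z) ->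
  Dn (Root q g (n + v.1) v.2 ^+ d.+1) =
  (c * (q ^ (e * d%:Z) * qint q d.+1)) *: (Root q g (n + v.1) v.2 ^+ d * y).
Proof.
move=> hv hD hy het.
apply: (@skew_exp n m q hq U g Dn id id (fun _ => 0) (fun _ => 0) DnM (erefl _) _ _ _ v y c t e d) => //.
- by move=> u _; rewrite expr0z scale1r.
- by move=> u _; rewrite expr0z scale1r.
by case: het => -[-> ->]; [left | right].
Qed.

Lemma dn_term0 (r : mon) v : r (vi v) = 0%N -> dn_term r v = 0.
Proof. by move=> h; rewrite /dn_term h expr0 /Dn mulr1 mul1r subrr mulr0 mul0r. Qed.

Lemma dn_term_row1 (r : mon) k : (0 < k < n)%N ->
  let r' := (r - U_(vi (1, k)%N))%MM in
  dn_term r (1, k)%N = ((\prod_(t <- iota 1 k) q ^+ r' (vi (1, t)%N)) * qint q (r (vi (1, k)%N))) *: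
    (E n k * gk g n * Emon q g r').
Proof.
move=> hk r'; have hv : valid n m (1, k)%N by rewrite /valid /=; lia.
case er : (r (vi (1, k)%N)) => [|d]; first by rewrite qint0 mulr0 scale0r dn_term0.
have e : vlist n m = rowseg 1 1 k.-1 ++ (1, k)%N :: (rowseg 1 k.+1 (n - k) ++ rows 2 (m - 1)).
  rewrite (vlist_rows (j := 1)); last lia.
  by rewrite (rowseg_split 1 (k := k)) /= -?catA //; lia.
have [e1 e2] := take_drop_index (uniq_vlist n m) e.
rewrite /dn_term e1 e2 er; set p1 := rowseg _ _ _; set p2 := _ ++ _.
have hy := qc_row1 hk (t := k) ltac:(lia).
rewrite eqxx in hy.
have D1 : Dn (Root q g (n + (1, k)%N.1) (1, k)%N.2) = 1 *: (E n k * gk g n).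
  by rewrite scale1r Dn_row1.
rewrite (Dn_exp d hv D1 hy (e := -1)); last by left.
rewrite (Emon_dec r hv e) er /= -scalerAr -scalerAl [Pr q g r p1 * (_ * _)]mulrA.
have q1 : qc q (\sum_(u <- p1) (-1) * (r (vi u))%:Z) (E n k * gk g n) (Pr q g r p1).
  apply: qc_Pr => // u /mapP [t]; rewrite mem_iota => ht -> /=.
  by apply: (qc_ext (qc_row1 hk (t := t) ltac:(lia))); have -> : (t == k) = false by lia.
have q2 := qcMr hq q1 (qcXr hq d hy).
have := qcS hq q2; rewrite /qc => ->; rewrite -scalerAl scalerA !mulrA; congr (_ *: _).
have -> : iota 1 k = iota 1 k.-1 ++ [:: k].
  transitivity (iota 1 (k.-1 + 1)); first by congr iota; lia.
  by rewrite iotaD /=; have -> : (1 + k.-1 = k)%N by lia.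
rewrite big_cat big_seq1 /= [r' _]mnmBE mnm1E eqxx er subn1 /=.
have -> : \prod_(t <- iota 1 k.-1) q ^+ r' (vi (1, t)%N) = q ^ (\sum_(u <- p1) (r (vi u))%:Z).
  rewrite expz_sum big_map; apply: eq_big_seq => t; rewrite mem_iota => ht.
  have hvt : valid n m (1, t)%N by rewrite /valid /=; lia.
  rewrite mnmBE mnm1E; case: eqP => [h|_]; last by rewrite subn0.
  by have [] := vi_inj hn hm hv hvt h; lia.
have -> : \sum_(u <- p1) -1 * (r (vi u))%:Z = - \sum_(u <- p1) (r (vi u))%:Z.
  by rewrite -sumrN; apply: eq_bigr => u _; rewrite mulN1r.
(* The exponent - d comes from differentiating the power, and 2 d from moving the result to the left
   past the remaining d factors. *)
have <- : q ^ (-1 * d%:Z) * q ^ (- ((- 1%:Z - 1) * d%:Z)) = q ^+ d.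
  by rewrite -expfzDr // exprnP; congr (q ^ _); ring.
rewrite mul1r opprD opprK expfzDr //.
set a1 := q ^ (- 1 * _); set a2 := q ^ (- (_ * _)); set a3 := q ^ _.
by ring.
Qed.

Lemma dec_row j j' (r : mon) l : (0 < j <= m)%N -> (0 < j' <= m)%N -> (0 < l <= n)%N -> j != j' ->
  (r - U_(vi (j, n)%N))%MM (vi (j', l)%N) = r (vi (j', l)%N).
Proof.
move=> hj hj' hl hne; have hv : valid n m (j, n)%N by rewrite /valid /=; lia.
have hv' : valid n m (j', l)%N by rewrite /valid /=; lia.
rewrite mnmBE mnm1E; case: eqP => [h|_]; last by rewrite subn0.
by have [] := vi_inj hn hm hv hv' h; lia.
Qed.

Lemma prod_rows (r : mon) (s : seq nat) (z : int) :
  \prod_(u <- [seq (j, k) | j <- s, k <- iota 1 n]) q ^ ((u.2 == n)%:Z * z * (r (vi u))%:Z) =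
  \prod_(j <- s) q ^ (z * (r (vi (j, n)%N))%:Z).
Proof.
rewrite big_allpairs; apply: eq_bigr => j _.
have -> : iota 1 n = iota 1 n.-1 ++ [:: n].
  transitivity (iota 1 (n.-1 + 1)); first by congr iota; lia.
  by rewrite iotaD /=; have -> : (1 + n.-1 = n)%N by lia.
rewrite big_cat big_seq1 /= eqxx mul1r big_seq big1 ?mul1r // => k; rewrite mem_iota => hk.
by have -> : (k == n) = false by [lia]; rewrite mul0r mul0r expr0z.
Qed.

Lemma dn_term_coln (r : mon) j : (1 < j <= m)%N ->
  let r' := (r - U_(vi (j, n)%N))%MM in
  dn_term r (j, n)%N =
  - ((\prod_(t <- iota j (m.+1 - j)) q ^+ r' (vi (t, n)%N)) * qint q (r (vi (j, n)%N))) *: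
    (Emon q g r' * (gki g n * E (n + j) (n + 1))).
Proof.
move=> hj r'; have hv : valid n m (j, n)%N by rewrite /valid /=; lia.
case er : (r (vi (j, n)%N)) => [|d]; first by rewrite qint0 mulr0 oppr0 scale0r dn_term0.
have e : vlist n m = (rows 1 j.-1 ++ rowseg j 1 n.-1) ++ (j, n)%N :: rows j.+1 (m - j).
  rewrite (vlist_rows (j := j)); last lia.
  by rewrite (rowseg_split j (k := n)) ?leqnn ?hn //= subnn -!catA.
have [e1 e2] := take_drop_index (uniq_vlist n m) e.
rewrite /dn_term e1 e2 er; set p1 := _ ++ _; set p2 := rows _ _.
have hy := qc_coln (j := j) (j' := j) (l := n) ltac:(lia) ltac:(lia) ltac:(lia).
rewrite !eqxx in hy.
have D1 : Dn (Root q g (n + (j, n)%N.1) (j, n)%N.2) = (-1) *: (gki g n * E (n + j) (n + 1)).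
  by rewrite scaleN1r Dn_coln.
rewrite (Dn_exp d hv D1 hy (e := 1)); last by right.
rewrite (Emon_dec r hv e) er /= -scalerAr -scalerAl.
have q1 : qc q (\sum_(u <- p2) (u.2 == n)%:Z * 1 * (r (vi u))%:Z)
    (gki g n * E (n + j) (n + 1)) (Pr q g r p2).
  apply: qc_Pr => // u /allpairsP [[a c] /=]; rewrite !mem_iota => -[ha hc ->] /=.
  apply: (qc_ext (qc_coln (j := j) (j' := a) (l := c) ltac:(lia) ltac:(lia) ltac:(lia))).
  by have -> : (a == j) = false by [lia]; rewrite add0r mulr1.
rewrite -!(mulrA (Pr q g r p1)) -(mulrA (_ ^+ d) _ (Pr q g r p2)).
have := q1; rewrite /qc => ->; rewrite -!scalerAr scalerA !(@mulrA U); congr (_ *: _).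
have -> : (m.+1 - j = (m - j).+1)%N by lia.
rewrite /= big_cons [r' _]mnmBE mnm1E eqxx er subn1 /=.
have -> : \prod_(t <- iota j.+1 (m - j)) q ^+ r' (vi (t, n)%N) =
    q ^ (\sum_(u <- p2) (u.2 == n)%:Z * 1 * (r (vi u))%:Z).
  rewrite expz_sum prod_rows; apply: eq_big_seq => t; rewrite mem_iota => ht.
  by rewrite mul1r dec_row //; lia.
rewrite mul1r -exprnP; set a2 := q ^ _; set a3 := qint _ _.
by ring.
Qed.

(** Treated apart from [Dn_exp]: the commutator at the corner is a combination of k_n and k_n^-1,
    which q-commute with E_{n+1,n} with different exponents. *)
Lemma Dn_exp_corner d : Dn (E (n + 1) n ^+ d.+1) =
  ((q - q^-1)^-1 * qint q d.+1) *: (E (n + 1) n ^+ d * (q ^- d *: gk g n - q ^+ d *: gki g n)).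
Proof.
have hs := sqr_sub1_neq0 hq hqq.
have hv : valid n m (1, n)%N by rewrite /valid /=; lia.
have h := qc_k_B hn hm hq hqq HU hnN hv.
have h' := qcV hq (gk_gki HR hnN) (gki_gk HR hnN) h.
have w : kw n n (1, n)%N = - 2%:Z.
  rewrite /kw /eps /= addn1 !eqxx.
  by have -> : (n.+1 == n) = false by [lia]; have -> : (n == n.+1) = false by lia.
rewrite w /qc /= -exprnN in h; rewrite w opprK /qc /= -exprnP in h'.
elim: d => [|d IH].
  by rewrite !expr0 expr1 invr1 !scale1r mul1r Dn_corner /qint expr1 divff // mulr1.
rewrite exprSr DnM IH Dn_corner -!scalerAl -(mulrA _ _ (E (n + 1) n)) mulrBl -!scalerAl h h'.
have hd : q ^+ d != 0 by rewrite expf_neq0.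
have e : E (n + 1) n ^+ d.+1 = E (n + 1) n ^+ d * E (n + 1) n by rewrite exprSr.
rewrite !e /qint !exprS expr0 mulr1.
by ncring ltac:(by field; rewrite hq hd hs).
Qed.

Lemma dn_term_corner (r : mon) :
  let r' := (r - U_(vi (1, n)%N))%MM in
  let G := \prod_(t <- iota 1 m) q ^+ r' (vi (t, n)%N) in
  dn_term r (1, n)%N = ((q - q^-1)^-1 * qint q (r (vi (1, n)%N))) *:
    (Emon q g r' * (G^-1 *: gk g n - G *: gki g n)).
Proof.
move=> r' G; have hv : valid n m (1, n)%N by rewrite /valid /=; lia.
case er : (r (vi (1, n)%N)) => [|d]; first by rewrite qint0 mulr0 scale0r dn_term0.
have e : vlist n m = rowseg 1 1 n.-1 ++ (1, n)%N :: rows 2 (m - 1).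
  rewrite (vlist_rows (j := 1)); last lia.
  by rewrite (rowseg_split 1 (k := n)) ?leqnn ?hn //= subnn -!catA.
have [e1 e2] := take_drop_index (uniq_vlist n m) e.
rewrite /dn_term e1 e2 er /= Dn_exp_corner; set p1 := rowseg _ _ _; set p2 := rows _ _.
rewrite (Emon_dec r hv e) er /= -scalerAr -scalerAl; congr (_ *: _).
rewrite -!(mulrA (Pr q g r p1)) -!(mulrA (_ ^+ d)); congr (_ * (_ * _)).
pose S (z : int) := q ^ (\sum_(u <- p2) (u.2 == n)%:Z * z * (r (vi u))%:Z).
have q1 : gk g n * Pr q g r p2 = S (-1) *: (Pr q g r p2 * gk g n).
  apply: qc_Pr => // u /allpairsP [[a c] /=]; rewrite !mem_iota => -[ha hc ->] /=.
  have hv' : valid n m (a, c)%N by rewrite /valid /=; lia.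
  apply: (qc_ext (qc_k_B hn hm hq hqq HU hnN hv')); rewrite /kw /eps /=.
  have -> : (n + a == n)%N = false by lia.
  have -> : (n + a == n.+1)%N = false by lia.
  have -> : (c == n.+1) = false by lia.
  by rewrite !subr0 sub0r mulrN1.
have q2 : gki g n * Pr q g r p2 = S 1 *: (Pr q g r p2 * gki g n).
  rewrite (qcV hq (gk_gki HR hnN) (gki_gk HR hnN) q1); congr (q ^ _ *: _).
  by rewrite -sumrN; apply: eq_bigr => u _; rewrite mulrN1 mulr1 mulNr opprK.
have hG : G = q ^+ d * S 1.
  rewrite /G; have -> : iota 1 m = 1%N :: iota 2 (m - 1).
    by transitivity (iota 1 (m - 1).+1) => //; congr iota; lia.
  have er' : r' (vi (1, n)%N) = d by rewrite mnmBE mnm1E eqxx er subn1.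
  rewrite big_cons er' /S expz_sum prod_rows; congr (_ * _).
  by apply: eq_big_seq => t; rewrite mem_iota => ht; rewrite mul1r dec_row //; lia.
have hS : S (-1) = (S 1)^-1.
  rewrite /S invr_expz -sumrN; congr (q ^ _); apply: eq_bigr => u _.
  by rewrite mulrN1 mulr1 mulNr.
have hS1 : S 1 != 0 by rewrite expfz_neq0.
have hd : q ^+ d != 0 by rewrite expf_neq0.
rewrite -/p2 mulrBl -!scalerAl q1 q2 hG hS.
by ncring ltac:(by field; rewrite ?hS1 ?hd).
Qed.

(** The q-integer of a_1 + ... + a_d, split according to [x + y] = [x] q^-y + q^x [y]. It accounts
    for the sum over x_{k,n} d_{k,n} d_{1,n} in the formula for e_n. *)
Lemma telescope_qint (a : nat -> nat) d :
  \sum_(1 <= c < d.+1) (\prod_(t <- iota 1 c.-1) q ^+ a t) * qint q (a c) *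
     (\prod_(t <- iota c.+1 (d - c)) q ^- a t) =
  (\prod_(t <- iota 1 d) q ^+ a t - (\prod_(t <- iota 1 d) q ^+ a t)^-1) / (q - q^-1).
Proof.
elim: d => [|d IH]; first by rewrite big_geq // big_nil invr1 subrr mul0r.
have hS : iota 1 d.+1 = iota 1 d ++ [:: d.+1].
  by transitivity (iota 1 (d + 1)); [rewrite addn1 | rewrite iotaD add1n].
have e0 : iota d.+2 (d.+1 - d.+1) = [::] by rewrite subnn.
rewrite big_nat_recr // e0 big_nil mulr1 -[d.+1.-1]/d hS big_cat big_seq1 /=.
have -> : \sum_(1 <= c < d.+1) (\prod_(t <- iota 1 c.-1) q ^+ a t) * qint q (a c) *
     (\prod_(t <- iota c.+1 (d.+1 - c)) q ^- a t) =
   (\sum_(1 <= c < d.+1) (\prod_(t <- iota 1 c.-1) q ^+ a t) * qint q (a c) *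
     (\prod_(t <- iota c.+1 (d - c)) q ^- a t)) * q ^- a d.+1.
  rewrite mulr_suml; apply: eq_big_nat => c hc; rewrite -[RHS]mulrA; congr (_ * _).
  have -> : (d.+1 - c = (d - c) + 1)%N by lia.
  rewrite iotaD big_cat /=; congr (_ * _).
  by rewrite big_seq1; congr (q ^- a _); lia.
rewrite IH; set P := \prod_(t <- _) _.
have hP : P != 0 by rewrite /P; elim: (iota 1 d) => [|t s IHs]; rewrite ?big_nil ?oner_neq0 // big_cons mulf_neq0 ?expf_neq0.
have ha : q ^+ a d.+1 != 0 by rewrite expf_neq0.
have hs := sqr_sub1_neq0 hq hqq.
by rewrite /qint; field; rewrite hP ha hq hs.
Qed.

Lemma Dn_sum (r : mon) : Dn (Emon q g r) =
  \sum_(1 <= c < n) dn_term r (1, c)%N + dn_term r (1, n)%N +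
  \sum_(2 <= c < m.+1) dn_term r (c, n)%N.
Proof.
have in1 : iota 1 n = iota 1 n.-1 ++ [:: n].
  transitivity (iota 1 (n.-1 + 1)); first by congr iota; lia.
  by rewrite iotaD /=; have -> : (1 + n.-1 = n)%N by lia.
have im1 : iota 1 m = 1%N :: iota 2 (m - 1).
  by transitivity (iota 1 (m - 1).+1) => //; congr iota; lia.
rewrite Dn_Emon /vlist big_allpairs im1 big_cons {1}in1 big_cat big_seq1 /=.
rewrite /index_iota subSS !subn1; congr (_ + _); apply: eq_big_seq => j; rewrite mem_iota => hj.
rewrite in1 big_cat big_seq1 /= big_seq big1 ?add0r // => k; rewrite mem_iota => hk.
have [hj' hk'] : (1 < j <= m)%N /\ (0 < k < n)%N by lia.
by rewrite /dn_term Dn_exp0 ?mulr0 ?mul0r //; apply: Dn_inner.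
Qed.

Lemma act_en (r : mon) v : act (ge g n) (TH (X r) v) =
    \sum_(1 <= c < n)
       act (E n c * gk g n) (TH (oprod [seq gam q 1 t | t <- iota 1 c] (dop q 1 c (X r))) v)
    - \sum_(2 <= c < m.+1)
       TH (oprod [seq gam q t n | t <- iota c (m.+1 - c)] (dop q c n (X r)))
          (sigma (gki g n * E (n + c) (n + 1)) v)
    - \sum_(1 <= c < m.+1)
       TH (oprod ([seq gam q t n | t <- iota 1 c.-1] ++ [seq gami q t n | t <- iota c.+1 (m - c)])
                 (xop c n (dop q c n (dop q 1 n (X r)))))
          (sigma (gk g n) v)
    + TH (X r) (sigma (ge g n) v)
    + TH (oprod [seq gam q t n | t <- iota 1 m] (dop q 1 n (X r)))
         ((q - q^-1)^-1 *: (sigma (gk g n) v - sigma (gki g n) v)).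
Proof.
have O1 s j k k' (r0 : mon) : oprod [seq gam q j t | t <- s] (dop q k k' (X r0)) =
    (qint q (r0 (vi (k, k')%N)) * \prod_(t <- s) q ^+ (r0 - U_(vi (k, k')%N))%MM (vi (j, t)%N)) *:
    X (r0 - U_(vi (k, k')%N))%MM.
  rewrite (dopX q (k, k')%N) (lin_scale _ _ (@oprod_lin (gam q j) _ _)); last exact: gam_lin.
  rewrite (@oprod_diag _ (fun t => q ^+ (r0 - U_(vi (k, k')%N))%MM (vi (j, t)%N))) ?scalerA //.
    by move=> t; apply: gam_lin.
  by move=> t; exact: (gamX q (j, t)%N).
have O2 s k k' (r0 : mon) : oprod [seq gam q t n | t <- s] (dop q k k' (X r0)) =
    (qint q (r0 (vi (k, k')%N)) * \prod_(t <- s) q ^+ (r0 - U_(vi (k, k')%N))%MM (vi (t, n)%N)) *: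
    X (r0 - U_(vi (k, k')%N))%MM.
  rewrite (dopX q (k, k')%N) (lin_scale _ _ (@oprod_lin (fun t => gam q t n) _ _)); last first.
    by move=> t; apply: gam_lin.
  rewrite (@oprod_diag (fun t => gam q t n) (fun t => q ^+ (r0 - U_(vi (k, k')%N))%MM (vi (t, n)%N))) ?scalerA //.
    by move=> t; apply: gam_lin.
  by move=> t; exact: (gamX q (t, n)%N).
set r1 := (r - U_(vi (1, n)%N))%MM.
pose a t := r1 (vi (t, n)%N).
have O3 c : (1 <= c < m.+1)%N ->
    oprod ([seq gam q t n | t <- iota 1 c.-1] ++ [seq gami q t n | t <- iota c.+1 (m - c)])
                 (xop c n (dop q c n (dop q 1 n (X r)))) =
    (qint q (r (vi (1, n)%N)) * ((\prod_(t <- iota 1 c.-1) q ^+ a t) * qint q (a c) *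
       (\prod_(t <- iota c.+1 (m - c)) q ^- a t))) *: X r1.
  move=> hc; have oc s s' (p : Cx n m) : oprod (s ++ s') p = oprod s (oprod s' p).
    by elim: s => [|F s IH] //; rewrite -[LHS]/(F (oprod (s ++ s') p)) IH.
  have LZ (F : Cx n m -> Cx n m) b p : is_lin F -> F (b *: p) = b *: F p by apply: lin_scale.
  rewrite (dopX q (1, n)%N) (LZ (dop q c n)) ?(dopX q (c, n)%N); last exact: dop_lin.
  rewrite -/r1 -/(a c) scalerA (LZ (xop c n)) ?(xopX (c, n)%N); last exact: xop_lin.
  (* If the exponent is 0, then x_{c,n} d_{c,n} does not restore the monomial, since the subtraction
     is truncated; but the q-integer is then 0. *)
  case ea : (a c) => [|d].
    by rewrite qint0 mulr0 scale0r mulr0 mul0r mulr0 scale0r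
      -[0]/(0 : Cx n m) -(scale0r (0 : Cx n m)) oc LZ ?LZ ?scale0r //; apply: oprod_lin => t;
      first [apply: gami_lin | apply: gam_lin].
  have -> : (U_(vi (c, n)%N) + (r1 - U_(vi (c, n)%N)))%MM = r1.
    apply/mnmP => i; rewrite mnmDE mnmBE mnm1E; case: eqP => [<-|_]; last by rewrite subn0.
    by rewrite -/(a c) ea subn1.
  rewrite oc (LZ (oprod _)); last by apply: oprod_lin => t; apply: gami_lin.
  rewrite (@oprod_diag (fun t => gami q t n) (fun t => q ^- a t)); last first.
  - by move=> t; exact: (gamiX q (t, n)%N).
  - by move=> t; apply: gami_lin.
  rewrite scalerA (LZ (oprod _)); last by apply: oprod_lin => t; apply: gam_lin.
  rewrite (@oprod_diag (fun t => gam q t n) (fun t => q ^+ a t)); last first.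
  - by move=> t; exact: (gamX q (t, n)%N).
  - by move=> t; apply: gam_lin.
  rewrite scalerA; congr (_ *: _); by ring.
rewrite ThetaX -actM.
have -> : ge g n * Emon q g r = Dn (Emon q g r) + Emon q g r * ge g n by rewrite /Dn subrK.
rewrite actD Dn_sum !actD [act (_ * ge g n) _]actM -(incl_act _ (Uqp_e hnN)).
rewrite -ThetaX !act_sum.
have -> : \sum_(1 <= c < n) act (dn_term r (1, c)%N) (incl v) = \sum_(1 <= c < n)
       act (E n c * gk g n) (TH (oprod [seq gam q 1 t | t <- iota 1 c] (dop q 1 c (X r))) v).
  apply: eq_big_nat => c hc; rewrite O1 ThetaZ ThetaX (lin_scale _ _ (act_lin _)) -actM dn_term_row1; last lia.
  by rewrite actZ mulrC.
have -> : \sum_(2 <= c < m.+1) act (dn_term r (c, n)%N) (incl v) = - \sum_(2 <= c < m.+1)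
       TH (oprod [seq gam q t n | t <- iota c (m.+1 - c)] (dop q c n (X r)))
          (sigma (gki g n * E (n + c) (n + 1)) v).
  rewrite -sumrN; apply: eq_big_nat => c hc; rewrite O2 ThetaZ ThetaX dn_term_coln; last lia.
  rewrite incl_act; last first.
    by apply: subalg_mul; [apply: Uqp_ki; exact: hnN | apply: Uqp_Root; lia].
  by rewrite -actM actZ scaleNr mulrC.
have -> : \sum_(1 <= c < m.+1)
       TH (oprod ([seq gam q t n | t <- iota 1 c.-1] ++ [seq gami q t n | t <- iota c.+1 (m - c)])
                 (xop c n (dop q c n (dop q 1 n (X r)))))
          (sigma (gk g n) v) =
   (qint q (r (vi (1, n)%N)) * ((\prod_(t <- iota 1 m) q ^+ a t - (\prod_(t <- iota 1 m) q ^+ a t)^-1) / (q - q^-1))) *: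
      TH (X r1) (sigma (gk g n) v).
  rewrite -telescope_qint mulr_sumr scaler_suml; apply: eq_big_nat => c hc.
  by rewrite O3 // ThetaZ.
rewrite O2 ThetaZ -/r1 dn_term_corner -/r1 actZ.
set G := \prod_(t <- iota 1 m) _.
have -> : act (Emon q g r1 * (G^-1 *: gk g n - G *: gki g n)) (incl v) =
    G^-1 *: TH (X r1) (sigma (gk g n) v) - G *: TH (X r1) (sigma (gki g n) v).
  rewrite !ThetaX !incl_act; [|exact: (Uqp_ki hnN)|exact: (Uqp_k hnN)].
  by rewrite mulrBr -!scalerAr actB !actZ !actM.
have -> : TH (X r1) ((q - q^-1)^-1 *: (sigma (gk g n) v - sigma (gki g n) v)) =
   (q - q^-1)^-1 *: (TH (X r1) (sigma (gk g n) v) - TH (X r1) (sigma (gki g n) v)).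
  rewrite !ThetaX (lin_scale _ _ incl_lin) (lin_scale _ _ (act_lin _)); congr (_ *: _).
  by rewrite -[- sigma _ _]scaleN1r (lin_add _ _ incl_lin) (lin_scale _ _ incl_lin)
    (lin_add _ _ (act_lin _)) (lin_scale _ _ (act_lin _)) scaleN1r.
rewrite -/G; set Q := qint _ _; set w1 := TH _ (sigma (gk g n) v); set w2 := TH _ (sigma (gki g n) v).
(* The corner term is split so that G^-1 disappears next to k_n^-1: one part is the telescoped sum,
   the other the term with (k_n - k_n^-1) / (q - q^-1). *)
have -> : ((q - q^-1)^-1 * Q) *: (G^-1 *: w1 - G *: w2) =
    - ((Q * ((G - G^-1) / (q - q^-1))) *: w1) + (Q * G) *: ((q - q^-1)^-1 *: (w1 - w2)).
  rewrite !scalerBr !scalerA addrA -[- (_ *: w1)]scaleNr -scalerDl.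
  by congr (_ *: _ - _ *: _); ring.
by rewrite !addrA [LHS](ACl (1*4*2*5*3)).
Qed.

End Induced.

(** Each formula describes pi_{q,V}(a) through [Theta], as the operator that the action of a on the
    induced module becomes on monomials; multiplicativity of pi_{q,V} is inherited from that of
    [act]. The first conjunct places the operators [rho a] in the quantum Weyl algebra. *)
Theorem theorem3p8
  (n m : nat) (hn : (0 < n)%N) (hm : (0 < m)%N)
  (q : CC) (hq0 : q != 0) (hq1 : q != 1) (hqm1 : q != -1)
  (U : algType CC) (g : gens U) (HU : is_Uq (n + m) q g)
  (V : lmodType CC) (sigma : U -> V -> V) (Hsigma : is_mod (Uqp n (n + m) g) sigma)
  (M : lmodType CC) (act : U -> M -> M) (incl : V -> M)
  (HM : is_induced (Uqp n (n + m) g) sigma act incl)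
  (ad : U -> U -> U) (Had : is_ad n (n + m) g ad)
  (rho : U -> Cx n m -> Cx n m) (Hrho : is_rho q g ad rho) :
  let TH := Theta q g act incl in
  let e := ge g in let f := gf g in let k := gk g in let ki := gki g in
  let E := Root q g in
  (* rho_q takes values in the quantum Weyl algebra A^q *)
  (forall a, Uql n (n + m) g a -> inAq q (rho a)) /\
  (* pi_{q,V}(a) = Theta^{-1} o (a .) o Theta is given on generators by: *)
  forall (r : 'X_{1..nv n m}) (v : V),
  let X : Cx n m := 'X_[r] in
  (* i = 1, ..., n-1 *)
  (forall i, (0 < i < n)%N ->
     act (f i) (TH X v) = TH (rho (f i) X) v + TH (rho (k i) X) (sigma (f i) v) /\
     act (e i) (TH X v) = TH (rho (e i) X) (sigma (ki i) v) + TH X (sigma (e i) v) /\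
     act (k i) (TH X v) = TH (rho (k i) X) (sigma (k i) v)) /\
  (* i = 1, ..., m-1 *)
  (forall i, (0 < i < m)%N ->
     act (f (n + i)) (TH X v) =
       TH (rho (f (n + i)) X) v + TH (rho (ki (n + i)) X) (sigma (f (n + i)) v) /\
     act (e (n + i)) (TH X v) =
       TH (rho (e (n + i)) X) (sigma (k (n + i)) v) + TH X (sigma (e (n + i)) v) /\
     act (k (n + i)) (TH X v) = TH (rho (k (n + i)) X) (sigma (k (n + i)) v)) /\
  (* f_n *)
  act (f n) (TH X v) =
    TH (xop 1 n (oprod [seq gam q 1 t | t <- iota 1 n.-1] X)) v /\
  (* k_n *)
  act (k n) (TH X v) = TH (rho (k n) X) (sigma (k n) v) /\
  (* E_{n,k}, k = 1, ..., n-1 *)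
  (forall c, (0 < c < n)%N ->
     act (E n c) (TH X v) =
       TH (rho (E n c) X) v + TH (rho (Kprod g c n) X) (sigma (E n c) v)
       + (q - q^-1) *: \sum_(c.+1 <= l < n) TH (rho (E l c * Kprod g l n) X) (sigma (E n l) v)) /\
  (* e_n *)
  act (e n) (TH X v) =
    \sum_(1 <= c < n)
       act (E n c * k n) (TH (oprod [seq gam q 1 t | t <- iota 1 c] (dop q 1 c X)) v)
    - \sum_(2 <= c < m.+1)
       TH (oprod [seq gam q t n | t <- iota c (m.+1 - c)] (dop q c n X))
          (sigma (ki n * E (n + c) (n + 1)) v)
    - \sum_(1 <= c < m.+1)
       TH (oprod ([seq gam q t n | t <- iota 1 c.-1] ++ [seq gami q t n | t <- iota c.+1 (m - c)])
                 (xop c n (dop q c n (dop q 1 n X))))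
          (sigma (k n) v)
    + TH X (sigma (e n) v)
    + TH (oprod [seq gam q t n | t <- iota 1 m] (dop q 1 n X))
         ((q - q^-1)^-1 *: (sigma (k n) v - sigma (ki n) v)).
Proof.
move=> TH e f k ki E.
have hqq : q - q^-1 != 0.
  apply: contra hq1; rewrite subr_eq0 => /eqP h.
  have : q ^+ 2 == 1 by rewrite expr2 {2}h mulfV.
  by rewrite sqrf_eq1 (negPf hqm1) orbF.
split; first by move=> a; apply: (inAq_rho hn hm hq0 hqq HU Had Hrho).
move=> r v X; split=> [i hi|].
  have hi' : (0 < i < n + m)%N by lia.
  have hin : i != n by lia.
  have kE : kap n g i = gk g i by rewrite /kap; case/andP: hi => _ ->.
  have kiE : kapi n g i = gki g i by rewrite /kapi; case/andP: hi => _ ->.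
  split; first by rewrite (act_f HM Had Hrho) // kE.
  split; first by rewrite (act_e HU HM Had Hrho) // kiE.
  by rewrite (act_k HU HM Had Hrho).
split=> [i hi|].
  have hi' : (0 < n + i < n + m)%N by lia.
  have hin : (n + i != n)%N by lia.
  have kE : kap n g (n + i) = gki g (n + i) by rewrite /kap ltnNge leq_addr.
  have kiE : kapi n g (n + i) = gk g (n + i) by rewrite /kapi ltnNge leq_addr.
  split; first by rewrite (act_f HM Had Hrho) // kE.
  split; first by rewrite (act_e HU HM Had Hrho) // kiE.
  by rewrite (act_k HU HM Had Hrho).
split; first exact: (act_fn hn hm hq0 hqq HU HM Had Hrho).
split; first by rewrite (act_k HU HM Had Hrho) //; lia.
split=> [c hc|]; first exact: (act_Root hn hm hq0 hqq HU HM Had Hrho).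
exact: (act_en hn hm hq0 hqq HU HM Had Hrho).
Qed.
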